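(* For every positive integer $q$, $$c(q,1)=\Pi(q,1)\prod_{b\in\mathbb{Z}_q^*\setminus\{1\}}\ \prod_{p\equiv b \bmod q}\Bigl(1-\frac1{p^{t_b}}\Bigr)^{-\varphi(q)/t_b},$$ where $t_b$ denotes the order of $b$ in the multiplicative group $\mathbb{Z}_q^*$ and $$\Pi(q,1)=\prod_{\substack{\chi \bmod q\\ \chi\neq\chi_0}}L(1,\chi)^{-1}.$$
   Context: Throughout, $p$ denotes a prime number, $\varphi$ is the Euler totient function, $\gamma$ is Euler's constant, $\mathbb{Z}_q^*$ is the group of reduced residue classes modulo $q$, $\chi$ ranges over Dirichlet characters modulo $q$, $\chi_0$ is the principal character modulo $q$, and $L(s,\chi)$ is the Dirichlet $L$-function of $\chi$. For $(q,a)=1$, the Mertens constant is $$C(q,a)=\lim_{x\to+\infty}(\log x)^{1/\varphi(q)}\prod_{\substack{p\le x\\ p\equiv a \bmod q}}\Bigl(1-\frac1p\Bigr),$$ a positive real number. The constant $c(q,a)$ is defined by $$C(q,a)^{\varphi(q)}=e^{-\gamma}\,\frac{q}{\varphi(q)}\,c(q,a);$$ equivalently (it is known that) $$c(q,a)=\prod_{p\nmid q}\Bigl(1-\frac1p\Bigr)^{\alpha(p;q,a)}=\lim_{x\to+\infty}\prod_{\substack{p\le x\\ p\nmid q}}\Bigl(1-\frac1p\Bigr)^{\alpha(p;q,a)},$$ where $\alpha(p;q,a)=\varphi(q)-1$ if $p\equiv a\bmod q$ and $\alpha(p;q,a)=-1$ otherwise; this product converges (conditionally) when taken over primes in increasing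 order. *)

(* Defs.v *)
From HB Require Import structures.
From mathcomp Require Import all_boot all_order all_algebra all_fingroup.
From mathcomp Require Import all_classical all_reals all_analysis.
From mathcomp Require Import complex.

Set Implicit Arguments.
Unset Strict Implicit.
Unset Printing Implicit Defensive.

Import Order.TTheory GRing.Theory Num.Theory.
Import numFieldNormedType.Exports.

Local Open Scope classical_set_scope.
Local Open Scope ring_scope.
Local Open Scope complex_scope.

Definition prime_in_class (q a p : nat) : bool :=
  prime p && (p == a %[mod q])%N.

Definition euler_gamma (R : realType) : R :=
  limn (fun n : nat => \sum_(1 <= k < n.+1) (k%:R : R)^-1 - ln (n%:R : R)).

Definition mertens_constant (R : realType) (q a : nat) : R :=
  lim ((fun x : R => ln x `^ ((totient q)%:R^-1) *
          \prod_(0 <= p < (Num.truncn x).+1 | prime_in_class q a p)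
            (1 - (p%:R)^-1)) @ +oo).

(* The solution of C(q, a) ^ phi(q) = exp (- gamma) * (q / phi(q)) * c(q, a). *)
Definition mertens_c (R : realType) (q a : nat) : R :=
  mertens_constant R q a ^+ totient q * expR (euler_gamma R)
  * ((totient q)%:R / q%:R).

(* Complete multiplicativity and [coprime 1 q] force [chi 1 = 1]. *)
Definition dirichlet_character (R : realType) (q : nat) (chi : nat -> R[i])
    : Prop :=
  [/\ forall m n, chi (m * n)%N = chi m * chi n,
      forall n, chi (n + q)%N = chi n
    & forall n, (chi n != 0) = coprime n q].

Definition principal_character (R : realType) (q : nat) (n : nat) : R[i] :=
  (coprime n q)%:R.

(* n ^ s = exp (s * ln n), for n > 0. *)
Definition natCpow (R : realType) (n : nat) (s : R[i]) : R[i] :=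
  let: u := complex.Re s * ln n%:R in
  let: v := complex.Im s * ln n%:R in
  (expR u * cos v) +i* (expR u * sin v).

(* Dirichlet series, summed in increasing order of n. For a non-principal
   character it converges to L(s, chi) on the whole half-plane Re s > 0, in
   particular (conditionally) at s = 1. The alias [R[i]^o] only serves to select
   the topology of the modulus on R[i]. *)
Definition dirichlet_L (R : realType) (s : R[i]) (chi : nat -> R[i]) : R[i] :=
  limn (fun N : nat => \sum_(1 <= n < N.+1) (chi n * natCpow n (- s)) : R[i]^o).

(* The index set is finite; [\big[_/_]_(_ \in _)] is the library's product over
   a finite classical set. *)
Definition Pi_q1 (R : realType) (q : nat) : R[i] :=
  \big[*%R/1]_(chi \in [set chi : nat -> R[i] |
      dirichlet_character q chi /\ chi <> @principal_character R q])
    (dirichlet_L 1 chi)^-1.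

(* Partial products, over the primes p < n congruent to b modulo q, of
   (1 - 1 / p ^ t) ^ (- phi(q) / t), with t = #[b] the order of b, an element
   of the group [units_Zp q] of reduced residue classes modulo q. For q = 1 the
   ring 'Z_1 is Z/2Z, but its unit group is trivial, as is that of Z/1Z. *)
Definition class_partial_prod (R : realType) (q : nat) (b : {unit 'Z_q})
    (n : nat) : R :=
  \prod_(0 <= p < n | prime_in_class q (FinRing.uval b) p)
    (1 - (p%:R ^+ #[b]%g)^-1) `^ (- ((totient q)%:R / (#[b]%g)%:R)).

(* Main.v *)
Require Import Defs.
From HB Require Import structures.
From mathcomp Require Import all_boot all_order all_algebra all_fingroup.
From mathcomp Require Import all_classical all_reals all_analysis.
From mathcomp Require Import complex.
From mathcomp Require Import separable cyclic mxrepresentation ring lra zify.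

Set Implicit Arguments.
Unset Strict Implicit.
Unset Printing Implicit Defensive.

Import Order.TTheory GRing.Theory Num.Theory.
Import numFieldNormedType.Exports.

Local Open Scope classical_set_scope.
Local Open Scope ring_scope.
Local Open Scope complex_scope.

(* Write phi for totient q. As the product of 1 - chi(p) z over all the characters is
   (1 - z ^ t) ^ (phi / t), where t is the order of p modulo q, raising the Mertens product over
   p = 1 mod q to the power phi gives the inverse of the Euler product at s = 1 of all the
   L(s, chi), truncated at x, times the partial products over the other classes b, which converge
   absolutely since t_b > 1. It remains to find the asymptotics of the logarithm E(x) of this
   truncated Euler product. For s = 1 + e > 1 the untruncated one is the product of the L(s, chi);
   its pole at s = 1 is cancelled by the factor 1 - 2 ^ (- e), whose logarithm is minus the sum of
   2 ^ (- m e) / m. So E is compared with the sum H(x) of the 1 / m over 2 ^ m <= x, that is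
   ln (ln x / ln 2) + gamma + o(1). Mertens' theorem in the class of 1, which rests on
   L(1, chi) <> 0, shows by partial summation that E(x) - H(x) converges to some y, and Abel's
   theorem identifies exp y as the limit when e tends to 0 of the product of all the
   L(1 + e, chi) by 1 - 2 ^ (- e), which is ln 2 * (phi / q) times the product of the L(1, chi)
   over the nonprincipal chi. *)

(** * Characters of a finite abelian group *)

(** Powers of two serve as a model because the weight 1 / m at 2 ^ m has two properties. First, its
    product with ln (2 ^ m) is the constant ln 2, so the weights times logarithms sum to ln N +
    O(1), exactly as phi * ln p / p does over p = 1 mod q; two weights that agree in this sense have
    a convergent difference, the factor ln n being removed by Dirichlet's test. Second, the partial
    sums of the weights are harmonic numbers, so Euler's constant enters through its definition,
    without the Gamma function or an integral.

    No logarithm of a complex number is taken: the only one used is that of the product of the Euler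
    factors over all characters, which is real, and complex identities are stated as products
    tending to 1.

    The arithmetic core is L(1, chi) <> 0. The product of all the L(1 + e, chi) leaves room for one
    zero only, hence none at a nonreal chi, whose conjugate would vanish too; the real case is
    Monsky's argument on Lambert series. Rates are kept (O(1 / N) for partial sums, O(e) near s = 1)
    because the zeros are weighed against a simple pole. *)

Lemma Xn_sub_1_roots (F : numClosedFieldType) m : (0 < m)%N ->
  exists2 rs : seq F, uniq rs & 'X^m - 1 = \prod_(r <- rs) ('X - r%:P).
Proof.
move=> m0; have [rs rsE] := closed_field_poly_normal ('X^m - 1 : {poly F}).
have lc : lead_coef ('X^m - 1 : {poly F}) = 1.
  by rewrite -polyC1 lead_coefXnsubC.
rewrite lc scale1r in rsE; exists rs => //.
rewrite -separable_prod_XsubC -rsE unlock; apply/coprimepP => d dp dp'.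
(* Separability: a common divisor of P = X^m - 1 and P' divides X P' - m P = m, a nonzero constant
   in characteristic 0. *)
have : d %| (m%:R : {poly F}).
  have -> : (m%:R : {poly F}) = 'X * ('X^m - 1)^`() - m%:R * ('X^m - 1).
    rewrite derivB derivXn -[X in _ - X^`()]polyC1 derivC subr0 mulrnAr -exprS.
    by rewrite prednK // mulr_natl mulrnBl opprB addrC subrK.
  by apply: dvdp_sub; apply: dvdp_mull.
rewrite -size_poly_eq1 -scaler_nat dvdpZr ?dvdp1 //.
by rewrite pnatr_eq0 -lt0n.
Qed.

(** The minimal polynomial divides X^m - 1, which splits with simple roots. *)
Lemma finite_order_diagonalizable (F : numClosedFieldType) n (A : 'M[F]_n) m :
  (0 < m)%N -> iter m (mulmx A) 1%:M = 1%:M -> diagonalizable A.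
Proof.
case: n A => [|n] A m0 Am.
  exists 1%:M; first exact: unitmx1.
  by apply/is_diag_mxP => -[].
apply/diagonalizableP.
have [rs urs rsE] := Xn_sub_1_roots F m0; exists rs => //.
rewrite -rsE dvd_mxminpoly rmorphB rmorph1 /= rmorphXn /= horner_mx_X.
rewrite subr_eq0; apply/eqP; rewrite -[RHS]Am.
by elim: {+}m => // k; rewrite exprS => ->.
Qed.

Lemma sum_root_unity (F : fieldType) (w : F) (t : nat) : w ^+ t = 1 ->
  \sum_(j < t) w ^+ j = if w == 1 then t%:R else 0.
Proof.
move=> wt; case: eqP => [->|/eqP w1].
  by under eq_bigr do rewrite expr1n; rewrite sumr_const card_ord.
apply: (mulfI (_ : w - 1 != 0)); first by rewrite subr_eq0.
by rewrite -subrX1 wt subrr mulr0.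
Qed.

(** The matrices of the regular representation commute and have finite order, so they are
    simultaneously diagonalizable; the characters are the diagonal entries in a common eigenbasis.
    This yields exactly as many as the order of the group, and the sum over i is the trace of the
    regular representation. *)
Lemma finite_abelian_characters (F : numClosedFieldType) (gT : finGroupType) :
  abelian [set: gT]%SET ->
  exists X : 'I_#|[set: gT]%SET| -> gT -> F,
  [/\ forall i, X i 1%g = 1,
      forall i g h, X i (g * h)%g = X i g * X i h,
      forall g, \sum_i X i g = if g == 1%g then #|[set: gT]%SET|%:R else 0,
      forall f : gT -> F, f 1%g = 1 -> (forall g h, f (g * h)%g = f g * f h) ->
        exists i, f =1 X i
    & forall i j, X i =1 X j -> i = j].
Proof.
move=> abG; set n := #|_|.
pose A (g : gT) : 'M[F]_n := regular_mx F [set: gT]%G g.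
have [A1 AM] : mx_repr [set: gT]%G A := regular_mx_repr _ _.
have AMT g h : A (g * h)%g = A g *m A h by apply: AM; rewrite inE.
have gC (g h : gT) : (g * h = h * g)%g.
  by apply: (centsP abG); rewrite inE.
have AX g k : iter k (mulmx (A g)) 1%:M = A (g ^+ k)%g.
  by elim: k => [|k IH]; rewrite ?expg0 ?A1 // iterS IH expgS AMT.
have [P Pu /allP AP] : codiagonalizable [seq A g | g : gT].
  apply/codiagonalizableP; split.
    by move=> _ _ /mapP[g _ ->] /mapP[h _ ->]; rewrite /comm_mx -!AMT gC.
  move=> _ /mapP[g _ ->]; apply: (@finite_order_diagonalizable _ _ _ #[g]%g).
    exact: order_gt0.
  by rewrite AX expg_order A1.
have /(_ _)/diagonalizable_forPex/sigW dA g := AP _ (map_f A (mem_enum _ g)).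
have [D AE] : exists D, forall g, A g = invmx P *m diag_mx (D g) *m P.
  exists (fun g => sval (dA g)) => g.
  by rewrite -conjVmx //; apply/(simmxLR Pu); exact: svalP (dA g).
pose X i g := D g 0 i.
have XE i g : X i g = (P *m A g *m invmx P) i i.
  by rewrite AE !mulmxA mulmxV // mul1mx mulmxK // mxE eqxx.
have PAdiag g : P *m A g *m invmx P = diag_mx (D g).
  by rewrite AE !mulmxA mulmxV // mul1mx mulmxK.
have X1 i : X i 1%g = 1 by rewrite XE A1 mulmx1 mulmxV // mxE eqxx.
have XM i g h : X i (g * h)%g = X i g * X i h.
  rewrite XE AMT.
  have -> : P *m (A g *m A h) *m invmx P = diag_mx (D g) *m diag_mx (D h).
    by rewrite -!PAdiag !mulmxA mulmxKV.
  by rewrite mul_diag_mx !mxE eqxx.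
have Xs g : \sum_i X i g = if g == 1%g then n%:R else 0.
  transitivity (\tr (A g)).
    by rewrite AE mxtrace_mulC mulmxA mulmxV // mul1mx mxtrace_diag.
  case: eqP => [->|/eqP g1]; first by rewrite A1 mxtrace1.
  rewrite /mxtrace big1 // => i _; rewrite !mxE.
  rewrite [_ == _ :> 'I_1]eqxx /=; case: eqP => // /(congr1 enum_val).
  rewrite gring_indexK ?inE // => /eqP.
  by rewrite -[X in X == _]mulg1 (inj_eq (mulgI _)) eq_sym (negPf g1).
have n0 : n%:R != 0 :> F by rewrite pnatr_eq0 -lt0n cardG_gt0.
(* Each multiplicative f occurs exactly once among the X i. The sum of f(g^-1) X_i(g) over i and g
   is n when summed over i first, since only g = 1 contributes; for a fixed i the sum over g is n if
   X i = f and 0 otherwise, as translating g by h multiplies it by both f h and X i h. *)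
have cntf (f : gT -> F) : f 1%g = 1 -> (forall g h, f (g * h)%g = f g * f h) ->
  #|[pred i | [forall g, X i g == f g]]| = 1%N.
  move=> f1 fM.
  have f0 g : f g != 0.
    by apply/eqP => fg; have /eqP := f1; rewrite -(mulgV g) fM fg mul0r eq_sym oner_eq0.
  have fV g : f g^-1%g = (f g)^-1.
    by apply: (mulfI (f0 g)); rewrite -fM mulgV f1 mulfV.
  have rowf i : \sum_g f g^-1%g * X i g = if [forall g, X i g == f g] then n%:R else 0.
    case: ifP => [/forallP Xf|/negbT].
      under eq_bigr => g _ do rewrite (eqP (Xf g)) fV mulVf //.
      by rewrite sumr_const /n cardsT.
    rewrite negb_forall => /existsP[h Xh].
    set S := \sum_g _; have : f h * S = X i h * S.
      rewrite [in RHS]/S (reindex_inj (mulgI h^-1%g)) /= !mulr_sumr.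
      apply: eq_bigr => g _; rewrite invMg invgK fM XM.
      have hh : X i h * X i h^-1%g = 1 by rewrite -XM mulgV X1.
      by rewrite -[LHS]mul1r -hh; ring.
    by move/eqP; rewrite -subr_eq0 -mulrBl mulf_eq0 subr_eq0 eq_sym (negPf Xh) => /eqP.
  have : \sum_i \sum_g f g^-1%g * X i g = n%:R.
    rewrite exchange_big /= (bigD1 1%g) //= [X in _ + X]big1.
      by rewrite -mulr_sumr Xs eqxx invg1 f1 mul1r addr0.
    by move=> g g1; rewrite -mulr_sumr Xs (negPf g1) mulr0.
  under eq_bigr do rewrite rowf.
  rewrite -big_mkcond /= sumr_const => /eqP.
  rewrite -[_ *+ _]mulr_natr -subr_eq0 -[X in _ - X]mulr1 -mulrBr mulf_eq0.
  rewrite (negPf n0) /= subr_eq0 pnatr_eq1 => /eqP <-.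
  by apply: eq_card => i; rewrite inE.
exists X; split=> //.
  move=> f f1 fM; have /eqP := cntf f f1 fM.
  move=> /eqP/eq_leq; have : (0 < #|[pred i | [forall g, X i g == f g]]|)%N by rewrite cntf.
  by case/card_gt0P => i; rewrite inE => /forallP Xf _; exists i => g; rewrite (eqP (Xf g)).
move=> i j Xij; have /eq_leq/card_le1_eqP := cntf (X i) (X1 i) (XM i).
by apply; rewrite inE; apply/forallP => g; rewrite ?Xij.
Qed.

(** Each X i g is a t-th root of unity, and all t of them occur equally often, n / t times; the
    product of 1 - z r over the t-th roots r is 1 - z^t. *)
Lemma prod_characters (F : numClosedFieldType) (gT : finGroupType) (n : nat)
    (X : 'I_n -> gT -> F) (g : gT) (z : F) :
  (forall i, X i 1%g = 1) ->
  (forall i g h, X i (g * h)%g = X i g * X i h) ->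
  (forall g, \sum_i X i g = if g == 1%g then n%:R else 0) ->
  (#[g]%g %| n)%N /\
  \prod_i (1 - z * X i g) = (1 - z ^+ #[g]%g) ^+ (n %/ #[g]%g).
Proof.
move=> X1 XM Xs; set t := #[g]%g; have t0 : (0 < t)%N := order_gt0 g.
have tF : t%:R != 0 :> F by rewrite pnatr_eq0 -lt0n.
have XX i k : X i (g ^+ k)%g = X i g ^+ k.
  by elim: k => [|k IH]; rewrite ?expg0 ?X1 // expgS XM IH exprS.
have Xt i : X i g ^+ t = 1 by rewrite -XX expg_order X1.
have [rs urs rsE] := Xn_sub_1_roots F t0.
have rsP r : (r \in rs) = (r ^+ t == 1).
  by rewrite -root_prod_XsubC -rsE rootE !hornerE subr_eq0.
have srs : size rs = t.
  have /(congr1 (size \o polyseq)) := rsE.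
  by rewrite /= size_prod_XsubC -polyC1 size_XnsubC // => -[].
(* The sum over j < t of (r^-1 X_i(g))^j is t times the indicator of X i g = r; after summing over i
   only j = 0 survives, because g^j <> 1 for 0 < j < t. *)
have cnt r : r \in rs -> (t * #|[pred i | X i g == r]|)%N = n.
  rewrite rsP => /eqP rt.
  have r0 : r != 0.
    by apply/eqP => r0; move/eqP: rt; rewrite r0 expr0n gtn_eqF // eq_sym oner_eq0.
  apply/eqP; rewrite -(@eqr_nat F) natrM.
  have <- : \sum_i \sum_(j < t) (r^-1 * X i g) ^+ j = n%:R.
    rewrite exchange_big /= (bigD1 (Ordinal t0)) //= [X in _ + X]big1.
      under eq_bigr do rewrite expr0.
      by rewrite sumr_const card_ord addr0.
    move=> j j0; under eq_bigr do rewrite exprMn -XX.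
    rewrite -mulr_sumr Xs -order_dvdn gtnNdvd ?mulr0 //.
    by rewrite lt0n; apply: contra j0 => /eqP j0; apply/eqP/val_inj.
  under eq_bigr => i _ do rewrite sum_root_unity ?exprMn ?Xt ?exprVn ?rt ?invr1 ?mulr1 //.
  rewrite -big_mkcond /= sumr_const mulr_natr ; apply/eqP; congr (_ *+ _).
  apply: eq_card => i; rewrite !inE -[RHS](inj_eq (mulfI r0)) mulVKf // mulr1.
  by [].
have tn : (t %| n)%N.
  have : (1 : F) \in rs by rewrite rsP expr1n.
  by move=> /cnt <-; rewrite dvdn_mulr.
split => //.
have cnt' r : r \in rs -> #|[pred i | X i g == r]| = (n %/ t)%N.
  by move=> /cnt/(congr1 (divn^~ t)) /=; rewrite mulKn.
have -> : \prod_i (1 - z * X i g) = \prod_(r <- rs) (1 - z * r) ^+ (n %/ t).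
  transitivity (\prod_i \prod_(r <- rs | X i g == r) (1 - z * r)).
    apply: eq_bigr => i _; rewrite (eq_bigl (pred1 (X i g))); last first.
      by move=> r; rewrite /= eq_sym.
    rewrite -big_filter filter_pred1_uniq ?big_seq1 //.
    by rewrite rsP Xt.
  rewrite (exchange_big_dep xpredT) //= !big_seq; apply: eq_bigr => r rrs.
  by rewrite prodr_const cnt'.
rewrite prodrXl; congr (_ ^+ _).
have [->|z0] := eqVneq z 0.
  rewrite expr0n gtn_eqF // subr0 big1 // => r _; by rewrite mul0r subr0.
(* Evaluating at z^-1 and spreading z^t over the factors turns each z^-1 - r into 1 - z r. *)
have /(congr1 (fun p => z ^+ t * p.[z^-1])) := rsE.
rewrite !hornerE horner_prod mulrBr exprVn mulfV ?expf_neq0 // mulr1 => ->.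
have zl (l : seq F) : z ^+ size l = \prod_(r <- l) z.
  by elim: l => [|r l IH]; rewrite ?big_nil ?big_cons ?expr0 // exprS IH.
rewrite -srs zl -big_split /=; apply: eq_bigr => r _.
by rewrite !hornerE mulrBr mulfV.
Qed.

(** * Partial summation and Dirichlet series *)

Lemma summation_by_parts (R : comNzRingType) (a v : nat -> R) N :
  \sum_(0 <= n < N) a n * v n =
  (\sum_(0 <= n < N) a n) * v N +
  \sum_(0 <= n < N) (\sum_(0 <= k < n.+1) a k) * (v n - v n.+1).
Proof.
elim: N => [|N IH]; first by rewrite !big_geq // mul0r addr0.
by rewrite !big_nat_recr //= IH; ring.
Qed.

Lemma telescope_sumr_lt (R : zmodType) (v : nat -> R) N :
  \sum_(0 <= n < N) (v n - v n.+1) = v 0%N - v N.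
Proof.
elim: N => [|N IH]; first by rewrite big_geq // subrr.
by rewrite big_nat_recr //= IH addrA subrK.
Qed.

Lemma abel_bound (R : realFieldType) (a v : nat -> R) (B : R) N :
  (forall n, `|\sum_(0 <= k < n) a k| <= B) ->
  (forall n, v n.+1 <= v n) -> (forall n, 0 <= v n) ->
  `|\sum_(0 <= n < N) a n * v n| <= B * v 0%N.
Proof.
move=> aB vd v0; rewrite summation_by_parts.
have -> : B * v 0%N = B * v N + \sum_(0 <= n < N) B * (v n - v n.+1).
  by rewrite -mulr_sumr telescope_sumr_lt -mulrDr addrC subrK.
apply: le_trans (ler_normD _ _) _; apply: lerD.
  by rewrite normrM (ger0_norm (v0 _)) ler_wpM2r.
apply: le_trans (ler_norm_sum _ _ _) _; apply: ler_sum => n _.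
by rewrite normrM (ger0_norm (_ : 0 <= v n - v n.+1)) ?subr_ge0 // ler_wpM2r ?subr_ge0.
Qed.

Lemma sum_nat_sub (R : zmodType) (a : nat -> R) m n : (m <= n)%N ->
  \sum_(0 <= k < n) a k - \sum_(0 <= k < m) a k = \sum_(m <= k < n) a k.
Proof. by move=> mn; rewrite (@big_cat_nat _ _ _ m 0 n) //= addrAC subrr add0r. Qed.

(** Abel's bound for the sequence shifted by M, whose partial sums are differences of two partial
    sums of a: hence 2 * B. *)
Lemma dirichlet_tail (R : realFieldType) (a v : nat -> R) (B : R) M N :
  (forall n, `|\sum_(0 <= k < n) a k| <= B) ->
  (forall n, v n.+1 <= v n) -> (forall n, 0 <= v n) ->
  `|\sum_(M <= n < N) a n * v n| <= 2 * B * v M.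
Proof.
move=> aB vd v0; have B0 : 0 <= B by apply: le_trans (aB 0%N).
have [NM|MN] := leqP N M.
  by rewrite big_geq // normr0 !mulr_ge0.
rewrite -[in X in index_iota X _](add0n M) big_addn.
apply: (@abel_bound _ (fun n => a (n + M)%N) (fun n => v (n + M)%N)) => [n|n|n] //; last exact: vd.
rewrite -[n](addnK M) -(@big_addn _ _ _ 0 (n + M) M predT a) add0n.
rewrite -sum_nat_sub ?leq_addl //.
by rewrite (le_trans (ler_normB _ _)) // mulr_natl mulr2n lerD // addnK.
Qed.

Lemma abs_summable_cvg (R : realType) (a : nat -> R) (B : R) :
  (forall n, \sum_(0 <= k < n) `|a k| <= B) -> cvgn (series a).
Proof.
move=> aB; apply: normed_cvg; apply: nondecreasing_is_cvgn.
  by move=> m n mn; rewrite /series /= -subr_ge0 sum_nat_sub // sumr_ge0.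
by exists B => _ [n _ <-]; exact: aB.
Qed.

Lemma cvg_norm_le (R : realType) (u : nat -> R) (l b : R) :
  u @ \oo --> l -> (\forall n \near \oo, `|u n| <= b) -> `|l| <= b.
Proof.
move=> /cvg_norm ul ub; rewrite -(cvg_lim _ ul) //.
by apply: limr_le => //; apply/cvg_ex; exists `|l|.
Qed.

(** Summation by parts leads to a series that converges absolutely, as the increments of v
    telescope. The explicit remainder is what later gives O(1 / N) errors for the series of L(1,
    chi). *)
Lemma dirichlet_test (R : realType) (a v : nat -> R) (B : R) :
  (forall n, `|\sum_(0 <= k < n) a k| <= B) ->
  (forall n, v n.+1 <= v n) -> (forall n, 0 <= v n) -> v @ \oo --> 0 ->
  exists2 L, series (fun n => a n * v n) @ \oo --> L &
    forall N, `|\sum_(0 <= n < N) a n * v n - L| <= 2 * B * v N.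
Proof.
move=> aB vd v0 vc; have B0 : 0 <= B by apply: le_trans (aB 0%N).
have c1 : (fun N => (\sum_(0 <= n < N) a n) * v N) @ \oo --> 0.
  apply/norm_cvg0P; apply: (@squeeze_cvgr _ _ _ _ (cst 0) (fun N => B * v N)).
  - by near=> N; rewrite normr_ge0 /= normrM (ger0_norm (v0 _)) ler_wpM2r.
  - exact: cvg_cst.
  - by rewrite -(mulr0 B); apply: cvgMr.
have c2 : cvgn (series (fun n => (\sum_(0 <= k < n.+1) a k) * (v n - v n.+1))).
  apply: (@abs_summable_cvg _ _ (B * v 0%N)) => N.
  apply: (@le_trans _ _ (\sum_(0 <= n < N) B * (v n - v n.+1))).
    apply: ler_sum => n _; rewrite normrM (ger0_norm (_ : 0 <= v n - v n.+1)) ?subr_ge0 //.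
    by rewrite ler_wpM2r ?subr_ge0.
  by rewrite -mulr_sumr telescope_sumr_lt ler_wpM2l // lerBlDr lerDl.
have c : cvgn (series (fun n => a n * v n)).
  rewrite (_ : series _ = (fun N => (\sum_(0 <= n < N) a n) * v N) \+
    series (fun n => (\sum_(0 <= k < n.+1) a k) * (v n - v n.+1))).
    by apply: is_cvgD => //; apply/cvg_ex; exists 0.
  by apply/funext => N; rewrite /series /= summation_by_parts.
exists (limn (series (fun n => a n * v n))) => // N.
rewrite distrC; apply: (@cvg_norm_le _ (fun M => series (fun n => a n * v n) M -
  \sum_(0 <= n < N) a n * v n)).
  by apply: cvgB => //; exact: cvg_cst.
near=> M; rewrite /series /= sum_nat_sub; last by near: M; exact: nbhs_infty_ge.
exact: dirichlet_tail.
Unshelve. all: by end_near. Qed.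

Lemma periodic_bound (R : realFieldType) (a : nat -> R) (M : R) q : (0 < q)%N ->
  (forall n, a (n + q)%N = a n) -> \sum_(0 <= n < q) a n = 0 ->
  (forall n, `|a n| <= M) ->
  forall N, `|\sum_(0 <= n < N) a n| <= q%:R * M.
Proof.
move=> q0 ap as0 aM; have M0 : 0 <= M by apply: le_trans (aM 0%N).
elim/ltn_ind => N IH; have [Nq|qN] := ltnP N q.
  apply: le_trans (ler_norm_sum _ _ _) _.
  apply: (@le_trans _ _ (\sum_(0 <= n < N) M)); first exact: ler_sum.
  by rewrite sumr_const_nat subn0 -[leLHS]mulr_natl ler_wpM2r // ler_nat ltnW.
rewrite (@big_cat_nat _ _ _ q 0 N) //= as0 add0r -[in X in index_iota X _](add0n q) big_addn.
by under eq_bigr do rewrite ap; apply: IH; rewrite ltn_subrL q0 (leq_trans q0).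
Qed.

(* n ^ (- e), with value 1 at n = 0 because [ln 0 = 0]. *)
Definition npow (R : realType) (e : R) (n : nat) : R := expR (- (e * ln n%:R)).

Section npow_theory.
Variable R : realType.
Implicit Types (e : R) (n : nat).

Lemma ln_nat_diff n : 0 <= (ln n.+1%:R - ln n%:R : R) <= n%:R^-1.
Proof.
case: n => [|n]; first by rewrite ln1 ln0 // subrr invr0 lexx.
rewrite subr_ge0 ler_ln ?posrE ?ltr0n // ler_nat leqnSn /=.
rewrite -ln_div ?posrE ?ltr0n // -natr1 mulrDl divff ?pnatr_eq0 // mul1r.
by apply: le_ln1Dx; rewrite (lt_le_trans (ltrN10 _)) // invr_ge0.
Qed.

(** The indicator repairs n = 0, where the left side is 1 and both logarithms vanish. *)
Lemma ln_nat_diff_ge n : n.+1%:R^-1 <= ln n.+1%:R - ln n%:R + (n == 0%N)%:R :> R.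
Proof.
case: n => [|n]; first by rewrite ln1 ln0 // subrr add0r invr1.
rewrite addr0 -lerN2 opprB -ln_div ?posrE ?ltr0n //.
have -> : n.+1%:R / n.+2%:R = 1 + - n.+2%:R^-1 :> R.
  by rewrite -[n.+1%:R](addrK 1) natr1 mulrBl divff ?pnatr_eq0 // mul1r.
by apply: le_ln1Dx; rewrite ltrN2 invf_lt1 ?ltr0n // ltr1n.
Qed.

Lemma npow_gt0 e n : 0 < npow e n. Proof. exact: expR_gt0. Qed.

Lemma npow0 e : npow e 0 = 1. Proof. by rewrite /npow ln0 // mulr0 oppr0 expR0. Qed.

Lemma npow1 e : npow e 1 = 1. Proof. by rewrite /npow ln1 mulr0 oppr0 expR0. Qed.

Lemma npow0n n : npow 0 n = 1 :> R.
Proof. by rewrite /npow mul0r oppr0 expR0. Qed.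

Lemma npowM e m n : (0 < m)%N -> (0 < n)%N -> npow e (m * n) = npow e m * npow e n.
Proof.
move=> m0 n0; rewrite /npow natrM lnM ?posrE ?ltr0n // mulrDr opprD.
exact: expRD.
Qed.

Lemma npow_le1 e n : 0 <= e -> npow e n <= 1.
Proof.
move=> e0; rewrite /npow -[leRHS]expR0 ler_expR oppr_le0 mulr_ge0 //.
case: n => [|n]; first by rewrite ln0.
by rewrite ln_ge0 // ler1n.
Qed.

Lemma npow_decr e n : 0 <= e -> npow e n.+1 <= npow e n.
Proof.
move=> e0; rewrite ler_expR lerN2 ler_wpM2l // -subr_ge0.
by have /andP[] := ln_nat_diff n.
Qed.

Lemma npow_diff_le e n : 0 <= e -> npow e n - npow e n.+1 <= e * n%:R^-1.
Proof.
move=> e0; set d := e * (ln n.+1%:R - ln n%:R).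
have dE : npow e n.+1 = npow e n * expR (- d).
  by rewrite /npow -expRD /d; congr expR; ring.
have dn : d <= e * n%:R^-1 by rewrite ler_wpM2l //; case/andP: (ln_nat_diff n).
have d0 : 0 <= d by rewrite mulr_ge0 //; case/andP: (ln_nat_diff n).
have := expR_ge1Dx (- d); have := npow_le1 n e0; have := npow_gt0 e n.
rewrite dE => p0 p1 ed.
have h1 : 1 - expR (- d) <= d by lra.
have := ler_wpM2l (ltW p0) h1; have := ler_wpM2r d0 p1.
lra.
Qed.

Lemma npow_diff_ge e n : 0 <= e -> (0 < n)%N ->
  e * (n.+1%:R^-1 * npow e n.+1) <= npow e n - npow e n.+1.
Proof.
move=> e0 n0; set d := e * (ln n.+1%:R - ln n%:R).
have dE : npow e n = npow e n.+1 * expR d.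
  by rewrite /npow -expRD /d; congr expR; ring.
have dn : e * n.+1%:R^-1 <= d.
  rewrite ler_wpM2l // (le_trans (ln_nat_diff_ge n)) // gtn_eqF //= addr0 //.
have := expR_ge1Dx d; have := npow_gt0 e n.+1.
rewrite dE => p0 ed.
have -> : e * (n.+1%:R^-1 * npow e n.+1) = npow e n.+1 * (e * n.+1%:R^-1) by ring.
have h1 : d <= expR d - 1 by lra.
apply: le_trans (ler_wpM2l (ltW p0) dn) _.
by rewrite -[X in _ - X]mulr1 -mulrBr ler_wpM2l // ltW.
Qed.

Lemma cvg_ln_nat : (fun n => ln n%:R : R) @ \oo --> +oo.
Proof.
apply/cvgryPge => A; near=> n.
rewrite -[A]expRK ler_ln ?posrE ?expR_gt0 //; last first.
  by rewrite ltr0n; near: n; exact: nbhs_infty_gt.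
by near: n; exact: nbhs_infty_ger.
Unshelve. all: by end_near. Qed.

Lemma npow_cvg0 e : 0 < e -> npow e @ \oo --> 0.
Proof.
move=> e0; apply/cvgr0Pnorm_le => d d0; near=> n.
rewrite ger0_norm; last exact: ltW (npow_gt0 _ _).
rewrite /npow -[leRHS]lnK ?posrE // ler_expR lerNl.
rewrite -ler_pdivrMl //; near: n.
by have /cvgryPge := cvg_ln_nat; apply.
Unshelve. all: by end_near. Qed.

(** Telescopes [npow_diff_ge], which plays the part of the integral of x^(-1-e) beyond M. *)
Lemma npow_tail e M N : 0 < e -> (0 < M)%N ->
  \sum_(M.+1 <= n < N) n%:R^-1 * npow e n <= npow e M / e.
Proof.
move=> e0 M0; rewrite ler_pdivlMr // mulrC mulr_sumr.
have [NM|MN] := leqP N M.+1; first by rewrite big_geq //; exact: ltW (npow_gt0 _ _).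
have -> : N = ((N - M.+1) + M.+1)%N by rewrite subnK // ltnW.
elim: (N - _)%N => [|k IH]; first by rewrite add0n big_geq //; exact: ltW (npow_gt0 _ _).
suff : forall k, \sum_(M.+1 <= i < k + M.+1) e * (i%:R^-1 * npow e i) <= npow e M - npow e (k + M).
  by move=> /(_ k.+1)/le_trans; apply; rewrite lerBlDr lerDl; exact: ltW (npow_gt0 _ _).
elim=> [|j IHj]; first by rewrite add0n big_geq // subrr.
rewrite addSn big_nat_recr ?leq_addl //= addSnnS.
have := @npow_diff_ge e (j + M)%N (ltW e0).
rewrite addn_gt0 M0 orbT -addnS => /(_ isT).
lra.
Qed.

End npow_theory.

Lemma summation_by_parts_sub (R : comNzRingType) (a v : nat -> R) (T : R) N :
  \sum_(0 <= n < N) a n * v n - T * v 0%N =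
  (\sum_(0 <= n < N) a n - T) * v N +
  \sum_(0 <= n < N) (\sum_(0 <= k < n.+1) a k - T) * (v n - v n.+1).
Proof.
rewrite summation_by_parts.
under [X in _ = _ + X]eq_bigr do rewrite mulrBl.
by rewrite sumrB -mulr_sumr telescope_sumr_lt; ring.
Qed.

Lemma sum_inv_prod (R : realFieldType) N :
  \sum_(0 <= n < N) (n.+1%:R^-1 * n%:R^-1 : R) <= 1.
Proof.
case: N => [|N]; first by rewrite big_geq.
suff -> : \sum_(0 <= n < N.+1) (n.+1%:R^-1 * n%:R^-1 : R) = 1 - N.+1%:R^-1.
  by rewrite gerBl.
elim: N => [|N IH]; first by rewrite big_nat1 invr0 mulr0 invr1 subrr.
rewrite big_nat_recr //= IH.
have h1 : (N.+1%:R : R) != 0 by rewrite pnatr_eq0.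
have h2 : (N.+2%:R : R) != 0 by rewrite pnatr_eq0.
have e2 : (N.+2%:R : R) = N.+1%:R + 1 by rewrite natr1.
have key (x : R) : x != 0 -> x + 1 != 0 -> 1 - x^-1 + (x + 1)^-1 * x^-1 = 1 - (x + 1)^-1.
  by move=> x0 x1; field; rewrite x0 x1.
by rewrite e2 key // -e2.
Qed.

Lemma sum_inv_sqr_tail (R : realFieldType) M N : (0 < M)%N ->
  \sum_(M.+1 <= n < N) (n%:R^-1 ^+ 2 : R) <= M%:R^-1.
Proof.
move=> M0; have [NM|MN] := leqP N M.+1; first by rewrite big_geq.
rewrite -(subnK (ltnW MN)); move: (N - M.+1)%N => k.
suff : \sum_(M.+1 <= n < k + M.+1) (n%:R^-1 ^+ 2 : R) <= M%:R^-1 - (k + M)%:R^-1.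
  by move=> /le_trans; apply; rewrite gerBl.
elim: k => [|k IH]; first by rewrite add0n big_geq // subrr.
rewrite addSn big_nat_recr ?leq_addl //= addSnnS.
rewrite addnS; have := IH; rewrite addnS; move: (k + M)%N (leq_addl k M) => j Mj h.
have j0 : 0 < (j%:R : R) by rewrite ltr0n (leq_trans M0).
have e2 : (j.+1%:R : R) = j%:R + 1 by rewrite natr1.
apply: (@le_trans _ _ (M%:R^-1 - j%:R^-1 + (j%:R^-1 - j.+1%:R^-1))); last by rewrite addrA subrK.
rewrite lerD // e2 expr2 -subr_ge0.
have -> : j%:R^-1 - (j%:R + 1)^-1 - (j%:R + 1)^-1 * (j%:R + 1)^-1 =
  (j%:R^-1 * (j%:R + 1)^-1 * (j%:R + 1)^-1 : R).
  have key (x : R) : x != 0 -> x + 1 != 0 -> x^-1 - (x + 1)^-1 - (x + 1)^-1 * (x + 1)^-1 =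
      x^-1 * (x + 1)^-1 * (x + 1)^-1.
    by move=> x0 x1; field; rewrite x0 x1.
  by rewrite key // gt_eqF //; lra.
by rewrite !mulr_ge0 // invr_ge0; lra.
Qed.

(** Beyond n0 the partial sums stay within d of T, and the decrements of [npow e] add up to at most
    1; each earlier decrement is at most e. So C and n0 depend on d alone, and the limits in e and N
    can later be interchanged. *)
Lemma abel_uniform (R : realType) (a : nat -> R) (T : R) : series a @ \oo --> T ->
  forall d, 0 < d -> exists C n0, forall N e, (n0 <= N)%N -> 0 <= e ->
    `|\sum_(0 <= n < N) a n * npow e n - T| <= C * e + d.
Proof.
move=> /cvgrPdist_le aT d d0; have [n0 _ an0] := aT d d0.
set A := fun n => \sum_(0 <= k < n) a k.
have AT n : (n0 <= n)%N -> `|A n - T| <= d by rewrite distrC; exact: an0.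
exists (\sum_(0 <= n < n0) `|A n.+1 - T|), n0 => N e nN e0.
have := summation_by_parts_sub a (npow e) T N; rewrite npow0 mulr1 => ->.
have w0 n : 0 <= npow e n - npow e n.+1 by rewrite subr_ge0 npow_decr.
have w1 n : npow e n - npow e n.+1 <= e.
  apply: le_trans (npow_diff_le n e0) _; rewrite ler_piMr //.
  by case: n => [|n]; rewrite ?invr0 ?ler01 // invf_le1 ?ltr0n // ler1n.
apply: le_trans (ler_normD _ _) _; rewrite normrM (ger0_norm (ltW (npow_gt0 _ _))).
have h1 := ler_wpM2r (ltW (npow_gt0 e N)) (AT N nN).
suff : `|\sum_(0 <= n < N) (A n.+1 - T) * (npow e n - npow e n.+1)| <=
    (\sum_(0 <= n < n0) `|A n.+1 - T|) * e + d * (1 - npow e N).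
  by move: h1; rewrite /A mulrBr mulr1; set x := `|_|; set y := `|_|; lra.
rewrite (@big_cat_nat _ _ _ n0 0 N) //=; apply: le_trans (ler_normD _ _) _.
apply: lerD.
  apply: le_trans (ler_norm_sum _ _ _) _; rewrite mulr_suml.
  by apply: ler_sum => n _; rewrite normrM (ger0_norm (w0 n)) ler_wpM2l.
apply: le_trans (ler_norm_sum _ _ _) _.
apply: (@le_trans _ _ (\sum_(n0 <= n < N) d * (npow e n - npow e n.+1))).
  rewrite !big_nat; apply: ler_sum => n /andP[n0n _].
  by rewrite normrM (ger0_norm (w0 n)) ler_wpM2r // AT // ltnW.
rewrite -mulr_sumr ler_wpM2l ?(ltW d0) // -sum_nat_sub // !telescope_sumr_lt npow0.
by have := npow_le1 n0 e0; lra.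
Qed.

(** The partial sums are off by C / (n + 1) and the decrements of [npow e] are at most e / n; as the
    sum of 1 / (n (n + 1)) is at most 1, the error is linear in e, up to the boundary term. *)
Lemma abel_lipschitz (R : realType) (a : nat -> R) (T C : R) :
  (forall N, `|\sum_(0 <= n < N.+1) a n - T| <= C * N.+1%:R^-1) ->
  forall N e, 0 <= e ->
  `|\sum_(0 <= n < N.+1) a n * npow e n - T| <= C * N.+1%:R^-1 + C * e.
Proof.
move=> aT N e e0.
have C0 : 0 <= C by have := le_trans (normr_ge0 _) (aT 0%N); rewrite invr1 mulr1.
have := summation_by_parts_sub a (npow e) T N.+1; rewrite npow0 mulr1 => ->.
apply: le_trans (ler_normD _ _) _; apply: lerD.
  rewrite normrM (ger0_norm (ltW (npow_gt0 _ _))).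
  rewrite -[leRHS]mulr1; apply: ler_pM => //; first exact: ltW (npow_gt0 _ _).
  exact: npow_le1.
apply: le_trans (ler_norm_sum _ _ _) _.
apply: (@le_trans _ _ (\sum_(0 <= n < N.+1) C * e * (n.+1%:R^-1 * n%:R^-1))).
  apply: ler_sum => n _; rewrite normrM (ger0_norm (_ : 0 <= npow e n - npow e n.+1)).
    rewrite mulrACA; apply: ler_pM => //; first by rewrite subr_ge0 npow_decr.
    exact: npow_diff_le.
  by rewrite subr_ge0 npow_decr.
by rewrite -mulr_sumr ler_piMr ?mulr_ge0 // sum_inv_prod.
Qed.

Lemma ln_le_nat (R : realType) n : ln n%:R <= n%:R :> R.
Proof.
case: n => [|n]; first by rewrite ln0.
by rewrite ltW // ln_sublinear.
Qed.

Lemma ln_nat_ge0 (R : realType) n : 0 <= ln n%:R :> R.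
Proof.
case: n => [|n]; first by rewrite ln0.
by rewrite ln_ge0 // ler1n.
Qed.

(** Summation by parts against ln, whose increments are at most 1 / n; the boundary term and the sum
    cost C each. For a n = chi n / n these are, up to sign, the partial sums of L'(1, chi). *)
Lemma sum_mul_ln_bounded (R : realType) (a : nat -> R) (T C : R) :
  (forall N, `|\sum_(0 <= n < N.+1) a n - T| <= C * N.+1%:R^-1) ->
  forall N, `|\sum_(0 <= n < N) a n * ln n%:R| <= 2 * C.
Proof.
move=> aT [|N].
  rewrite big_geq // normr0 mulr_ge0 //.
  by have := le_trans (normr_ge0 _) (aT 0%N); rewrite invr1 mulr1.
have C0 : 0 <= C by have := le_trans (normr_ge0 _) (aT 0%N); rewrite invr1 mulr1.
have := summation_by_parts_sub a (fun n => ln n%:R) T N.+1.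
rewrite ln0 // mulr0 subr0 => ->.
apply: le_trans (ler_normD _ _) _; rewrite mulr_natl mulr2n; apply: lerD.
  rewrite normrM (ger0_norm (ln_nat_ge0 _ _)).
  have -> : C = C * N.+1%:R^-1 * N.+1%:R by rewrite mulfVK ?pnatr_eq0.
  by apply: ler_pM => //; [exact: ln_nat_ge0|exact: ln_le_nat].
apply: le_trans (ler_norm_sum _ _ _) _.
apply: (@le_trans _ _ (\sum_(0 <= n < N.+1) C * (n.+1%:R^-1 * n%:R^-1))).
  apply: ler_sum => n _; rewrite normrM mulrA; apply: ler_pM => //.
  by have /andP[? ?] := ln_nat_diff R n; rewrite distrC ger0_norm.
by rewrite -mulr_sumr ler_piMr // sum_inv_prod.
Qed.

(** * The simple pole of the zeta function at s = 1 *)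

Section zeta.
Variables (R : realType) (e : R).
Hypothesis e0 : 0 < e.

Lemma zeta_partial_le N : \sum_(0 <= n < N) n%:R^-1 * npow e n <= 1 + e^-1.
Proof.
have e1 : 0 <= e^-1 by rewrite invr_ge0 ltW.
case: N => [|[|N]]; first by rewrite big_geq // addr_ge0.
  by rewrite big_nat1 invr0 mul0r addr_ge0.
rewrite !big_nat_recl //= invr0 mul0r add0r invr1 npow1 mul1r lerD2l.
by have := npow_tail N.+2 e0 (ltn0Sn 0); rewrite npow1 mul1r !big_add1 /=.
Qed.

Lemma zeta_partial_ge N : 1 - npow e N <= e * \sum_(0 <= n < N) n%:R^-1 * npow e n.
Proof.
have := telescope_sumr_lt (npow e) N; rewrite npow0 => <-.
rewrite mulr_sumr; apply: ler_sum => n _.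
case: n => [|n]; first by rewrite npow0 npow1 subrr invr0 mul0r mulr0.
have := @npow_diff_le _ e n.+1 (ltW e0) => h; apply: le_trans (_ : _ <= npow e n.+1 * (e * n.+1%:R^-1)) _; last first.
  by rewrite mulrCA [npow e n.+1 * _]mulrC.
set d := e * (ln n.+2%:R - ln n.+1%:R).
have dE : npow e n.+2 = npow e n.+1 * expR (- d).
  by rewrite /npow -expRD /d; congr expR; ring.
have dn : d <= e * n.+1%:R^-1.
  by rewrite ler_wpM2l ?(ltW e0) //; case/andP: (ln_nat_diff R n.+1).
have := expR_ge1Dx (- d); rewrite dE => h1.
rewrite -[X in X - _]mulr1 -mulrBr ler_wpM2l ?(ltW (npow_gt0 _ _)) //.
by apply: le_trans dn; rewrite lerBlDr -lerBlDl.
Qed.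

Lemma dirichlet_series_cvg (a : nat -> R) : (forall n, `|a n| <= 1) ->
  cvgn (series (fun n => a n * (n%:R^-1 * npow e n))).
Proof.
move=> a1; apply: (@abs_summable_cvg _ _ (1 + e^-1)) => N.
apply: le_trans (zeta_partial_le N); apply: ler_sum => n _.
have h : 0 <= n%:R^-1 * npow e n by rewrite mulr_ge0 ?invr_ge0 // ltW ?npow_gt0.
by rewrite normrM (ger0_norm h) ler_piMl.
Qed.

(** Telescoping n^(-e) bounds the partial sums on both sides, in place of a comparison with an
    integral. *)
Lemma zeta_residue : exists2 Z,
  series (fun n => n%:R^-1 * npow e n) @ \oo --> Z & 1 <= e * Z <= 1 + e.
Proof.
have c : cvgn (series (fun n => n%:R^-1 * npow e n)).
  have := @dirichlet_series_cvg (fun _ => 1); under eq_fun do rewrite mul1r.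
  by apply; rewrite normr1.
exists (limn (series (fun n => n%:R^-1 * npow e n))) => //.
have -> : 1 + e = e * (1 + e^-1) by rewrite mulrDr mulr1 mulfV ?gt_eqF // addrC.
apply/andP; split; last first.
  by rewrite ler_wpM2l ?(ltW e0) //; apply: limr_le => //; near=> N; exact: zeta_partial_le.
have c1 : (fun N => 1 - npow e N) @ \oo --> (1 : R).
  by rewrite -[X in _ --> X](subr0 (1 : R)); apply: cvgB; [exact: cvg_cst|exact: npow_cvg0].
have c2 : (fun N => e * series (fun n => n%:R^-1 * npow e n) N) @ \oo -->
  e * limn (series (fun n => n%:R^-1 * npow e n)) by apply: cvgMr.
apply: (ler_cvg_to c1 c2); near=> N; exact: zeta_partial_ge.
Unshelve. all: by end_near. Qed.

End zeta.

(** * Chebyshev's and Mertens' estimates *)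

Lemma sum_multiples (V : nmodType) (d N : nat) (g : nat -> V) : (0 < d)%N ->
  \sum_(1 <= n < N.+1 | (d %| n)%N) g n = \sum_(1 <= m < (N %/ d).+1) g (d * m)%N.
Proof.
move=> d0; elim: N => [|N IH]; first by rewrite div0n !big_geq.
rewrite big_mkcond big_nat_recr //= -big_mkcond IH divnS //.
have [dN|_] := boolP (d %| N.+1)%N; last by rewrite addr0 add0n.
rewrite add1n [in RHS]big_nat_recr //=; congr (_ + g _).
by have := divnK dN; rewrite divnS // dN add1n mulnC.
Qed.

Lemma sum_divisor_pairs (V : nmodType) (N : nat) (F : nat -> nat -> V) :
  \sum_(1 <= n < N.+1) \sum_(1 <= d < N.+1 | (d %| n)%N) F d n =
  \sum_(1 <= d < N.+1) \sum_(1 <= m < (N %/ d).+1) F d (d * m)%N.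
Proof.
under eq_bigr do rewrite big_mkcond.
rewrite exchange_big_nat /=; rewrite !big_nat; apply: eq_bigr => d /andP[d0 _].
by rewrite -big_mkcond sum_multiples.
Qed.

Lemma sum_divisors_widen (V : nmodType) (n N : nat) (F : nat -> V) : (0 < n <= N)%N ->
  \sum_(1 <= d < N.+1 | (d %| n)%N) F d = \sum_(1 <= d < n.+1 | (d %| n)%N) F d.
Proof.
move=> /andP[n0 nN]; rewrite (@big_cat_nat _ _ _ n.+1 1 N.+1) //=.
rewrite [X in _ + X]big_nat_cond [X in _ + X]big1 ?addr0 // => d /andP[/andP[nd _] dn].
by have := dvdn_leq n0 dn; rewrite leqNgt nd.
Qed.

Section mangoldt.
Variable R : realType.

(** At most one pair (p, k) contributes. Writing a double sum rather than a case distinction on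
    prime powers reduces [sum_mangoldt] to an exchange of sums. *)
Definition mangoldt (d : nat) : R :=
  \sum_(0 <= p < d.+1 | prime p) \sum_(1 <= k < d.+1 | (p ^ k == d)%N) ln p%:R.

Lemma mangoldt_ge0 d : 0 <= mangoldt d.
Proof. by rewrite !sumr_ge0 // => p _; rewrite sumr_ge0 // => k _; exact: ln_nat_ge0. Qed.

Lemma mangoldt_widen d N : (d <= N)%N -> mangoldt d =
  \sum_(0 <= p < N.+1 | prime p) \sum_(1 <= k < N.+1 | (p ^ k == d)%N) ln p%:R.
Proof.
move=> dN; rewrite [RHS](@big_cat_nat _ _ _ d.+1 0 N.+1) //=.
rewrite [X in _ = _ + X]big_nat_cond [X in _ = _ + X]big1 ?addr0; last first.
  move=> p /andP[/andP[dp _] pp]; rewrite big_nat_cond big1 // => k /andP[/andP[k0 _] /eqP pk].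
  have := leq_trans dp (leq_pexp2l (prime_gt0 pp) k0).
  by rewrite pk ltnn.
apply: eq_bigr => p pp; case: d dN => [|d] dN.
  have pk k : (p ^ k == 0)%N = false by rewrite expn_eq0 eqn0Ngt prime_gt0.
  by rewrite [LHS]big1 ?[RHS]big1 // => k; rewrite pk.
rewrite [RHS](@big_cat_nat _ _ _ d.+2 1 N.+1) //=.
rewrite [X in _ = _ + X]big_nat_cond [X in _ = _ + X]big1 ?addr0 //.
move=> k /andP[/andP[dk _] /eqP pk].
by have := ltn_trans dk (ltn_expl k (prime_gt1 pp)); rewrite pk ltnn.
Qed.

Lemma sum_mangoldt N (f : nat -> R) :
  \sum_(1 <= d < N.+1) mangoldt d * f d =
  \sum_(0 <= p < N.+1 | prime p) \sum_(1 <= k < N.+1 | (p ^ k <= N)%N) ln p%:R * f (p ^ k)%N.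
Proof.
transitivity (\sum_(1 <= d < N.+1) \sum_(0 <= p < N.+1 | prime p)
    \sum_(1 <= k < N.+1 | (p ^ k == d)%N) ln p%:R * f d).
  rewrite !big_nat; apply: eq_bigr => d /andP[_ dN].
  rewrite (@mangoldt_widen d N) // mulr_suml; apply: eq_bigr => p _.
  by rewrite mulr_suml.
rewrite exchange_big /=; apply: eq_bigr => p pp.
under eq_bigr do rewrite big_mkcond.
rewrite exchange_big [RHS]big_mkcond /=; apply: eq_bigr => k _.
rewrite -big_mkcond /=; case: ifP => pkN.
  rewrite (eq_bigl (pred1 (p ^ k)%N)); last by move=> d /=; rewrite eq_sym.
  rewrite -big_filter filter_pred1_uniq ?iota_uniq ?big_seq1 //.
  by rewrite mem_index_iota expn_gt0 prime_gt0 //= ltnS.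
rewrite big_nat_cond big1 // => d /andP[/andP[_ dN] /eqP pk].
by move: dN; rewrite ltnS -pk pkN.
Qed.

Lemma mangoldt_prime p : prime p -> mangoldt p = ln p%:R.
Proof.
move=> pp; rewrite /mangoldt big_mkcond (bigD1_seq p) ?iota_uniq ?mem_index_iota //=.
rewrite pp big_mkcond (bigD1_seq 1%N) ?iota_uniq ?mem_index_iota //=; last first.
  by rewrite ltnS prime_gt0.
rewrite expn1 eqxx big1 ?addr0; last first.
  move=> k /negP k1; case: eqP => // /eqP pk; case: k1.
  by rewrite -(eqn_exp2l k 1 (prime_gt1 pp)) expn1 pk.
rewrite big1 ?addr0 // => p' np; case: ifP => // pp'.
rewrite big_nat_cond big1 // => k /andP[/andP[k0 _] /eqP pk].
have : (p' %| p)%N by rewrite -pk dvdn_exp.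
by rewrite dvdn_prime2 // (negPf np).
Qed.

Lemma ln_prod_primes n : (0 < n)%N ->
  ln n%:R = \sum_(0 <= p < n.+1 | prime p) (logn p n)%:R * ln p%:R :> R.
Proof.
move=> n0; rewrite -{1}(partnT n0) /partn.
have -> : (\prod_(0 <= p < n.+1 | p \in predT) p ^ logn p n =
  \prod_(0 <= p < n.+1 | prime p) p ^ logn p n)%N.
  rewrite [RHS]big_mkcond; apply: eq_bigr => p _; case: ifP => // pp.
  by rewrite lognE pp.
apply: (proj2 (_ : (0 < _)%N /\ ln _%:R = _)).
apply: (big_rec2 (fun (x : nat) (y : R) => (0 < x)%N /\ ln x%:R = y)).
  by rewrite ln1.
move=> p x y pp [x0 <-]; have pk0 : (0 < p ^ logn p n)%N by rewrite expn_gt0 prime_gt0.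
split; first by rewrite muln_gt0 pk0.
by rewrite natrM lnM ?posrE ?ltr0n // natrX lnXn ?ltr0n ?prime_gt0 // mulr_natl.
Qed.

Lemma sum_mangoldt_divisors n : (0 < n)%N ->
  \sum_(1 <= d < n.+1 | (d %| n)%N) mangoldt d = ln n%:R.
Proof.
move=> n0; rewrite big_mkcond.
rewrite (eq_bigr (fun d => mangoldt d * (d %| n)%:R)); last first.
  by move=> d _; case: ifP; rewrite ?mulr1 ?mulr0.
rewrite sum_mangoldt ln_prod_primes //; apply: eq_bigr => p pp.
rewrite -mulr_sumr mulrC; congr (_ * _).
rewrite (eq_bigr (fun k => if (k <= logn p n)%N then 1 else 0)); last first.
  by move=> k _; rewrite pfactor_dvdn //; case: ifP.
rewrite big_mkcond /=.
rewrite (@big_cat_nat _ _ _ (logn p n).+1 1 n.+1) //= ?ltnS; last first.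
  by apply: leq_trans (ltnW (ltn_logl p n0)) _.
rewrite [X in _ + X]big_nat [X in _ + X]big1 ?addr0; last first.
  by move=> k /andP[lk _]; rewrite (ltn_geF lk) if_same.
rewrite big_nat (eq_bigr (fun _ => 1)); last first.
  move=> k /andP[k0 kl]; have kl' : (k <= logn p n)%N by rewrite -ltnS.
  by rewrite kl' (dvdn_leq n0) // pfactor_dvdn.
by rewrite -big_nat sumr_const_nat subn1.
Qed.

Lemma sum_ln_mangoldt (f : nat -> R) N :
  \sum_(1 <= n < N.+1) f n * ln n%:R =
  \sum_(1 <= d < N.+1) mangoldt d * \sum_(1 <= m < (N %/ d).+1) f (d * m)%N.
Proof.
under [RHS]eq_bigr do rewrite mulr_sumr.
rewrite -(sum_divisor_pairs N (fun d n => mangoldt d * f n)) !big_nat.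
apply: eq_bigr => n /andP[n0 nN].
by rewrite -mulr_suml sum_divisors_widen ?n0 // sum_mangoldt_divisors // mulrC.
Qed.

Definition lnfact N : R := \sum_(1 <= n < N.+1) ln n%:R.

(** Legendre's formula for the factorial, in logarithmic form. *)
Lemma lnfactE N : lnfact N = \sum_(1 <= d < N.+1) mangoldt d * (N %/ d)%:R.
Proof.
rewrite /lnfact; under eq_bigr do rewrite -[ln _]mul1r.
rewrite (sum_ln_mangoldt (fun _ => 1)).
by apply: eq_bigr => d _; rewrite sumr_const_nat subn1.
Qed.

Lemma lnfactS N : lnfact N.+1 = lnfact N + ln N.+1%:R.
Proof. by rewrite /lnfact big_nat_recr. Qed.

Lemma lnfact_ge N : N%:R * ln N%:R - N%:R <= lnfact N.
Proof.
elim: N => [|N IH]; first by rewrite /lnfact big_geq // mul0r subr0.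
rewrite lnfactS; have /andP[_] := ln_nat_diff R N.
move=> /(ler_wpM2l (ler0n R N)) h.
have h1 : (N%:R * N%:R^-1 : R) <= 1.
  by case: N {IH h} => [|N]; rewrite ?mul0r // mulfV ?pnatr_eq0.
rewrite -[N.+1%:R]natr1 !mulrDl mul1r in h *; lra.
Qed.

Lemma lnfact_le N : lnfact N <= N%:R * ln N%:R.
Proof.
case: N => [|N]; first by rewrite /lnfact big_geq // mul0r.
apply: (@le_trans _ _ (\sum_(1 <= n < N.+2) ln N.+1%:R)).
  rewrite /lnfact !big_nat; apply: ler_sum => n /andP[n0 nN].
  by rewrite ler_ln ?posrE ?ltr0n // ler_nat.
by rewrite sumr_const_nat subn1 mulr_natl.
Qed.

(** The left side is the logarithm of the central binomial coefficient, bounded by 4^M: passing to M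
    + 1 multiplies it by (2M + 1)(2M + 2) / (M + 1)^2 <= 4. *)
Lemma lnfact_double M : lnfact M.*2 - 2 * lnfact M <= M%:R * (2 * ln 2).
Proof.
elim: M => [|M IH]; first by rewrite /lnfact !big_geq // mul0r mulr0 subrr.
rewrite doubleS !lnfactS.
have e2 : ln M.*2.+2%:R = ln 2 + ln M.+1%:R :> R.
  by rewrite -doubleS -mul2n natrM lnM ?posrE ?ltr0n.
have h : ln M.*2.+1%:R <= ln M.*2.+2%:R :> R.
  by rewrite ler_ln ?posrE ?ltr0n // ler_nat.
rewrite -[M.+1%:R in leRHS]natr1 mulrDl mul1r; rewrite e2 in h *; lra.
Qed.

Definition chebyshev_psi N : R := \sum_(1 <= d < N.+1) mangoldt d.

Lemma chebyshev_psi_homo M N : (M <= N)%N -> chebyshev_psi M <= chebyshev_psi N.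
Proof.
move=> MN; rewrite /chebyshev_psi [leRHS](@big_cat_nat _ _ _ M.+1 1 N.+1) //=.
by rewrite lerDl sumr_ge0 // => d _; exact: mangoldt_ge0.
Qed.

(** The coefficient floor(2M / d) - 2 floor(M / d) of [mangoldt d] on the right is never negative,
    and is at least 1 for M < d <= 2M. *)
Lemma chebyshev_psi_double M :
  chebyshev_psi M.*2 - chebyshev_psi M <= lnfact M.*2 - 2 * lnfact M.
Proof.
have -> : lnfact M = \sum_(1 <= d < M.*2.+1) mangoldt d * (M %/ d)%:R.
  rewrite lnfactE [RHS](@big_cat_nat _ _ _ M.+1 1 M.*2.+1) //= ?ltnS -?addnn ?leq_addr //.
  rewrite [X in _ = _ + X]big_nat [X in _ = _ + X]big1 ?addr0 //.
  by move=> d /andP[Md _]; rewrite divn_small // mulr0.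
have -> : chebyshev_psi M = \sum_(1 <= d < M.*2.+1) mangoldt d * (d <= M)%:R.
  rewrite /chebyshev_psi [RHS](@big_cat_nat _ _ _ M.+1 1 M.*2.+1) //= ?ltnS -?addnn ?leq_addr //.
  rewrite [X in _ = _ + X]big_nat [X in _ = _ + X]big1 ?addr0; last first.
    by move=> d /andP[Md _]; rewrite leqNgt Md mulr0.
  by rewrite !big_nat; apply: eq_bigr => d /andP[_]; rewrite ltnS => ->; rewrite mulr1.
rewrite lnfactE mulr_sumr -!sumrB; rewrite !big_nat; apply: ler_sum => d /andP[d0 dM].
rewrite mulrCA -[X in X - _]mulr1 -!mulrBr ler_wpM2l ?mangoldt_ge0 //.
have h : (2 * (M %/ d) + 1 <= M.*2 %/ d + (d <= M))%N.
  rewrite -mul2n; case: (leqP d M) => [dM'|Md]; last first.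
    by rewrite (divn_small Md) muln0 add0n addn0 leq_divRL // mul1n mul2n -ltnS.
  by rewrite leq_add2r leq_divRL // -mulnA leq_mul2l /= leq_trunc_div.
have : ((2 * (M %/ d) + 1)%N%:R : R) <= (M.*2 %/ d + (d <= M))%N%:R by rewrite ler_nat.
rewrite natrD natrM [X in _ <= X]natrD; lra.
Qed.

Lemma ln2_le1 : ln 2 <= 1 :> R.
Proof. by have := @le_ln1Dx R 1; rewrite (_ : 1 + 1 = 2) //; apply; lra. Qed.

(** Doubling gives psi(2^k) <= 2^k * 2 ln 2. The next power of two above N is at most 2 N, and ln 2
    <= 1, whence the constant 4. *)
Lemma chebyshev_psi_le N : chebyshev_psi N <= 4 * N%:R.
Proof.
have ln2 : 0 <= ln 2 :> R by apply: ln_ge0; lra.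
have h k : chebyshev_psi (2 ^ k) <= (2 ^ k)%:R * (2 * ln 2).
  elim: k => [|k IH].
    rewrite /chebyshev_psi big_nat1 /mangoldt /= big_mkcond !big_nat_recl //= big_geq //.
    by rewrite !addr0 !mulr_ge0.
  have := chebyshev_psi_double (2 ^ k); have := lnfact_double (2 ^ k).
  rewrite -mul2n -expnS (expnS 2 k) natrM; move: IH.
  by set x := chebyshev_psi _; set y := chebyshev_psi _; set z := (2 ^ k)%:R; lra.
case: N => [|N]; first by rewrite /chebyshev_psi big_geq // mulr0.
have /andP[l1 l2] := @trunc_log_bounds 2 N.+1 isT isT.
apply: le_trans (chebyshev_psi_homo (ltnW l2)) _.
apply: le_trans (h _) _; rewrite expnS natrM.
have h1 : (2 ^ trunc_log 2 N.+1)%:R <= N.+1%:R :> R by rewrite ler_nat.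
have h2 := ler_wpM2l (_ : 0 <= (2 ^ trunc_log 2 N.+1)%:R) ln2_le1.
move: h2 => /(_ (ler0n _ _)) h2; lra.
Qed.

(** In ln N!, [mangoldt d] has coefficient floor(N / d), off from N / d by less than 1, so N times
    the sum exceeds ln N! by at most psi(N). The -1 comes from the weak Stirling bound, the 4 from
    Chebyshev. *)
Lemma mertens_first N : (0 < N)%N ->
  ln N%:R - 1 <= \sum_(1 <= d < N.+1) mangoldt d * d%:R^-1 <= ln N%:R + 4.
Proof.
move=> N0; have NR : 0 < N%:R :> R by rewrite ltr0n.
set S := \sum_(_ <= d < _) _.
have h1 : lnfact N <= N%:R * S.
  rewrite lnfactE mulr_sumr !big_nat; apply: ler_sum => d /andP[d0 _].
  rewrite mulrCA ler_wpM2l ?mangoldt_ge0 // ler_pdivlMr ?ltr0n // -natrM ler_nat.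
  exact: leq_trunc_div.
have h2 : N%:R * S <= lnfact N + chebyshev_psi N.
  rewrite lnfactE mulr_sumr -big_split /= !big_nat; apply: ler_sum => d /andP[d0 _].
  rewrite mulrCA -[X in _ + X]mulr1 -mulrDr ler_wpM2l ?mangoldt_ge0 //.
  rewrite ler_pdivrMr ?ltr0n // natr1 -natrM ler_nat ltnW // ltn_ceil //.
have h3 := chebyshev_psi_le N; have h4 := lnfact_ge N; have h5 := lnfact_le N.
apply/andP; split; rewrite -(ler_pM2l NR) ?mulrBr ?mulrDr ?mulr1; lra.
Qed.

Lemma sum_ln_inv_prod N : \sum_(1 <= n < N) ln n.+1%:R * (n.+1%:R^-1 * n%:R^-1) <= 2 :> R.
Proof.
case: N => [|N]; first by rewrite big_geq.
(* The induction needs an explicit majorant, modelled on the primitive -(ln x + 1) / x of ln x /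
   x^2; the 2 gives enough slack, the step reducing to (ln (x + 1) - ln x) (x + 1) <= 2. *)
suff h : \sum_(1 <= n < N.+1) ln n.+1%:R * (n.+1%:R^-1 * n%:R^-1) <=
    2 - (ln N.+1%:R + 2) * N.+1%:R^-1 :> R.
  apply: le_trans h _; rewrite gerBl mulr_ge0 ?invr_ge0 ?ler0n // addr_ge0 //.
  exact: ln_nat_ge0.
elim: N => [|N IH]; first by rewrite big_geq // ln1 add0r invr1 mulr1 subrr.
rewrite big_nat_recr //=; apply: le_trans (lerD IH (lexx _)) _.
have /andP[_ h] := ln_nat_diff R N.+1.
have e2 : (N.+2%:R : R) = N.+1%:R + 1 by rewrite natr1.
have x1 : 1 <= N.+1%:R :> R by rewrite ler1n.
move: h; set l := ln N.+1%:R; set l' := ln N.+2%:R; rewrite e2.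
move: x1; set x := N.+1%:R => x1 h.
clear IH e2; clearbody x l l'.
have xi1 : x^-1 <= 1 by rewrite invf_le1 //; lra.
have xi0 : 0 <= x^-1 by rewrite invr_ge0; lra.
have yi0 : 0 <= (x + 1)^-1 by rewrite invr_ge0; lra.
rewrite -subr_ge0.
have -> : 2 - (l' + 2) / (x + 1) - (2 - (l + 2) / x + l' * ((x + 1)^-1 / x)) =
    x^-1 * (x + 1)^-1 * (2 - (l' - l) * (x + 1)).
  have x0 : x != 0 by rewrite gt_eqF //; lra.
  have x10 : x + 1 != 0 by rewrite gt_eqF //; lra.
  by field; rewrite x0 x10.
rewrite !mulr_ge0 // subr_ge0.
have x10 : 0 <= x + 1 by lra.
apply: le_trans (ler_wpM2r x10 h) _.
by rewrite mulrDr mulr1 mulVf ?gt_eqF //; lra.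
Qed.

Lemma sum_geometric_from2 (x : R) N : 0 <= x < 1 ->
  \sum_(1 <= k < N.+1) (if (k == 1)%N then 0 else x ^+ k) <= x ^+ 2 / (1 - x).
Proof.
move=> /andP[x0 x1]; have x10 : 0 < 1 - x by rewrite subr_gt0.
rewrite ler_pdivlMr //.
case: N => [|N]; first by rewrite big_geq // mul0r exprn_ge0.
suff -> : (\sum_(1 <= k < N.+2) (if (k == 1)%N then 0 else x ^+ k)) * (1 - x) =
  x ^+ 2 - x ^+ N.+2 by rewrite gerBl exprn_ge0.
elim: N => [|N IH]; first by rewrite big_nat1 eqxx mul0r subrr.
by rewrite big_nat_recr //= mulrDl IH [x ^+ N.+3]exprS; ring.
Qed.

(** Only the powers p^k with k >= 2 count; their geometric series gives ln p / (p (p - 1)), which is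
    then summed over all integers instead of the primes. *)
Lemma sum_mangoldt_nonprime N :
  \sum_(1 <= d < N.+1) mangoldt d * (if prime d then 0 else d%:R^-1) <= 2.
Proof.
rewrite sum_mangoldt; apply: le_trans (sum_ln_inv_prod N).
apply: (@le_trans _ _ (\sum_(2 <= p < N.+1) ln p%:R * (p%:R^-1 * p.-1%:R^-1))); last first.
  by rewrite big_add1.
rewrite big_mkcond; case: N => [|N].
  by rewrite big_nat1 [leRHS]big_geq.
rewrite big_nat_recl // big_nat_recl //= !add0r.
rewrite 2!big_add1 /=; apply: ler_sum => p _.
have pR : (2 : R) <= p.+2%:R by rewrite ler_nat.
have rhs0 : 0 <= ln p.+2%:R * (p.+2%:R^-1 * p.+1%:R^-1) :> R.
  by rewrite !mulr_ge0 ?invr_ge0 ?ler0n ?ln_nat_ge0.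
case: ifP => // pp; rewrite -mulr_sumr ler_wpM2l ?ln_nat_ge0 //.
have x01 : 0 <= (p.+2%:R^-1 : R) < 1.
  by rewrite invr_ge0 ler0n /= invf_lt1 ?ltr0n // ltr1n.
have -> : p.+2%:R^-1 / p.+1%:R = p.+2%:R^-1 ^+ 2 / (1 - p.+2%:R^-1) :> R.
  have -> : p.+1%:R = p.+2%:R - 1 :> R by rewrite -[p.+2%:R]natr1 addrK.
  have n0 : p.+2%:R != 0 :> R by rewrite pnatr_eq0.
  have n1 : p.+2%:R - 1 != 0 :> R by rewrite gt_eqF //; lra.
  have key (x : R) : x != 0 -> x - 1 != 0 -> x^-1 / (x - 1) = x^-1 ^+ 2 / (1 - x^-1).
    by move=> x0 x1; field; rewrite x0 x1.
  exact: key.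
apply: le_trans (sum_geometric_from2 N.+1 x01).
rewrite big_mkcond; apply: ler_sum => k _; case: ifP => _; last first.
  by case: ifP => // _; rewrite exprn_ge0 // invr_ge0 ler0n.
case: eqP => [->|_]; first by rewrite expn1 pp.
case: ifP => _; first by rewrite exprn_ge0 // invr_ge0 ler0n.
by rewrite natrX exprVn.
Qed.

End mangoldt.

(** * Complex numbers and Dirichlet characters *)

Section complex_facts.
Variable R : realType.
Local Notation C := R[i].

Lemma norm_real_complex (x : R) : `|x%:C| = `|x|%:C :> C.
Proof. by rewrite normc_def /= expr0n addr0 sqrtr_sqr. Qed.

Lemma norm_Re_le (z : C) (a : R) : `|z| <= a%:C -> `|complex.Re z| <= a.
Proof. by move=> /(le_trans (normc_ge_Re z)); rewrite lecR. Qed.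

Lemma norm_Im_le (z : C) (a : R) : `|z| <= a%:C -> `|complex.Im z| <= a.
Proof.
move=> za; rewrite -normrN -ReiNIm; apply: norm_Re_le.
rewrite normrM (_ : `|'i%C| = 1) ?mulr1 //.
by rewrite normc_def /= expr0n expr1n add0r sqrtr1.
Qed.

Lemma norm_complex_le (z : C) (a b : R) : `|complex.Re z| <= a -> `|complex.Im z| <= b ->
  `|z| <= (a + b)%:C.
Proof.
move=> za zb; rewrite [z]complexE rmorphD /=; apply: le_trans (ler_normD _ _) _.
rewrite normrM !norm_real_complex (_ : `|'i%C| = 1); last first.
  by rewrite normc_def /= expr0n expr1n add0r sqrtr1.
by rewrite mul1r; apply: lerD; rewrite lecR.
Qed.

Lemma Re_sum_real (f : nat -> C) (v : nat -> R) (m n : nat) :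
  complex.Re (\sum_(m <= k < n) f k * (v k)%:C) = \sum_(m <= k < n) complex.Re (f k) * v k.
Proof.
elim/big_rec2 : _ => [//|k x y _ <-]; case: (f k) y => a b [c d] /=.
by rewrite mulr0 subr0.
Qed.

Lemma Im_sum_real (f : nat -> C) (v : nat -> R) (m n : nat) :
  complex.Im (\sum_(m <= k < n) f k * (v k)%:C) = \sum_(m <= k < n) complex.Im (f k) * v k.
Proof.
elim/big_rec2 : _ => [//|k x y _ <-]; case: (f k) y => a b [c d] /=.
by rewrite mulr0 add0r mulrC.
Qed.

Lemma Re_sum (f : nat -> C) (m n : nat) :
  complex.Re (\sum_(m <= k < n) f k) = \sum_(m <= k < n) complex.Re (f k).
Proof. by elim/big_rec2 : _ => [//|k x y _ <-]; case: (f k) y => a b [c d]. Qed.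

Lemma Im_sum (f : nat -> C) (m n : nat) :
  complex.Im (\sum_(m <= k < n) f k) = \sum_(m <= k < n) complex.Im (f k).
Proof. by elim/big_rec2 : _ => [//|k x y _ <-]; case: (f k) y => a b [c d]. Qed.

Lemma ReB (x y : C) : complex.Re (x - y) = complex.Re x - complex.Re y.
Proof. by case: x y => a b []. Qed.

Lemma ImB (x y : C) : complex.Im (x - y) = complex.Im x - complex.Im y.
Proof. by case: x y => a b []. Qed.

(* Convergence in [R[i]], stated componentwise to stay clear of its topology. *)
Definition ccvg (u : nat -> C) (l : C) : Prop :=
  (fun n => complex.Re (u n)) @ \oo --> complex.Re l /\
  (fun n => complex.Im (u n)) @ \oo --> complex.Im l.

Lemma ccvg_cvg (u : nat -> C) (l : C) : ccvg u l ->
  (u : nat -> R[i]^o) @ \oo --> (l : R[i]^o).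
Proof.
move=> [/cvgrPdist_le ul /cvgrPdist_le vl]; apply/cvgrPdist_le => e e0.
have [r re] : exists r : R, e = r%:C.
  by apply/complex_realP; rewrite realE ltW.
have r0 : 0 < r by move: e0; rewrite re -[0]/(0%:C) ltcR.
have r2 : 0 < r / 2 by rewrite divr_gt0.
near=> n; rewrite re [r](splitr r); apply: norm_complex_le.
  by rewrite ReB; near: n; exact: ul.
by rewrite ImB; near: n; exact: vl.
Unshelve. all: by end_near. Qed.

Lemma ccvg_near_eq (u v : nat -> C) (l : C) :
  (\forall n \near \oo, u n = v n) -> ccvg u l -> ccvg v l.
Proof.
move=> uv [ul1 ul2]; split.
  by apply: cvg_trans ul1; apply: near_eq_cvg; near=> n; congr complex.Re; near: n.
by apply: cvg_trans ul2; apply: near_eq_cvg; near=> n; congr complex.Im; near: n.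
Unshelve. all: by end_near. Qed.

Lemma ccvg_shiftS (u : nat -> C) (l : C) : ccvg (fun n => u n.+1) l <-> ccvg u l.
Proof.
by split=> -[u1 u2]; split; move: u1 u2;
  rewrite -?(cvg_shiftS (fun n => complex.Re (u n))) -?(cvg_shiftS (fun n => complex.Im (u n))).
Qed.

Lemma ccvg_comp (u : nat -> C) (l : C) (h : nat -> nat) :
  h @ \oo --> \oo -> ccvg u l -> ccvg (fun n => u (h n)) l.
Proof. by move=> ho [u1 u2]; split; [exact: (cvg_comp _ _ ho u1)|exact: (cvg_comp _ _ ho u2)]. Qed.

Lemma ccvg_cst (l : C) : ccvg (fun=> l) l.
Proof. by split; exact: cvg_cst. Qed.

Lemma ccvgB (u v : nat -> C) (l m : C) :
  ccvg u l -> ccvg v m -> ccvg (fun n => u n - v n) (l - m).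
Proof.
move=> [u1 u2] [v1 v2]; split.
  by under eq_fun do rewrite ReB; rewrite ReB; apply: cvgB.
by under eq_fun do rewrite ImB; rewrite ImB; apply: cvgB.
Qed.

Lemma ReM (x y : C) : complex.Re (x * y) =
  complex.Re x * complex.Re y - complex.Im x * complex.Im y.
Proof. by case: x y => a b []. Qed.

Lemma ImM (x y : C) : complex.Im (x * y) =
  complex.Re x * complex.Im y + complex.Im x * complex.Re y.
Proof. by case: x y => a b []. Qed.

Lemma ccvgM (u v : nat -> C) (l m : C) :
  ccvg u l -> ccvg v m -> ccvg (fun n => u n * v n) (l * m).
Proof.
move=> [u1 u2] [v1 v2]; split.
  by under eq_fun do rewrite ReM; rewrite ReM; apply: cvgB; apply: cvgM.
by under eq_fun do rewrite ImM; rewrite ImM; apply: cvgD; apply: cvgM.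
Qed.

Lemma ccvg_prod (I : finType) (P : pred I) (u : I -> nat -> C) (l : I -> C) :
  (forall i, P i -> ccvg (u i) (l i)) ->
  ccvg (fun n => \prod_(i | P i) u i n) (\prod_(i | P i) l i).
Proof.
move=> ul; elim: (index_enum I) => [|i s IH].
  by rewrite big_nil; under eq_fun do rewrite big_nil; exact: ccvg_cst.
rewrite big_cons; under eq_fun do rewrite big_cons.
by case: ifP => // Pi; apply: ccvgM => //; exact: ul.
Qed.

Lemma ccvg_real (u : nat -> R) (l : R) : u @ \oo --> l -> ccvg (fun n => (u n)%:C) l%:C.
Proof. by move=> ul; split=> //=; exact: cvg_cst. Qed.

Lemma ccvg_bound (u : nat -> C) (l : C) (v : nat -> R) : v @ \oo --> 0 ->
  (\forall n \near \oo, `|u n - l| <= (v n)%:C) -> ccvg u l.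
Proof.
move=> v0 ul; split; apply/cvgrPdist_le => e e0; near=> n.
  rewrite distrC -ReB; apply: norm_Re_le; apply: le_trans (_ : (v n)%:C <= _).
    by near: n.
  rewrite lecR; apply: le_trans (ler_norm _) _.
  by near: n; move/cvgr0Pnorm_le : v0; apply.
rewrite distrC -ImB; apply: norm_Im_le; apply: le_trans (_ : (v n)%:C <= _).
  by near: n.
rewrite lecR; apply: le_trans (ler_norm _) _.
by near: n; move/cvgr0Pnorm_le : v0; apply.
Unshelve. all: by end_near. Qed.

Lemma ccvg_norm_le (u : nat -> C) (l : C) (b : R) :
  ccvg u l -> (\forall n \near \oo, `|u n| <= b%:C) -> `|l| <= b%:C.
Proof.
move=> /ccvg_cvg/cvgrPdist_le ul ub; apply/ler_addgt0Pr => e e0.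
have [n [h1 h2]] : exists n, `|l - u n| <= e /\ `|u n| <= b%:C.
  near \oo => n; exists n; split; first by near: n; exact: ul.
  by near: n.
rewrite -(subrK (u n) l) addrC; apply: le_trans (ler_normD _ _) _.
exact: lerD.
Unshelve. all: by end_near. Qed.

Lemma ccvg_unique (u : nat -> C) (l l' : C) : ccvg u l -> ccvg u l' -> l = l'.
Proof.
move=> [u1 u2] [v1 v2]; apply/eqP; rewrite eq_complex.
by rewrite (cvg_unique _ u1 v1) // (cvg_unique _ u2 v2) // !eqxx.
Qed.

End complex_facts.

Section dirichlet_character_theory.
Variables (R : realType) (q : nat) (f : nat -> R[i]).
Hypotheses (q0 : (0 < q)%N) (fq : dirichlet_character q f).

Lemma dcharM m n : f (m * n)%N = f m * f n. Proof. by case: fq. Qed.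

Lemma dcharD n : f (n + q)%N = f n. Proof. by case: fq. Qed.

Lemma dchar_neq0 n : (f n != 0) = coprime n q. Proof. by case: fq. Qed.

Lemma dchar0 n : ~~ coprime n q -> f n = 0.
Proof. by rewrite -dchar_neq0 negbK => /eqP. Qed.

Lemma dchar1 : f 1 = 1.
Proof.
have f1 : f 1 != 0 by rewrite dchar_neq0 coprime1n.
by apply: (mulfI f1); rewrite -dcharM mulr1 muln1.
Qed.

Lemma dchar_mod n : f (n %% q)%N = f n.
Proof.
rewrite {2}(divn_eq n q) addnC; elim: (n %/ q)%N => [|k IH].
  by rewrite mul0n addn0.
by rewrite mulSnr addnA dcharD.
Qed.

Lemma dcharX n k : f (n ^ k)%N = f n ^+ k.
Proof. by elim: k => [|k IH]; rewrite ?dchar1 // expnS dcharM IH exprS. Qed.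

Lemma dchar_norm n : `|f n| = (coprime n q)%:R.
Proof.
have [nq|/dchar0 ->] := boolP (coprime n q); last by rewrite normr0.
have /(congr1 f) := Euler_exp_totient nq; rewrite !dchar_mod dchar1 dcharX.
move=> /(congr1 Num.norm); rewrite normrX normr1 => /eqP.
by rewrite pexprn_eq1 ?totient_gt0 // => /orP[|/eqP //]; rewrite eqn0Ngt totient_gt0 q0.
Qed.

Lemma dchar_norm_le1 n : `|f n| <= 1.
Proof. by rewrite dchar_norm lern1 leq_b1. Qed.

Lemma dchar_conj : dirichlet_character q (fun n => (f n)^*).
Proof.
split=> [m n|n|n]; first by rewrite dcharM rmorphM.
  by rewrite dcharD.
by rewrite conjc_eq0 dchar_neq0.
Qed.

(** Orthogonality to the principal character: multiplication by some unit m with f m <> 1 permutes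
    the residues, so the sum over a period is fixed by the factor f m. *)
Hypothesis f1 : f <> principal_character R q.

Lemma dchar_sum0 : \sum_(0 <= n < q) f n = 0.
Proof.
have [m mq fm] : exists2 m, coprime m q & f m != 1.
  apply: contra_notP f1 => h; apply/funext => n; rewrite /principal_character.
  have [nq|/dchar0 -> //] := boolP (coprime n q).
  by apply/eqP; apply: contra_notT h => fn; exists n.
rewrite big_mkord; set S := \sum_(_ < _) _.
suff : f m * S = S.
  move/eqP; rewrite -subr_eq0 -{2}[S]mul1r -mulrBl mulf_eq0 subr_eq0 (negPf fm).
  by move/eqP.
pose h (i : 'I_q) : 'I_q := Ordinal (ltn_pmod (m * i) q0).
have hi : injective h.
  move=> i j /(congr1 val) /= /eqP.
  wlog ij : i j / (i <= j)%N.
    by move=> H hij; case/orP: (leq_total i j) => /H; [apply|move=> /(_ _)/esym -> //; rewrite eq_sym].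
  rewrite eq_sym eqn_mod_dvd ?leq_mul2l ?ij ?orbT // -mulnBr Gauss_dvdr; last by rewrite coprime_sym.
  move=> /dvdnP [k kE]; apply/val_inj/eqP; rewrite eqn_leq ij /= -subn_eq0 kE.
  case: k kE => [|k] kE //; have := leq_ltn_trans (leq_subr i j) (ltn_ord j).
  by rewrite kE mulSn ltnNge leq_addr.
rewrite mulr_sumr [RHS](reindex_inj hi) /=; apply: eq_bigr => i _.
by rewrite -dcharM dchar_mod.
Qed.

End dirichlet_character_theory.

(** * Values of L-functions and Euler products *)

Section periodic_series.
Variables (R : realType) (q : nat) (g : nat -> R).
Hypotheses (q0 : (0 < q)%N) (gq : forall n, g (n + q)%N = g n)
  (gs : \sum_(0 <= n < q) g n = 0) (g1 : forall n, `|g n| <= 1).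

Lemma periodic_series_inv : exists T C : R,
  [/\ series (fun n => g n * n%:R^-1) @ \oo --> T,
      forall N, `|\sum_(0 <= n < N.+1) g n * n%:R^-1 - T| <= C * N.+1%:R^-1 &
      forall e S, 0 < e -> series (fun n => g n * (n%:R^-1 * npow e n)) @ \oo --> S ->
        `|S - T| <= C * e].
Proof.
(* Dirichlet's test is applied from index 1 on, since 1 / n is not decreasing at 0; dropping g 0
   costs at most 1. *)
have aB n : `|\sum_(0 <= k < n) g k.+1| <= q%:R + 1.
  have := periodic_bound q0 gq gs g1 n.+1; rewrite mulr1 big_nat_recl //.
  set x := \sum_(_ <= _ < _) _ => h; rewrite -(addKr (g 0%N) x) addrC.
  by apply: le_trans (ler_normD _ _) _; rewrite normrN; apply: lerD.
have vd n : n.+2%:R^-1 <= n.+1%:R^-1 :> R by rewrite lef_pV2 ?posrE ?ltr0n // ler_nat.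
have v0 n : 0 <= n.+1%:R^-1 :> R by rewrite invr_ge0 ler0n.
have vc : (fun n => n.+1%:R^-1 : R) @ \oo --> 0 by exact: cvg_harmonic.
have [T cT bT] := dirichlet_test aB vd v0 vc.
have shift N : \sum_(0 <= n < N.+1) g n * n%:R^-1 = \sum_(0 <= n < N) g n.+1 * n.+1%:R^-1.
  by rewrite big_nat_recl // invr0 mulr0 add0r.
have bT' N : `|\sum_(0 <= n < N.+1) g n * n%:R^-1 - T| <= 2 * (q%:R + 1) * N.+1%:R^-1.
  by rewrite shift; exact: bT.
exists T, (2 * (q%:R + 1)); split => //.
  rewrite -cvg_shiftS /=; apply: cvg_trans cT; apply: near_eq_cvg; near=> N.
  by rewrite /series /= shift.
move=> e S e0 cS; apply/ler_addgt0Pr => d d0.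
apply: (@cvg_norm_le _ (fun N => series (fun n => g n * (n%:R^-1 * npow e n)) N.+1 - T)).
  by apply: cvgB; [rewrite cvg_shiftS|exact: cvg_cst].
have c0 : (fun N => 2 * (q%:R + 1) * N.+1%:R^-1 : R) @ \oo --> 0.
  by rewrite -(mulr0 (2 * (q%:R + 1))); apply: cvgMr.
near=> N; rewrite /series /=.
under eq_bigr do rewrite mulrA.
apply: le_trans (abel_lipschitz bT' N (ltW e0)) _; rewrite addrC lerD2l.
apply: le_trans (ler_norm _) _.
by near: N; move/cvgr0Pnorm_le : c0; apply.
Unshelve. all: by end_near. Qed.

End periodic_series.

(* L(1 + e, f), whose defining series has a null term at n = 0 because [0^-1 = 0]. *)
Definition L_value (R : realType) (f : nat -> R[i]) (e : R) : R[i] :=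
  limn (series (fun n => complex.Re (f n) * (n%:R^-1 * npow e n))) +i*
  limn (series (fun n => complex.Im (f n) * (n%:R^-1 * npow e n))).

Section L_value_theory.
Variables (R : realType) (f : nat -> R[i]).
Hypothesis f1 : forall n, `|f n| <= 1.

Let Ref1 n : `|complex.Re (f n)| <= 1.
Proof. exact: norm_Re_le (f1 n). Qed.

Let Imf1 n : `|complex.Im (f n)| <= 1.
Proof. exact: norm_Im_le (f1 n). Qed.

Lemma L_value_cvg e : 0 < e ->
  ccvg (fun N => \sum_(0 <= n < N) f n * (n%:R^-1 * npow e n)%:C) (L_value f e).
Proof.
move=> e0; split => /=.
  by under eq_fun do rewrite Re_sum_real; exact: dirichlet_series_cvg.
by under eq_fun do rewrite Im_sum_real; exact: dirichlet_series_cvg.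
Qed.

Variable q : nat.
Hypotheses (q0 : (0 < q)%N) (fq : forall n, f (n + q)%N = f n)
  (fs : \sum_(0 <= n < q) f n = 0).

Lemma L_value_nonprincipal : exists C : R,
  [/\ ccvg (fun N => \sum_(0 <= n < N) f n * (n%:R^-1)%:C) (L_value f 0),
      forall N, `|\sum_(0 <= n < N.+1) f n * (n%:R^-1)%:C - L_value f 0| <=
        (C * N.+1%:R^-1)%:C,
      forall N, `|\sum_(0 <= n < N) f n * (n%:R^-1 * ln n%:R)%:C| <= C%:C &
      forall e, 0 < e -> `|L_value f e - L_value f 0| <= (C * e)%:C].
Proof.
have [] := @periodic_series_inv R q (fun n => complex.Re (f n)) q0.
- by move=> n; rewrite fq.
- by rewrite -Re_sum fs.
- exact: Ref1.
move=> T1 [C1 [cT1 bT1 lT1]].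
have [] := @periodic_series_inv R q (fun n => complex.Im (f n)) q0.
- by move=> n; rewrite fq.
- by rewrite -Im_sum fs.
- exact: Imf1.
move=> T2 [C2 [cT2 bT2 lT2]].
have L0 : L_value f 0 = T1 +i* T2.
  rewrite /L_value; under eq_fun do rewrite npow0n mulr1.
  rewrite (cvg_lim _ cT1) //; congr (_ +i* _).
  by under eq_fun do rewrite npow0n mulr1; rewrite (cvg_lim _ cT2).
have C10 : 0 <= C1 by have := le_trans (normr_ge0 _) (bT1 0%N); rewrite invr1 mulr1.
have C20 : 0 <= C2 by have := le_trans (normr_ge0 _) (bT2 0%N); rewrite invr1 mulr1.
(* One constant for all the bounds: real and imaginary parts add up, and the 2 comes from
   [sum_mul_ln_bounded]. *)
exists (2 * (C1 + C2)); split.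
- by rewrite L0; split => /=; [under eq_fun do rewrite Re_sum_real|
    under eq_fun do rewrite Im_sum_real].
- move=> N; apply: le_trans (_ : (C1 * N.+1%:R^-1 + C2 * N.+1%:R^-1)%:C <= _).
    by apply: norm_complex_le; rewrite ?ReB ?ImB ?Re_sum_real ?Im_sum_real L0.
  by rewrite lecR -mulrDl ler_wpM2r ?invr_ge0 ?ler0n //; lra.
- move=> N; rewrite mulrDr; apply: norm_complex_le.
    by rewrite Re_sum_real; under eq_bigr do rewrite mulrA; exact: sum_mul_ln_bounded bT1 N.
  by rewrite Im_sum_real; under eq_bigr do rewrite mulrA; exact: sum_mul_ln_bounded bT2 N.
- move=> e e0; apply: le_trans (_ : (C1 * e + C2 * e)%:C <= _).
    apply: norm_complex_le; rewrite ?ReB ?ImB L0 /=.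
      by apply: lT1 => //; exact: dirichlet_series_cvg.
    by apply: lT2 => //; exact: dirichlet_series_cvg.
  by rewrite lecR -mulrDl ler_wpM2r ?(ltW e0) //; lra.
Qed.

End L_value_theory.

Lemma dirichlet_L_value (R : realType) (q : nat) (f : nat -> R[i]) : (0 < q)%N ->
  dirichlet_character q f -> f <> principal_character R q -> dirichlet_L 1 f = L_value f 0.
Proof.
move=> q0 fq fp.
have [C [cL _ _ _]] := L_value_nonprincipal (dchar_norm_le1 q0 fq) q0 (dcharD fq)
  (dchar_sum0 q0 fq fp).
have h : ccvg (fun N => \sum_(1 <= n < N.+1) (f n * natCpow n (- 1))) (L_value f 0); last first.
  exact: (cvg_lim (@norm_hausdorff _ _) (ccvg_cvg h)).
move/(iffRL (ccvg_shiftS _ _)) : cL; apply: ccvg_near_eq; near=> N.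
rewrite big_nat_recl // invr0 mulr0 add0r big_add1 /=; apply: eq_bigr => n _.
rewrite /natCpow /= oppr0 mul0r cos0 sin0 mulr1 mulr0 mulN1r expRN lnK //.
by rewrite posrE ltr0n.
Unshelve. all: by end_near. Qed.

Lemma sum_coprime q : (0 < q)%N -> (\sum_(0 <= n < q) coprime n q)%N = totient q.
Proof.
by move=> q0; rewrite totient_count_coprime; apply: eq_bigr => n _; rewrite coprime_sym.
Qed.

(** Subtracting its mean phi / q from the principal character leaves a periodic function of mean
    zero, whose series stays bounded near s = 1; the pole is carried by phi / q times zeta. *)
Lemma L_value_principal (R : realType) q : (0 < q)%N -> exists C : R,
  forall e, 0 < e <= 1 ->
  `|e%:C * L_value (principal_character R q) e - ((totient q)%:R / q%:R)%:C| <= (C * e)%:C.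
Proof.
move=> q0; set r : R := (totient q)%:R / q%:R.
have qR : 0 < q%:R :> R by rewrite ltr0n.
have r01 : 0 <= r <= 1.
  rewrite divr_ge0 ?ler0n //= ler_pdivrMr // mul1r ler_nat -sum_coprime //.
  rewrite -[leqRHS]muln1 -[X in (_ <= X * _)%N]subn0 -sum_nat_const_nat.
  by apply: leq_sum => n _; exact: leq_b1.
pose g n : R := (coprime n q)%:R - r.
have gq n : g (n + q)%N = g n by rewrite /g -coprime_modl modnDr coprime_modl.
have gs : \sum_(0 <= n < q) g n = 0.
  rewrite sumrB -natr_sum sum_coprime // sumr_const_nat subn0 -[r *+ q]mulr_natr /r.
  by rewrite divfK ?subrr // gt_eqF.
have g1 n : `|g n| <= 1.
  by rewrite /g ler_norml; case: (coprime n q) => /=; lra.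
have [T [C [cT bT lT]]] := periodic_series_inv q0 gq gs g1.
have C0 : 0 <= C by have := le_trans (normr_ge0 _) (bT 0%N); rewrite invr1 mulr1.
exists (`|T| + C + 1) => e /andP[e0 e1].
have [Z cZ /andP[Z1 Z2]] := zeta_residue e0.
have cS := dirichlet_series_cvg e0 g1; set S := limn _ in cS.
have ST : `|S - T| <= C * e by apply: lT.
have -> : L_value (principal_character R q) e = (S + r * Z)%:C.
  rewrite /L_value; congr (_ +i* _); apply: cvg_lim => //.
    have cr : (fun N => r * series (fun n => n%:R^-1 * npow e n) N) @ \oo --> r * Z.
      by apply: cvgMr.
    rewrite (_ : series _ = series (fun n => g n * (n%:R^-1 * npow e n)) \+
      (fun N => r * series (fun n => n%:R^-1 * npow e n) N)); first exact: cvgD cS cr.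
    apply/funext => N; rewrite /series /= mulr_sumr -big_split /=; apply: eq_bigr => n _.
    by rewrite /principal_character /g -mulrDl subrK; case: (coprime n q).
  rewrite (_ : series _ = cst 0); first exact: cvg_cst.
  apply/funext => N; rewrite /series /= big1 // => n _.
  by rewrite /principal_character; case: (coprime n q); rewrite mul0r.
rewrite -rmorphM -rmorphB /= norm_real_complex lecR mulrDr -addrA.
apply: le_trans (ler_normD _ _) _; rewrite mulrDl mul1r; apply: lerD.
  rewrite normrM (ger0_norm (ltW e0)) mulrC ler_wpM2r ?(ltW e0) //.
  rewrite -(subrK T S) addrC; apply: le_trans (ler_normD _ _) _; rewrite lerD2l.
  by apply: le_trans ST _; rewrite ler_piMr.
have -> : e * (r * Z) - r = r * (e * Z - 1) by ring.
have /andP[r0 r1] := r01.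
rewrite normrM (ger0_norm r0) (ger0_norm (_ : 0 <= e * Z - 1)) ?subr_ge0 //.
by apply: le_trans (_ : 1 * (e * Z - 1) <= _); [rewrite ler_wpM2r ?subr_ge0|lra].
Qed.

Section euler_product.
Variables (R : realType) (q : nat) (f : nat -> R[i]) (e : R).
Hypotheses (q0 : (0 < q)%N) (fq : dirichlet_character q f) (e0 : 0 < e).

Let g n : R[i] := f n * (n%:R^-1 * npow e n)%:C.

Let gM m n : (0 < m)%N -> (0 < n)%N -> g (m * n)%N = g m * g n.
Proof.
move=> m0 n0; rewrite /g (dcharM fq) npowM // natrM invfM !rmorphM /=.
by ring.
Qed.

Definition rough N n := all (fun p => ~~ (prime p && (p %| n)%N)) (iota 0 N).

Lemma roughS N n : rough N.+1 n = rough N n && ~~ (prime N && (N %| n)%N).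
Proof. by rewrite /rough -addn1 iotaD all_cat /= andbT. Qed.

Lemma rough_mul N m : prime N -> rough N (N * m) = rough N m.
Proof.
move=> pN; apply: eq_in_all => p; rewrite mem_iota /= => pltN.
have [pp|//] := boolP (prime p); rewrite Euclid_dvdM // dvdn_prime2 //.
by rewrite (ltn_eqF pltN).
Qed.

Lemma rough_ge N n : (1 < n)%N -> rough N n -> (N <= n)%N.
Proof.
move=> n1 /allP r; rewrite leqNgt; apply/negP => nN.
have := r (pdiv n); rewrite mem_iota /= pdiv_prime // pdiv_dvd => h.
by have := h (leq_ltn_trans (pdiv_leq (ltnW n1)) nN).
Qed.

Let F N M := \sum_(1 <= n < M.+1 | rough N n) g n.

(** One step of the sieve: the multiples of a prime N without smaller prime factor are the N m with
    m of the same kind, so g N factors out and the truncation becomes M / N. *)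
Let FS N M : F N.+1 M = if prime N then F N M - g N * F N (M %/ N) else F N M.
Proof.
rewrite /F; case: ifP => pN; last first.
  by apply: eq_bigl => n; rewrite roughS pN andbT.
apply/eqP; rewrite eq_sym subr_eq; apply/eqP.
rewrite (bigID (fun n => N %| n)%N) /= addrC; congr (_ + _).
  by apply: eq_bigl => n; rewrite roughS pN.
rewrite mulr_sumr big_mkcondl /= sum_multiples ?prime_gt0 // [RHS]big_mkcond !big_nat.
apply: eq_bigr => m /andP[m0 _]; rewrite rough_mul //; case: ifP => // _.
by rewrite gM // prime_gt0.
Qed.

Lemma cvg_divn N : (0 < N)%N -> (fun M => (M %/ N)%N) @ \oo --> \oo.
Proof.
move=> N0; apply/cvgnyPge => A; near=> M; rewrite leq_divRL //.
by near: M; exact: nbhs_infty_ge.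
Unshelve. all: by end_near. Qed.

Let PS N : \prod_(0 <= p < N.+1 | prime p) (1 - g p) =
  \prod_(0 <= p < N | prime p) (1 - g p) * (if prime N then 1 - g N else 1).
Proof. by rewrite big_mkcond big_nat_recr // -big_mkcond. Qed.

Let Fcvg N : ccvg (F N) (L_value f e * \prod_(0 <= p < N | prime p) (1 - g p)).
Proof.
elim: N => [|N IH].
  rewrite big_geq // mulr1.
  have /(iffRL (ccvg_shiftS _ _)) := L_value_cvg (dchar_norm_le1 q0 fq) e0.
  apply: ccvg_near_eq; near=> M.
  rewrite big_nat_recl // invr0 mul0r mulr0 add0r /F big_add1 /=.
  by apply: eq_bigr.
rewrite PS (_ : F N.+1 = fun M => if prime N then F N M - g N * F N (M %/ N) else F N M); last first.
  by apply/funext => M; rewrite FS.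
case: ifP => pN; last by rewrite mulr1.
set l := L_value f e * _ in IH.
have -> : L_value f e * (\prod_(0 <= p < N | prime p) (1 - g p) * (1 - g N)) = l - g N * l.
  by rewrite /l; ring.
apply: ccvgB => //; apply: ccvgM; first exact: ccvg_cst.
exact: (ccvg_comp (cvg_divn (prime_gt0 pN)) IH).
Unshelve. all: by end_near. Qed.

(** After sieving by the primes below N there remain 1 and terms of index at least N, bounded by the
    tail of zeta(1 + e). Stating the result as a product tending to 1 avoids any division by an
    L-value. *)
Lemma euler_product :
  ccvg (fun N => L_value f e * \prod_(0 <= p < N | prime p) (1 - f p * (p%:R^-1 * npow e p)%:C)) 1.
Proof.
apply: (@ccvg_bound _ _ _ (fun N => npow e N.-1 / e)).
  rewrite -(mul0r e^-1); apply: cvgMl; rewrite -cvg_shiftS /=; exact: npow_cvg0.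
near=> N; have N1 : (1 < N)%N by near: N; exact: nbhs_infty_gt.
apply: (@ccvg_norm_le _ (fun M => F N M - 1)).
  by apply: ccvgB; [exact: Fcvg|exact: ccvg_cst].
near=> M; have M0 : (0 < M)%N by near: M; exact: nbhs_infty_gt.
have -> : F N M - 1 = \sum_(N <= n < M.+1 | rough N n) g n.
  rewrite /F; apply/eqP; rewrite subr_eq; apply/eqP.
  rewrite big_mkcond big_ltn // [RHS]addrC; congr (_ + _).
    rewrite /rough ifT; first by rewrite /g (dchar1 fq) invr1 mul1r npow1 mul1r.
    by apply/allP => p _; apply/negP => /andP[pp]; rewrite dvdn1 => /eqP p1; rewrite p1 in pp.
  have NM : (N <= M.+1)%N by rewrite leqW //; near: M; exact: nbhs_infty_ge.
  rewrite (@big_cat_nat _ _ _ N 2 M.+1) //= big_nat big1 ?add0r ?[RHS]big_mkcond //.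
  move=> n /andP[n1 nN]; case: ifP => // /(rough_ge n1).
  by rewrite leqNgt nN.
apply: le_trans (ler_norm_sum _ _ _) _.
apply: (@le_trans _ _ (\sum_(N <= n < M.+1) (n%:R^-1 * npow e n)%:C)).
  rewrite big_mkcond; apply: ler_sum => n _.
  have h : 0 <= n%:R^-1 * npow e n by rewrite mulr_ge0 ?invr_ge0 ?ler0n //; exact: ltW (npow_gt0 _ _).
  case: ifP => _; last by rewrite ler0c.
  rewrite /g normrM norm_real_complex (ger0_norm h) ler_piMl ?ler0c //.
  exact: (dchar_norm_le1 q0 fq).
rewrite -rmorph_sum lecR /= -[N in index_iota N _](prednK (ltnW N1)).
by apply: npow_tail => //; rewrite -ltnS prednK // ltnW.
Unshelve. all: by end_near. Qed.

End euler_product.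

(** * Enumeration of the Dirichlet characters modulo q *)

Section unit_of_nat.
Variable q : nat.

(** The default 1 is the value at n not coprime to q. In the lemmas below q <= 1 is treated apart:
    there ['Z_q] is not Z/qZ, but its unit group is trivial. *)
Definition unit_of_nat (n : nat) : {unit 'Z_q} := insubd (1%g : {unit 'Z_q}) (n%:R : 'Z_q).

Hypothesis q0 : (0 < q)%N.

Lemma unit_Z1_eq (x y : {unit 'Z_q}) : (q <= 1)%N -> x = y.
Proof.
move=> q1; have : (#|[set: {unit 'Z_q}]%SET| <= 1)%N.
  rewrite (card_units_Zp q0); have -> : q = 1%N by apply/eqP; rewrite eqn_leq q1.
  by [].
by move/card_le1_eqP; apply; rewrite inE.
Qed.

Lemma eq_mod_le1 m n : (q <= 1)%N -> (m == n %[mod q])%N.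
Proof. by move=> q1; have -> : q = 1%N; [apply/eqP; rewrite eqn_leq q1|rewrite !modn1]. Qed.

Lemma coprime_le1 n : (q <= 1)%N -> coprime n q.
Proof. by move=> q1; have -> : q = 1%N; [apply/eqP; rewrite eqn_leq q1|exact: coprimen1]. Qed.

Lemma val_unit_of_nat n : (1 < q)%N -> coprime n q ->
  FinRing.uval (unit_of_nat n) = n%:R.
Proof.
move=> q1 nq; have := @insubdK _ _ _ (1%g : {unit 'Z_q}) (n%:R : 'Z_q).
by apply; rewrite unfold_in /= unitZpE // coprime_sym.
Qed.

Lemma unit_of_natM m n : coprime m q -> coprime n q ->
  unit_of_nat (m * n) = (unit_of_nat m * unit_of_nat n)%g.
Proof.
move=> mq nq; have [q1|q1] := leqP q 1; first exact: unit_Z1_eq.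
apply: val_inj; rewrite FinRing.val_unitM /= !val_unit_of_nat ?natrM //.
by rewrite coprimeMl mq.
Qed.

Lemma unit_of_natD n : unit_of_nat (n + q) = unit_of_nat n.
Proof.
have [q1|q1] := leqP q 1; first exact: unit_Z1_eq.
by rewrite /unit_of_nat -(Zp_nat_mod q1) modnDr (Zp_nat_mod q1).
Qed.

Lemma unit_of_nat_uval (g : {unit 'Z_q}) : unit_of_nat (FinRing.uval g) = g.
Proof. by rewrite /unit_of_nat natr_Zp; exact: valKd. Qed.

Lemma coprime_uval (g : {unit 'Z_q}) : coprime (FinRing.uval g) q.
Proof.
have [q1|q1] := leqP q 1; first exact: coprime_le1.
by rewrite coprime_sym -unitZpE // natr_Zp; exact: valP.
Qed.

Lemma unit_of_nat_eq n (g : {unit 'Z_q}) : (1 < q)%N -> coprime n q ->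
  (unit_of_nat n == g) = (n == FinRing.uval g %[mod q])%N.
Proof.
move=> q1 nq; rewrite -(inj_eq val_inj) /= val_unit_of_nat // -(inj_eq val_inj) /=.
rewrite val_Zp_nat //; congr (_ == _); rewrite modn_small //.
by apply: leq_trans (ltn_ord (FinRing.uval g)) _; rewrite Zp_cast.
Qed.

Lemma unit_of_nat_eq1 n : coprime n q -> (unit_of_nat n == 1%g) = (n == 1 %[mod q])%N.
Proof.
move=> nq; have [q1|q1] := leqP q 1.
  rewrite (unit_Z1_eq (unit_of_nat n) 1%g q1) eqxx.
  by have -> : q = 1%N; [apply/eqP; rewrite eqn_leq q1|rewrite !modn1].
by rewrite unit_of_nat_eq //= FinRing.val_unit1 /= (Zp_cast q1) // modn_mod.
Qed.

Lemma modn1_coprime n : (n == 1 %[mod q])%N -> coprime n q.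
Proof. by move=> /eqP nq; rewrite -coprime_modl nq coprime_modl coprime1n. Qed.

End unit_of_nat.

(** Characters of the unit group extended by 0. Numbering them by ['I_(totient q)] makes the
    products over all characters ordinary finite products. *)
Lemma dirichlet_characters_enum (R : realType) q : (0 < q)%N ->
  exists chi : 'I_(totient q) -> nat -> R[i],
  [/\ forall i, dirichlet_character q (chi i),
      injective chi,
      forall f, dirichlet_character q f -> exists i, f = chi i,
      forall n, \sum_i chi i n = if (n == 1 %[mod q])%N then (totient q)%:R else 0 &
      forall p z, coprime p q -> (#[unit_of_nat q p]%g %| totient q)%N /\
        \prod_i (1 - chi i p * z) =
        (1 - z ^+ #[unit_of_nat q p]%g) ^+ (totient q %/ #[unit_of_nat q p]%g)].
Proof.
move=> q0; have E : #|[set: {unit 'Z_q}]%SET| = totient q := card_units_Zp q0.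
have := finite_abelian_characters R[i] (units_Zp_abelian q); rewrite E.
move=> [X [X1 XM Xs Xf Xi]].
have X0 i g : X i g != 0.
  apply/eqP => Xg; have := X1 i; rewrite -(mulgV g) XM Xg mul0r.
  by move/eqP; rewrite eq_sym oner_eq0.
exists (fun i n => if coprime n q then X i (unit_of_nat q n) else 0); split.
- move=> i; split=> [m n|n|n].
  + rewrite coprimeMl; case: ifP => [/andP[mq nq]|].
      by rewrite mq nq unit_of_natM // XM.
    by case: (coprime m q) => //= [->|]; rewrite ?mulr0 ?mul0r.
  + by rewrite -coprime_modl modnDr coprime_modl unit_of_natD.
  + by case: ifP => // _; rewrite ?X0 ?eqxx.
- move=> i j ij; apply: Xi => g.
  have /(congr1 (@^~ (FinRing.uval g : nat))) := ij.
  by rewrite /= coprime_uval // unit_of_nat_uval.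
- move=> f fq; have f1 := dchar1 fq.
  have fmod m n : (m == n %[mod q])%N -> f m = f n.
    by move=> /eqP mn; rewrite -(dchar_mod fq m) mn (dchar_mod fq).
  have [||i fX] := Xf (fun g => f (FinRing.uval g : nat)).
  + have [q1|q1] := leqP q 1; first by rewrite -f1; apply: fmod; exact: eq_mod_le1.
    by rewrite -f1; apply: fmod; rewrite FinRing.val_unit1 /= Zp_cast // modn_mod.
  + move=> g h; rewrite -(dcharM fq); apply: fmod.
    have [q1|q1] := leqP q 1; first exact: eq_mod_le1.
    rewrite eq_sym -unit_of_nat_eq ?coprimeMl ?coprime_uval //.
    by rewrite unit_of_natM ?coprime_uval // !unit_of_nat_uval.
  exists i; apply/funext => n; case: ifP => [nq|/negbT/(dchar0 fq) //].
  rewrite -fX; apply: fmod; have [q1|q1] := leqP q 1; first exact: eq_mod_le1.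
  by rewrite -unit_of_nat_eq.
- move=> n; have [nq|nq] := boolP (coprime n q).
    by rewrite Xs unit_of_nat_eq1.
  rewrite big1 //; case: ifP => // /modn1_coprime.
  by rewrite (negPf nq).
- move=> p z pq; rewrite pq; have [-> <-] := prod_characters (unit_of_nat q p) z X1 XM Xs.
  by split => //; apply: eq_bigr => i _; rewrite mulrC.
Qed.

(** * Monsky's proof that L(1, chi) is nonzero for real chi *)

Section divisor_sums.
Variables (R : realType) (a : nat -> R).
Hypotheses (aM : forall m n, a (m * n)%N = a m * a n) (a1 : a 1%N = 1)
  (a3 : forall n, [\/ a n = -1, a n = 0 | a n = 1]).

Definition divisor_sum n : R := \sum_(1 <= d < n.+1 | (d %| n)%N) a d.

(** The divisors of p^(k+1) m prime to p are those of m; the others are p times the divisors of p^k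
    m. *)
Lemma divisor_sum_pmul p k m : prime p -> (0 < m)%N -> ~~ (p %| m)%N ->
  divisor_sum (p ^ k.+1 * m) = divisor_sum m + a p * divisor_sum (p ^ k * m).
Proof.
move=> pp m0 pm; have p0 := prime_gt0 pp.
have pkm0 j : (0 < p ^ j * m)%N by rewrite muln_gt0 expn_gt0 p0.
rewrite /divisor_sum (bigID (fun d => p %| d)%N) /= addrC; congr (_ + _).
  rewrite -(@sum_divisors_widen _ m (p ^ k.+1 * m)) ?m0 ?leq_pmull ?expn_gt0 ?p0 //.
  apply: eq_bigl => d; have [pd|pd] := boolP (p %| d)%N.
    rewrite andbF; apply/esym/negbTE; apply: contra pm => dm.
    exact: dvdn_trans pd dm.
  by rewrite andbT Gauss_dvdr // coprimeXr // coprime_sym prime_coprime.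
under eq_bigl do rewrite andbC.
rewrite big_mkcondr sum_multiples // expnS -mulnA mulKn // mulr_sumr.
rewrite [RHS]big_mkcond; apply: eq_bigr => d _.
by rewrite dvdn_pmul2l // aM.
Qed.

(** The factor at p^k is 1 + a p + ... + (a p)^k, which is nonnegative for a p in {-1, 0, 1} and at
    least 1 for even k. Even valuations express that n is a square in a form that passes to the
    cofactor m. *)
Lemma divisor_sum_ge n : (0 < n)%N ->
  0 <= divisor_sum n /\ ((forall p, ~~ odd (logn p n)) -> 1 <= divisor_sum n).
Proof.
elim/ltn_ind: n => n IH n0; have [n1|n1] := leqP n 1.
  have -> : n = 1%N by apply/eqP; rewrite eqn_leq n1.
  by rewrite /divisor_sum big_mkcond big_nat1 dvd1n a1; split.
set p := pdiv n; have pp : prime p := pdiv_prime n1.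
have [m pm nE] := @pfactor_coprime p n pp n0; set k := logn p n in nE.
have m0 : (0 < m)%N by move: n0; rewrite nE muln_gt0 => /andP[].
have pm' : ~~ (p %| m)%N by rewrite -prime_coprime.
have k0 : (0 < k)%N by rewrite logn_gt0 mem_primes pp n0 pdiv_dvd.
have mn : (m < n)%N by rewrite nE ltn_Pmulr // -[1%N](expn0 p) ltn_exp2l ?prime_gt1.
have [cm0 cm1] := IH m mn m0.
have rec j := @divisor_sum_pmul p j m pp m0 pm'.
have key j : 0 <= divisor_sum (p ^ j * m) /\
    (~~ odd j -> divisor_sum m <= divisor_sum (p ^ j * m)).
  case: (a3 p) => ap.
  - have -> : divisor_sum (p ^ j * m) = if odd j then 0 else divisor_sum m.
      elim: j => [|j IHj]; first by rewrite expn0 mul1n.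
      by rewrite rec IHj ap /=; case: (odd j) => /=; ring.
    by case: (odd j).
  - have -> : divisor_sum (p ^ j * m) = divisor_sum m.
      case: j => [|j]; first by rewrite expn0 mul1n.
      by rewrite rec ap mul0r addr0.
    by [].
  - have h : divisor_sum m <= divisor_sum (p ^ j * m).
      elim: j => [|j IHj]; first by rewrite expn0 mul1n.
      by rewrite rec ap mul1r lerDl (le_trans cm0).
    by split => //; apply: le_trans h.
rewrite nE mulnC; have [h1 h2] := key k; split => // ev.
have kev : ~~ odd k.
  by have := ev p; rewrite mulnC -nE.
apply: le_trans (h2 kev); apply: cm1 => r.
have e1 : logn r (p ^ k * m) = (logn r (p ^ k) + logn r m)%N.
  by rewrite lognM // expn_gt0 prime_gt0.
by have := ev r; rewrite e1 lognX oddD oddM (negPf kev).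
Qed.

End divisor_sums.

Section monsky.
Variables (R : realType) (a : nat -> R) (B C : R).
Hypotheses (aM : forall m n, a (m * n)%N = a m * a n) (a1 : a 1%N = 1)
  (a3 : forall n, [\/ a n = -1, a n = 0 | a n = 1])
  (aB : forall n, `|\sum_(0 <= k < n) a k| <= B)
  (aC : forall N, `|\sum_(0 <= n < N.+1) a n * n%:R^-1| <= C * N.+1%:R^-1).

Let geo (t : R) n := \sum_(0 <= k < n) t ^+ k.

Let geo_gt0 t n : 0 < t -> 0 < geo t n.+1.
Proof.
by move=> t0; rewrite /geo big_nat_recl // expr0 ltr_pwDl // sumr_ge0 // => k _; rewrite exprn_ge0 // ltW.
Qed.

Let geoS t n : geo t n.+1 = 1 + t * geo t n.
Proof.
rewrite /geo big_nat_recl // expr0 mulr_sumr; congr (_ + _).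
by apply: eq_bigr => k _; rewrite exprS.
Qed.

Let geoE t n : (1 - t) * geo t n = 1 - t ^+ n.
Proof.
elim: n => [|n IH]; first by rewrite /geo big_geq // mulr0 expr0 subrr.
by rewrite geoS mulrDr mulr1 mulrCA IH exprS; ring.
Qed.

(* AM-GM, pairing the terms of degrees [k] and [n - k] of the geometric sum. *)
Let geo_ge r n : 0 < r -> n.+1%:R * r ^+ n <= geo (r ^+ 2) n.+1.
Proof.
move=> r0; have [m ->] : exists m, n = (odd n + m.*2)%N.
  by exists n./2; rewrite odd_double_half.
elim: m => [|m IH].
  rewrite addn0; case: (odd n) => /=.
    rewrite geoS /geo big_nat1 expr0 mulr1 expr1.
    by have := sqr_ge0 (1 - r); rewrite -subr_ge0 sqrrB expr1n mul1r; lra.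
  by rewrite /geo big_nat1 !expr0 mulr1.
rewrite doubleS !addnS; move: IH; move: (odd n + m.*2)%N => j IH.
have step : geo (r ^+ 2) j.+3 = 1 + r ^+ 2 * geo (r ^+ 2) j.+1 + r ^+ j.+2 ^+ 2.
  rewrite geoS {1}/geo big_nat_recr //= -/(geo _ _) mulrDr addrA -exprS.
  by rewrite -exprM mulnC exprM.
rewrite step; have h := ler_wpM2l (sqr_ge0 r) IH.
have h2 := sqr_ge0 (1 - r ^+ j.+2).
have -> : j.+3%:R * r ^+ j.+2 = r ^+ 2 * (j.+1%:R * r ^+ j) + 2 * r ^+ j.+2.
  by rewrite -[j.+3]addn2 natrD -[j.+2]addn2 exprD; ring.
move: h2; rewrite sqrrB expr1n mul1r; lra.
Qed.

Section fixed_t.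
Variable r : R.
Hypotheses (r0 : 0 < r) (r1 : r < 1).
Let t := r ^+ 2.

Let t0 : 0 < t. Proof. by rewrite exprn_gt0. Qed.

Let t1 : t < 1. Proof. by rewrite /t expr_lt1 // ltW. Qed.

(** With n = k + 1 this is 1 / n - (1 - t) t^n / (1 - t^n), the gap between 1 / n and the
    coefficient of a n in (1 - t) times the Lambert series of a. *)
Let beta k := k.+1%:R^-1 - t ^+ k.+1 / geo t k.+1.

Let beta_ge0 k : 0 <= beta k.
Proof.
rewrite subr_ge0 ler_pdivrMr ?geo_gt0 // mulrC ler_pdivlMr ?ltr0n // mulrC.
apply: le_trans (geo_ge k r0); rewrite ler_wpM2l ?ler0n //.
rewrite -exprM ler_wiXn2l ?ltW //; lia.
Qed.

(** The difference is 1 / (n (n + 1)) - t^n / (g_n g_(n+1)) with n = k + 1 and g = [geo t]. The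
    bound [geo_ge], used for both factors, gives g_n g_(n+1) >= n (n + 1) r^(2n-1), and t^n = r^(2n)
    is smaller than r^(2n-1). *)
Let beta_decr k : beta k.+1 <= beta k.
Proof.
rewrite -subr_ge0 /beta.
have g1 := geo_gt0 k t0; have g2 := geo_gt0 k.+1 t0.
have -> : k.+1%:R^-1 - t ^+ k.+1 / geo t k.+1 - (k.+2%:R^-1 - t ^+ k.+2 / geo t k.+2) =
    (k.+1%:R * k.+2%:R)^-1 - t ^+ k.+1 / (geo t k.+1 * geo t k.+2).
  have e2 : (k.+2%:R : R) = k.+1%:R + 1 by rewrite natr1.
  have n1 : (k.+1%:R : R) != 0 by rewrite pnatr_eq0.
  have n2 : (k.+1%:R : R) + 1 != 0 by rewrite natr1 pnatr_eq0.
  have g1' := lt0r_neq0 g1; have g2' := lt0r_neq0 g2.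
  have gE : geo t k.+2 = 1 + t * geo t k.+1 := geoS t k.+1.
  rewrite e2 gE [t ^+ k.+2]exprS in g2' *.
  have key (x g u : R) : x != 0 -> x + 1 != 0 -> g != 0 -> 1 + t * g != 0 ->
      x^-1 - u / g - ((x + 1)^-1 - t * u / (1 + t * g)) = (x * (x + 1))^-1 - u / (g * (1 + t * g)).
    by move=> x0 x1 gn gn'; field; rewrite x0 x1 gn gn'.
  exact: key.
rewrite subr_ge0 ler_pdivrMr ?mulr_gt0 // mulrC ler_pdivlMr ?mulr_gt0 ?ltr0n //.
apply: (@le_trans _ _ ((k.+1%:R * r ^+ k) * (k.+2%:R * r ^+ k.+1))); last first.
  by apply: ler_pM; rewrite ?mulr_ge0 ?ler0n ?exprn_ge0 ?(ltW r0) // geo_ge.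
rewrite mulrACA mulrC ler_wpM2l ?mulr_ge0 ?ler0n // -exprM -exprD.
by rewrite ler_wiXn2l ?ltW //; lia.
Qed.

(** Three pieces: the sum of a n / n, small by [aC]; the sum of the a n beta n, bounded by Abel's
    inequality since beta decreases from 1 - t; and the truncation of each geometric series, at most
    t^N because n (floor(N / n) + 1) > N. *)
Lemma lambert_bound N :
  (1 - t) * `|\sum_(1 <= m < N.+1) divisor_sum a m * t ^+ m| <=
  C * N.+1%:R^-1 + (B + 1) * (1 - t) + N%:R * t ^+ N.
Proof.
have t10 : 0 <= 1 - t by rewrite subr_ge0 ltW.
have E : \sum_(1 <= m < N.+1) divisor_sum a m * t ^+ m =
    \sum_(1 <= n < N.+1) a n * \sum_(1 <= k < (N %/ n).+1) t ^+ (n * k).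
  under [RHS]eq_bigr do rewrite mulr_sumr.
  rewrite -(sum_divisor_pairs N (fun d n => a d * t ^+ n)) !big_nat.
  apply: eq_bigr => n /andP[n0 nN].
  by rewrite -mulr_suml sum_divisors_widen ?n0.
have G n : (0 < n)%N -> (1 - t) * \sum_(1 <= k < (N %/ n).+1) t ^+ (n * k) =
    t ^+ n / geo t n - t ^+ (n * (N %/ n).+1) / geo t n.
  case: n => [//|n] _; have g0 := geo_gt0 n t0; apply: (mulIf (lt0r_neq0 g0)).
  rewrite mulrAC geoE -mulrBl divfK ?lt0r_neq0 //.
  move: (N %/ n.+1)%N => K; elim: K => [|K IH]; first by rewrite big_geq // mulr0 muln1 subrr.
  by rewrite big_nat_recr //= mulrDr IH [X in _ = _ - t ^+ X]mulnS exprD; ring.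
have a_le1 n : `|a n| <= 1.
  by case: (a3 n) => ->; rewrite ?normrN ?normr1 ?normr0.
rewrite -(ger0_norm t10) -normrM (ger0_norm t10) E mulr_sumr.
have -> : \sum_(1 <= n < N.+1) (1 - t) * (a n * \sum_(1 <= k < (N %/ n).+1) t ^+ (n * k)) =
    \sum_(0 <= n < N.+1) a n * n%:R^-1 + (- \sum_(0 <= k < N) a k.+1 * beta k)
    + (- \sum_(1 <= n < N.+1) a n * (t ^+ (n * (N %/ n).+1) / geo t n)).
  rewrite [X in _ = X + _ + _]big_nat_recl // invr0 mulr0 add0r 2!big_add1 /= -!sumrB.
  by apply: eq_bigr => n _; rewrite mulrCA G // /beta; ring.
apply: le_trans (ler_normD _ _) _; apply: lerD.
  apply: le_trans (ler_normD _ _) _; apply: lerD; first exact: aC.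
  rewrite normrN; have <- : beta 0%N = 1 - t.
    by rewrite /beta /geo big_nat1 expr0 expr1 invr1 mulr1.
  apply: abel_bound => //.
  move=> n; have := aB n.+1; rewrite big_nat_recl //.
  set x := \sum_(_ <= _ < _) _ => h; rewrite -(addKr (a 0%N) x) addrC.
  by apply: le_trans (ler_normD _ _) _; rewrite normrN; apply: lerD.
rewrite normrN; apply: le_trans (ler_norm_sum _ _ _) _.
apply: (@le_trans _ _ (\sum_(1 <= n < N.+1) t ^+ N)); last first.
  by rewrite sumr_const_nat subn1 mulr_natl.
rewrite !big_nat; apply: ler_sum => -[//|n] /andP[_ nN].
have g1 : 1 <= geo t n.+1.
  by rewrite geoS lerDl mulr_ge0 ?(ltW t0) // sumr_ge0 // => k _; rewrite exprn_ge0 // ltW.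
rewrite normrM -[leRHS]mul1r; apply: ler_pM => //.
have pw0 : 0 <= t ^+ (n.+1 * (N %/ n.+1).+1) by rewrite exprn_ge0 // ltW.
have g0 := geo_gt0 n t0.
rewrite ger0_norm; last by rewrite divr_ge0 // ltW.
rewrite ler_pdivrMr //.
apply: le_trans (_ : t ^+ N <= _); last by rewrite ler_peMr // exprn_ge0 // ltW.
by rewrite ler_wiXn2l ?(ltW t0) ?(ltW t1) // ltnW // mulnC ltn_ceil.
Qed.

(** All terms are nonnegative; only the squares s^2 <= S^2 are kept, each contributing at least
    t^(S^2). *)
Lemma lambert_ge S :
  S%:R * t ^+ (S ^ 2) <= \sum_(1 <= m < (S ^ 2).+1) divisor_sum a m * t ^+ m.
Proof.
apply: (@le_trans _ _ (\sum_(1 <= s < S.+1) t ^+ (s ^ 2))).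
  have -> : S%:R * t ^+ (S ^ 2) = \sum_(1 <= s < S.+1) t ^+ (S ^ 2).
    by rewrite sumr_const_nat subn1 mulr_natl.
  rewrite !big_nat; apply: ler_sum => s /andP[_ sS].
  by rewrite ler_wiXn2l ?(ltW t0) ?(ltW t1) // leq_exp2r.
elim: S => [|S IH]; first by rewrite !big_geq.
have SS : ((S ^ 2).+1 <= S.+1 ^ 2)%N by rewrite ltn_exp2r.
rewrite big_nat_recr //= [leRHS](@big_cat_nat _ _ _ (S ^ 2).+1 1 _) //=; last by rewrite ltnW.
apply: lerD => //; rewrite big_nat_recr //=.
have c0 m : (0 < m)%N -> 0 <= divisor_sum a m * t ^+ m.
  move=> m0; apply: mulr_ge0; first by case: (divisor_sum_ge aM a1 a3 m0).
  by rewrite exprn_ge0 // ltW.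
rewrite -[leLHS]add0r; apply: lerD.
  rewrite big_nat sumr_ge0 // => m /andP[m0 _]; apply: c0.
  by apply: leq_trans m0.
have tS0 : 0 <= t ^+ (S.+1 ^ 2) by apply: exprn_ge0; exact: ltW.
rewrite ler_peMl //.
have [_] := @divisor_sum_ge _ a aM a1 a3 (S.+1 ^ 2) (leq_trans (ltn0Sn _) SS).
by apply => p; rewrite lognX mul2n odd_double.
Qed.

End fixed_t.

(* As t = r ^ 2 tends to 1, (1 - t) times the sum of the divisor_sum a m * t ^ m stays O(1 - t)
   by [lambert_bound], while the squares alone contribute about sqrt (1 - t) to it. *)
Lemma monsky_contradiction : False.
Proof.
have main S : (0 < S)%N -> S%:R * expR (-1) <= B + 1.
  move=> S0; have SR : 0 < S%:R :> R by rewrite ltr0n.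
  (* Chosen so that t = r^2 satisfies t^(S^2) = exp (-1): the lower bound is then S / e, while the
     upper one, divided by 1 - t, tends to B + 1 as N grows. *)
  pose r := expR (- (2 * S%:R ^+ 2)^-1) : R.
  have r0 : 0 < r by exact: expR_gt0.
  have r1 : r < 1 by rewrite /r expR_lt1 oppr_lt0 invr_gt0 mulr_gt0 // exprn_gt0.
  have t0 : 0 < r ^+ 2 by rewrite exprn_gt0.
  have t1 : 0 < 1 - r ^+ 2 by rewrite subr_gt0 expr_lt1 // ltW.
  have tS : (r ^+ 2) ^+ (S ^ 2) = expR (-1).
    rewrite -exprM /r -expRM_natl; congr expR.
    rewrite natrM natrX; field; exact: lt0r_neq0.
  (* One factor r^N absorbs N: (1 - r) N r^N is at most (1 - r) times the geometric sum, hence at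
     most 1; the other factor r^N tends to 0. *)
  have c1 : (fun N => N%:R * (r ^+ 2) ^+ N) @ \oo --> 0.
    apply: (@squeeze_cvgr _ _ _ _ (cst 0) (fun N => (1 - r)^-1 * r ^+ N)).
    - near=> N; apply/andP; split.
        by apply: mulr_ge0 => //; rewrite exprn_ge0 // ltW.
      rewrite exprAC expr2 mulrA.
      rewrite ler_wpM2r ?exprn_ge0 ?(ltW r0) // -[leRHS]mul1r ler_pdivlMr ?subr_gt0 //.
      apply: (@le_trans _ _ (geo r N * (1 - r))).
        rewrite ler_wpM2r ?subr_ge0 ?(ltW r1) // /geo.
        have -> : N%:R * r ^+ N = \sum_(0 <= k < N) r ^+ N.
          by rewrite sumr_const_nat subn0 mulr_natl.
        rewrite !big_nat; apply: ler_sum => k /andP[_ kN].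
        by rewrite ler_wiXn2l ?(ltW r0) ?(ltW r1) // ltnW.
      by rewrite mulrC geoE gerBl exprn_ge0 // ltW.
    - exact: cvg_cst.
    - rewrite -[X in _ --> X](mulr0 (1 - r)^-1); apply: cvgMr.
      by apply: cvg_expr; rewrite ger0_norm // ltW.
  have c2 : (fun N => C * N.+1%:R^-1 + (B + 1) * (1 - r ^+ 2) + N%:R * (r ^+ 2) ^+ N) @ \oo -->
      0 + (B + 1) * (1 - r ^+ 2) + 0.
    apply: cvgD => //; apply: cvgD; last exact: cvg_cst.
    by rewrite -(mulr0 C); apply: cvgMr; exact: cvg_harmonic.
  have : (1 - r ^+ 2) * (S%:R * expR (-1)) <= 0 + (B + 1) * (1 - r ^+ 2) + 0.
    apply: (ler_cvg_to (cvg_cst _) c2); near=> N.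
    apply: le_trans (lambert_bound r0 r1 N); rewrite ler_wpM2l ?(ltW t1) //.
    have SN : ((S ^ 2).+1 <= N.+1)%N by rewrite ltnS; near: N; exact: nbhs_infty_ge.
    apply: le_trans (ler_norm _); rewrite [leRHS](@big_cat_nat _ _ _ (S ^ 2).+1 1 _) //=.
    rewrite -[leLHS]addr0; apply: lerD.
      by have := lambert_ge r0 r1 S; rewrite tS.
    rewrite big_nat sumr_ge0 // => m /andP[m0 _].
    apply: mulr_ge0; last by rewrite exprn_ge0 // ltW.
    by case: (@divisor_sum_ge _ a aM a1 a3 m) => //; apply: leq_trans m0.
  by rewrite add0r addr0 mulrC ler_pM2r.
have e0 : 0 < expR (-1) :> R := expR_gt0 _.
pose S := (Num.truncn ((B + 2) / expR (-1))).+1.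
have := main S (ltn0Sn _); rewrite leNgt => /negP; apply.
apply: (@lt_trans _ _ (B + 2)); first by lra.
by rewrite -ltr_pdivrMr // /S truncnS_gt.
Unshelve. all: by end_near. Qed.

End monsky.

(** * The product of all L-functions *)

Definition unit_order (q p : nat) : nat := #[unit_of_nat q p]%g.

(* [- ln] of the partial product of (1 - p ^ (- t s)) ^ (phi / t), with s = 1 + e and t the
   order of p, i.e. the logarithm of the partial Euler product of all the L(s, chi). *)
Definition log_euler (R : realType) (q : nat) (e : R) (N : nat) : R :=
  \sum_(0 <= p < N | prime p && coprime p q)
    - ((totient q %/ unit_order q p)%:R * ln (1 - (p%:R^-1 * npow e p) ^+ unit_order q p)).

Section prime_weights.
Variables (R : realType) (e : R) (p : nat).
Hypotheses (e0 : 0 <= e) (pp : prime p).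

Lemma prime_weight_gt0 : 0 < p%:R^-1 * npow e p :> R.
Proof. by rewrite mulr_gt0 ?npow_gt0 // invr_gt0 ltr0n prime_gt0. Qed.

Lemma prime_weight_le : p%:R^-1 * npow e p <= p%:R^-1 :> R.
Proof. by rewrite ler_piMr ?npow_le1 // invr_ge0 ler0n. Qed.

Lemma prime_weight_le_half : p%:R^-1 * npow e p <= 2^-1 :> R.
Proof.
apply: le_trans prime_weight_le _; rewrite lef_pV2 ?posrE ?ltr0n ?prime_gt0 //.
by rewrite ler_nat prime_gt1.
Qed.

Lemma prime_weightX_le t : (0 < t)%N -> (p%:R^-1 * npow e p) ^+ t <= 2^-1 :> R.
Proof.
move=> t0; apply: le_trans _ prime_weight_le_half.
have h := prime_weight_gt0; have h' := prime_weight_le_half.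
rewrite -[leRHS]expr1 ler_wiXn2l //; first exact: ltW.
by apply: le_trans h' _; lra.
Qed.

Lemma prime_weightX_gt0 t : (0 < t)%N -> 0 < 1 - (p%:R^-1 * npow e p) ^+ t :> R.
Proof. by move=> t0; have := prime_weightX_le t0; lra. Qed.

End prime_weights.

Lemma log_euler_ge0 (R : realType) q (e : R) N : 0 <= e -> 0 <= log_euler q e N.
Proof.
move=> e0; rewrite sumr_ge0 // => p /andP[pp pq].
rewrite oppr_ge0 mulr_ge0_le0 ?ler0n // ln_le0 // gerBl exprn_ge0 //.
exact: ltW (prime_weight_gt0 e pp).
Qed.

Lemma expR_mul_ln (R : realType) (k : nat) (y : R) : 0 < y -> expR (k%:R * ln y) = y ^+ k.
Proof. by move=> y0; rewrite expRM_natl lnK. Qed.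

Lemma norm_complex_ex (R : realType) (z : R[i]) : exists2 r : R, 0 <= r & `|z| = r%:C.
Proof. by rewrite normc_def; exists (Num.sqrt (complex.Re z ^+ 2 + complex.Im z ^+ 2)) => //; exact: sqrtr_ge0. Qed.

Lemma norm_mul_le (R : realType) (x y : R[i]) (a b : R) :
  `|x| <= a%:C -> `|y| <= b%:C -> `|x * y| <= (a * b)%:C.
Proof. by move=> xa yb; rewrite normrM rmorphM; apply: ler_pM. Qed.

Lemma norm_prod_le (R : realType) (I : finType) (P : pred I) (x : I -> R[i]) (a : I -> R) :
  (forall i, P i -> `|x i| <= (a i)%:C) ->
  `|\prod_(i | P i) x i| <= (\prod_(i | P i) a i)%:C.
Proof.
move=> xa; elim/big_rec2 : _ => [|i y z Pi IH]; first by rewrite normr1.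
by apply: norm_mul_le => //; exact: xa.
Qed.

Section all_characters.
Variables (R : realType) (q : nat) (chi : 'I_(totient q) -> nat -> R[i]).
Hypotheses (q0 : (0 < q)%N)
  (chiD : forall i, dirichlet_character q (chi i))
  (chiI : injective chi)
  (chiE : forall f, dirichlet_character q f -> exists i, f = chi i)
  (chiS : forall n, \sum_i chi i n = if (n == 1 %[mod q])%N then (totient q)%:R else 0)
  (chiP : forall p z, coprime p q -> (unit_order q p %| totient q)%N /\
     \prod_i (1 - chi i p * z) =
     (1 - z ^+ unit_order q p) ^+ (totient q %/ unit_order q p)).

Lemma prod_euler_factors e N : 0 <= e ->
  \prod_i \prod_(0 <= p < N | prime p) (1 - chi i p * (p%:R^-1 * npow e p)%:C) =
  (expR (- log_euler q e N))%:C.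
Proof.
move=> e0; rewrite exchange_big /= /log_euler -sumrN expR_sum rmorph_prod /=.
rewrite big_mkcondr; apply: eq_bigr => p pp; case: ifP => [pq|/negbT pq]; last first.
  by rewrite big1 // => i _; rewrite (dchar0 (chiD i)) // mul0r subr0.
have [_ ->] := chiP (p%:R^-1 * npow e p)%:C pq; rewrite opprK.
rewrite -rmorphXn -(rmorph1 (real_complex R)) -rmorphB -rmorphXn /=; congr (_%:C).
have t0 : (0 < unit_order q p)%N by exact: order_gt0.
by rewrite expR_mul_ln // prime_weightX_gt0.
Qed.

Lemma prod_L_value_euler e : 0 < e ->
  ccvg (fun N => \prod_i L_value (chi i) e * (expR (- log_euler q e N))%:C) 1.
Proof.
move=> e0; have := ccvg_prod (P := predT) (fun i _ => euler_product q0 (chiD i) e0).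
rewrite big1 //; apply: ccvg_near_eq; near=> N.
by rewrite big_split prod_euler_factors // ltW.
Unshelve. all: by end_near. Qed.

(** The inverse Euler products are at most 1, as [log_euler] is nonnegative, yet their product with
    the L-values tends to 1. *)
Lemma prod_L_value_ge1 e b : 0 < e -> `|\prod_i L_value (chi i) e| <= b%:C -> 1 <= b.
Proof.
move=> e0 hb; rewrite -lecR -[X in X <= _](normr1 R[i]).
apply: (ccvg_norm_le (prod_L_value_euler e0)); near=> N.
rewrite normrM norm_real_complex (ger0_norm (expR_ge0 _)) -[X in _ <= X]mulr1.
apply: ler_pM => //; first by rewrite ler0c expR_ge0.
by rewrite -[1]/(1%:C) lecR -expR0 ler_expR oppr_le0 log_euler_ge0 // ltW.
Unshelve. all: by end_near. Qed.

Lemma principal_dirichlet : dirichlet_character q (principal_character R q).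
Proof.
split=> [m n|n|n]; rewrite /principal_character.
- by rewrite coprimeMl; case: (coprime m q); case: (coprime n q); rewrite ?mulr1 ?mulr0.
- by rewrite -coprime_modl modnDr coprime_modl.
- by case: (coprime n q); rewrite ?oner_eq0 ?eqxx.
Qed.

Variable i0 : 'I_(totient q).
Hypothesis chi0 : chi i0 = principal_character R q.

Lemma chi_nonprincipal i : i != i0 -> chi i <> principal_character R q.
Proof. by move=> ii0 ci; move/eqP: ii0; apply; apply: chiI; rewrite ci. Qed.

Lemma L_value_package i : i != i0 -> exists C : R,
  [/\ ccvg (fun N => \sum_(0 <= n < N) chi i n * (n%:R^-1)%:C) (L_value (chi i) 0),
      forall N, `|\sum_(0 <= n < N.+1) chi i n * (n%:R^-1)%:C - L_value (chi i) 0| <=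
        (C * N.+1%:R^-1)%:C,
      forall N, `|\sum_(0 <= n < N) chi i n * (n%:R^-1 * ln n%:R)%:C| <= C%:C &
      forall e, 0 < e -> `|L_value (chi i) e - L_value (chi i) 0| <= (C * e)%:C].
Proof.
move=> ii0; apply: (@L_value_nonprincipal R (chi i) _ q q0).
- exact: (dchar_norm_le1 q0 (chiD i)).
- exact: (dcharD (chiD i)).
- exact: (dchar_sum0 q0 (chiD i) (chi_nonprincipal ii0)).
Qed.

(* Two vanishing values L(1, chi) would make the product of all the L(1 + e, chi), which is at
   least 1, tend to 0 with e: the simple pole of the principal one compensates only one zero. *)
Lemma L_value_zero_unique i j : i != i0 -> j != i0 -> i != j ->
  L_value (chi i) 0 = 0 -> L_value (chi j) 0 = 0 -> False.
Proof.
move=> ii0 ji0 ij Li Lj.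
have [Ci [_ _ _ Lie]] := L_value_package ii0.
have [Cj [_ _ _ Lje]] := L_value_package ji0.
have [C0 L0e] := L_value_principal R q0; rewrite -chi0 in L0e.
have e1 : (0 : R) < 1 by [].
have /boolp.choice[b hb] (k : 'I_(totient q)) : exists x : R, 0 <= x /\ (k != i0 ->
    forall e, 0 < e <= 1 -> `|L_value (chi k) e| <= x%:C).
  have [->|ki0] := eqVneq k i0; first by exists 0; split.
  have [Ck [_ _ _ Lke]] := L_value_package ki0.
  have Ck0 : 0 <= Ck by have := le_trans (normr_ge0 _) (Lke 1 e1); rewrite mulr1 ler0c.
  have [r r0 rE] := norm_complex_ex (L_value (chi k) 0).
  exists (r + Ck); split; first by rewrite addr_ge0.
  move=> _ e /andP[e0 ele1]; rewrite -(subrK (L_value (chi k) 0) (L_value (chi k) e)) addrC.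
  apply: le_trans (ler_normD _ _) _; rewrite rmorphD; apply: lerD; first by rewrite rE.
  by apply: le_trans (Lke e e0) _; rewrite lecR ler_piMr.
have Ci0 : 0 <= Ci by have := le_trans (normr_ge0 _) (Lie 1 e1); rewrite mulr1 ler0c.
have Cj0 : 0 <= Cj by have := le_trans (normr_ge0 _) (Lje 1 e1); rewrite mulr1 ler0c.
have C00 : 0 <= C0.
  have := le_trans (normr_ge0 _) (L0e 1 _); rewrite mulr1 ler0c; apply.
  by rewrite ltr01 lexx.
pose D := (totient q)%:R / q%:R + C0.
have L0 e : 0 < e <= 1 -> `|L_value (chi i0) e| <= (D / e)%:C.
  move=> /[dup] ee /andP[e0 ele1].
  have -> : L_value (chi i0) e = (e^-1)%:C * (e%:C * L_value (chi i0) e).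
    by rewrite mulrA -rmorphM /= mulVf ?mul1r // gt_eqF.
  have ei0 : 0 <= e^-1 by rewrite invr_ge0 ltW.
  rewrite normrM norm_real_complex (ger0_norm ei0) [leLHS]mulrC [leRHS]rmorphM.
  rewrite ler_wpM2r ?ler0c //.
  rewrite -(subrK ((totient q)%:R / q%:R)%:C (e%:C * _)) addrC.
  apply: le_trans (ler_normD _ _) _; rewrite rmorphD; apply: lerD.
    by rewrite norm_real_complex ger0_norm // divr_ge0 ?ler0n.
  by apply: le_trans (L0e e ee) _; rewrite lecR ler_piMr.
pose P := \prod_(k | [&& k != i0, k != i & k != j]) b k.
have P0 : 0 <= P by apply: prodr_ge0 => k _; case: (hb k).
have bound e : 0 < e <= 1 -> 1 <= D * Ci * Cj * P * e.
  move=> /[dup] ee /andP[e0 ele1]; apply: (prod_L_value_ge1 e0).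
  rewrite (bigD1 i0) //= (bigD1 i) //= (bigD1 j) /=; last by rewrite ji0 eq_sym.
  have -> : D * Ci * Cj * P * e = D / e * ((Ci * e) * ((Cj * e) * P)).
    by field; rewrite gt_eqF.
  apply: norm_mul_le; first exact: L0.
  apply: norm_mul_le; first by have := Lie e e0; rewrite Li subr0.
  apply: norm_mul_le; first by have := Lje e e0; rewrite Lj subr0.
  rewrite (eq_bigl [pred k | [&& k != i0, k != i & k != j]]); last by move=> k /=; rewrite andbA.
  apply: norm_prod_le => k /and3P[ki0 _ _].
  by case: (hb k) => _; apply.
set K := D * Ci * Cj * P in bound.
have K1 : 1 <= K by have := bound 1; rewrite mulr1 ltr01 lexx; apply.
have K0 : 0 < K by exact: lt_le_trans K1.
(* One factor e is left after the two zeros have been set against the pole, so e = 1 / (2 K) turns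
   the bound into 1 <= 1 / 2. *)
have := bound ((2 * K)^-1); rewrite invfM mulrCA mulfV ?gt_eqF // mulr1.
rewrite mulr_gt0 ?invr_gt0 //=.
have KI : K^-1 <= 1 by rewrite invf_le1.
have h : 2^-1 / K <= 1 by lra.
by move=> /(_ h); rewrite leNgt invf_lt1 ?ltr1n.
Qed.

Lemma conjM_real (z : R[i]) (x : R) : (z * x%:C)^* = z^* * x%:C.
Proof. by case: z => a b; congr (_ +i* _) => /=; ring. Qed.

Lemma ccvg_conj (u : nat -> R[i]) l : ccvg u l -> ccvg (fun n => (u n)^*) l^*.
Proof.
move=> [u1 u2]; split.
  by have -> : (fun n => complex.Re (u n)^*) = (fun n => complex.Re (u n));
    [apply/funext => n; case: (u n)|case: (l) u1].
have -> : (fun n => complex.Im (u n)^*) = (fun n => - complex.Im (u n)).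
  by apply/funext => n; case: (u n).
have -> : complex.Im l^* = - complex.Im l by case: (l).
exact: cvgN.
Qed.

(** A zero at chi is also one at its conjugate, so a nonreal chi would give two zeros; a real chi
    takes its values in {-1, 0, 1} and falls under Monsky's argument. *)
Lemma L_value_neq0 i : i != i0 -> L_value (chi i) 0 != 0.
Proof.
move=> ii0; apply/eqP => Li.
have [j cj] := chiE (dchar_conj (chiD i)).
have ji0 : j != i0.
  apply: contra_not_neq (chi_nonprincipal ii0) => ji; apply/funext => n.
  have /(congr1 (@^~ n)) := cj; rewrite ji chi0 /principal_character => /(congr1 conjc).
  by rewrite conjcK => ->; rewrite conjc_nat.
have [Ci [ci1 ci2 _ _]] := L_value_package ii0.
have [Cj [cj1 _ _ _]] := L_value_package ji0.
have Lj : L_value (chi j) 0 = 0.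
  apply: (ccvg_unique cj1); have := ccvg_conj ci1; rewrite Li conjc0.
  apply: ccvg_near_eq; near=> N; rewrite rmorph_sum; apply: eq_bigr => n _.
  by apply: etrans (conjM_real _ _) _; rewrite -cj.
have [ij|ij] := eqVneq i j; last exact: (L_value_zero_unique ii0 ji0 ij Li Lj).
have real n : chi i n = (complex.Re (chi i n))%:C.
  have /(congr1 (@^~ n)) := cj; rewrite -ij; case: (chi i n) => a b [] /eqP.
  by rewrite -subr_eq0 -opprD oppr_eq0 -mulr2n mulrn_eq0 /= => /eqP ->.
have sgn n : `|complex.Re (chi i n)| = (coprime n q)%:R.
  have := dchar_norm q0 (chiD i) n; rewrite real norm_real_complex.
  by rewrite -(rmorph_nat (real_complex R)) => /complexI.
apply: (@monsky_contradiction R (fun n => complex.Re (chi i n)) q%:R Ci).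
- by move=> m n; have := dcharM (chiD i) m n; rewrite (real m) (real n) -rmorphM => ->.
- by have := dchar1 (chiD i) => ->.
- move=> n; have := sgn n; case: (coprime n q) => /eqP /=; last first.
    by rewrite normr_eq0 => /eqP ->; constructor 2.
  rewrite eqr_norml ler01 andbT => /orP[] /eqP ->; first by constructor 3.
  by constructor 1.
- move=> n; have := @periodic_bound R (fun n => complex.Re (chi i n)) 1 q q0.
  rewrite mulr1; apply => [m||m].
  + by rewrite (dcharD (chiD i)).
  + by rewrite -Re_sum (dchar_sum0 q0 (chiD i) (chi_nonprincipal ii0)).
  + exact: norm_Re_le (dchar_norm_le1 q0 (chiD i) m).
- by move=> N; have := norm_Re_le (ci2 N); rewrite Li subr0 Re_sum_real.
Unshelve. all: by end_near. Qed.

(** Writing ln as a divisor sum of [mangoldt], the bounded sum of chi(n) ln n / n becomes that of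
    chi(d) mangoldt(d) / d times a partial sum of L(1, chi). Replacing the latter by L costs O(1),
    and L <> 0 can be divided out. *)
Lemma sum_chi_mangoldt_bounded i : i != i0 -> exists K : R, forall N,
  `|\sum_(1 <= d < N.+1) chi i d * (mangoldt R d * d%:R^-1)%:C| <= K%:C.
Proof.
move=> ii0; have [C [_ TL Cl _]] := L_value_package ii0.
have L0 := L_value_neq0 ii0; set L := L_value (chi i) 0 in TL L0.
have C0 : 0 <= C.
  by have := le_trans (normr_ge0 _) (TL 0%N); rewrite invr1 mulr1 ler0c.
have [r r0 rE] := norm_complex_ex L.
have rn0 : r != 0 by move: L0; rewrite -normr_eq0 rE -[0]/(0%:C) (inj_eq (@complexI _)).
exists ((C + 4 * C) / r) => N.
set S := \sum_(_ <= _ < _) _.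
have T1 k : \sum_(1 <= m < k.+1) chi i m * (m%:R^-1)%:C =
    \sum_(0 <= m < k.+1) chi i m * (m%:R^-1)%:C.
  by rewrite [RHS]big_ltn // invr0 mulr0 add0r.
have E : \sum_(0 <= n < N.+1) chi i n * (n%:R^-1 * ln n%:R)%:C =
    L * S + \sum_(1 <= d < N.+1) chi i d * (mangoldt R d * d%:R^-1)%:C *
      (\sum_(0 <= m < (N %/ d).+1) chi i m * (m%:R^-1)%:C - L).
  rewrite /S mulr_sumr -big_split /= big_ltn // invr0 mul0r mulr0 add0r.
  transitivity (\sum_(1 <= n < N.+1) \sum_(1 <= d < N.+1 | (d %| n)%N)
      chi i n * (n%:R^-1 * mangoldt R d)%:C).
    rewrite !big_nat; apply: eq_bigr => n /andP[n0 nN].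
    rewrite -mulr_sumr -rmorph_sum -mulr_sumr sum_divisors_widen ?n0 //.
    by rewrite sum_mangoldt_divisors.
  rewrite (sum_divisor_pairs N (fun d n => chi i n * (n%:R^-1 * mangoldt R d)%:C)).
  apply: eq_bigr => d _; rewrite mulrBr [L * _]mulrC addrC subrK -T1 mulr_sumr.
  apply: eq_bigr => m _; rewrite (dcharM (chiD i)) natrM invfM !rmorphM /=.
  by ring.
have LS : `|L * S| <= (C + 4 * C)%:C.
  rewrite -(addrK (\sum_(1 <= d < N.+1) chi i d * (mangoldt R d * d%:R^-1)%:C *
      (\sum_(0 <= m < (N %/ d).+1) chi i m * (m%:R^-1)%:C - L)) (L * S)) -E.
  apply: le_trans (ler_normB _ _) _; rewrite rmorphD; apply: lerD; first exact: Cl.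
  apply: le_trans (ler_norm_sum _ _ _) _.
  case: N @S T1 E => [|N] S T1 E; first by rewrite big_geq // ler0c mulr_ge0.
  have NR : 0 < N.+1%:R :> R by rewrite ltr0n.
  (* The remainder after N / d terms, of order d / N, cancels the factor 1 / d; what is left is C
     psi(N) / N, at most 4 * C by Chebyshev. *)
  apply: (@le_trans _ _ (\sum_(1 <= d < N.+2) (mangoldt R d * (C * N.+1%:R^-1))%:C)).
    rewrite !big_nat; apply: ler_sum => d /andP[d0 dN].
    have dR : 0 < d%:R :> R by rewrite ltr0n.
    have md : 0 <= mangoldt R d * d%:R^-1.
      by rewrite mulr_ge0 ?mangoldt_ge0 // invr_ge0 ler0n.
    rewrite !normrM norm_real_complex (ger0_norm md).
    apply: (@le_trans _ _ (1 * (mangoldt R d * d%:R^-1)%:C * (C * (N.+1 %/ d).+1%:R^-1)%:C)).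
      apply: ler_pM => //; first by rewrite mulr_ge0 // ler0c.
      by rewrite ler_wpM2r ?ler0c // (dchar_norm_le1 q0).
    rewrite mul1r -rmorphM lecR -mulrA ler_wpM2l ?mangoldt_ge0 //.
    rewrite mulrCA ler_wpM2l // -invfM lef_pV2 ?posrE ?mulr_gt0 // ?ltr0n //.
    by rewrite -natrM ler_nat mulnC ltnW // ltn_ceil.
  rewrite -rmorph_sum lecR /= -mulr_suml mulrCA [4 * C]mulrC ler_wpM2l //.
  by rewrite ler_pdivrMr //; exact: chebyshev_psi_le.
have -> : S = L^-1 * (L * S) by rewrite mulKf.
rewrite normrM normfV rE mulrC rmorphM fmorphV.
by rewrite ler_wpM2r // invr_ge0 ler0c.
Qed.

(* The nonprincipal characters contribute bounded sums, and the prime powers and the primes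
   dividing q a convergent series. *)
Lemma mertens_progression : exists K : R, forall N,
  `|\sum_(1 <= p < N.+1 | prime p && (p == 1 %[mod q])%N)
     (totient q)%:R * (ln p%:R * p%:R^-1) - ln N%:R| <= K.
Proof.
have /boolp.choice[b hb] (i : 'I_(totient q)) : exists x : R, i != i0 -> forall N,
    `|\sum_(1 <= d < N.+1) chi i d * (mangoldt R d * d%:R^-1)%:C| <= x%:C.
  have [->|ii0] := eqVneq i i0; first by exists 0.
  by have [K hK] := sum_chi_mangoldt_bounded ii0; exists K.
pose w d : R := mangoldt R d * d%:R^-1.
have w0 d : 0 <= w d by rewrite mulr_ge0 ?mangoldt_ge0 // invr_ge0 ler0n.
pose A := \sum_(1 <= d < q.+1) w d.
pose K1 := \sum_(i | i != i0) b i.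
have phi0 : 0 <= (totient q)%:R :> R by [].
exists (K1 + (2 + A) + 2 * (totient q)%:R + 4) => N.
(* Orthogonality detects d = 1 mod q: the principal character yields the sum over d coprime to q,
   the others at most K1 together. *)
have h1 : `|(totient q)%:R * (\sum_(1 <= d < N.+1 | (d == 1 %[mod q])%N) w d) -
    \sum_(1 <= d < N.+1 | coprime d q) w d| <= K1.
  rewrite -lecR -norm_real_complex rmorphB /= rmorphM !rmorph_sum /=.
  have -> : (totient q)%:R%:C * (\sum_(1 <= d < N.+1 | (d == 1 %[mod q])%N) (w d)%:C) =
      \sum_i \sum_(1 <= d < N.+1) chi i d * (w d)%:C.
    rewrite exchange_big /= mulr_sumr big_mkcond; apply: eq_bigr => d _.
    by rewrite -mulr_suml chiS; case: ifP => _; rewrite ?mul0r // rmorph_nat.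
  rewrite (bigD1 i0) //= chi0.
  have -> : \sum_(1 <= d < N.+1) principal_character R q d * (w d)%:C =
      \sum_(1 <= d < N.+1 | coprime d q) (w d)%:C.
    rewrite [RHS]big_mkcond; apply: eq_bigr => d _; rewrite /principal_character.
    by case: (coprime d q); rewrite ?mul1r ?mul0r.
  rewrite addrAC subrr add0r; apply: le_trans (ler_norm_sum _ _ _) _.
  by apply: ler_sum => i ii0; exact: hb.
have np := sum_mangoldt_nonprime R N.
(* A d not coprime to q is either not prime, which costs 2 in all, or a prime divisor of q, hence at
   most q and counted in A. *)
have h2 : 0 <= \sum_(1 <= d < N.+1) w d - \sum_(1 <= d < N.+1 | coprime d q) w d <= 2 + A.
  rewrite (bigID (fun d => coprime d q)) /= addrAC subrr add0r sumr_ge0 //=.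
  apply: (@le_trans _ _ (\sum_(1 <= d < N.+1) mangoldt R d * (if prime d then 0 else d%:R^-1) +
      \sum_(1 <= d < N.+1) (if (d <= q)%N then w d else 0))).
    rewrite big_mkcond -big_split; apply: ler_sum => d _ /=.
    have [pd|pd] := boolP (prime d); last first.
      by case: ifP => _; [case: ifP => _; rewrite ?lerDl ?addr0|rewrite addr_ge0 ?w0 //; case: ifP].
    rewrite mulr0 add0r; case: ifP => [dq|_]; last by case: ifP.
    rewrite ifT // dvdn_leq //; move: dq; rewrite prime_coprime // negbK //.
  apply: lerD => //; apply: (@le_trans _ _ (\sum_(1 <= d < (q + N).+1) (if (d <= q)%N then w d else 0))).
    rewrite [leRHS](@big_cat_nat _ _ _ N.+1 1 _) //= ?ltnS ?leq_addl //.
    by rewrite lerDl sumr_ge0 // => d _; case: ifP.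
  rewrite (@big_cat_nat _ _ _ q.+1 1 _) //= ?ltnS ?leq_addr // [X in _ + X]big_nat.
  rewrite [X in _ + X]big1 ?addr0; last by move=> d /andP[qd _]; rewrite leqNgt qd.
  by rewrite /A !big_nat; apply: ler_sum => d /andP[_ dq]; case: ifP.
have h3 : 0 <= \sum_(1 <= d < N.+1 | (d == 1 %[mod q])%N) w d -
    \sum_(1 <= p < N.+1 | prime p && (p == 1 %[mod q])%N) ln p%:R * p%:R^-1 <= 2.
  have -> : \sum_(1 <= p < N.+1 | prime p && (p == 1 %[mod q])%N) ln p%:R * p%:R^-1 =
      \sum_(1 <= d < N.+1 | (d == 1 %[mod q])%N) (if prime d then w d else 0).
    under eq_bigl do rewrite andbC.
    by rewrite big_mkcondr; apply: eq_bigr => d _; case: ifP => // pd; rewrite /w mangoldt_prime.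
  rewrite -sumrB; apply/andP; split.
    by rewrite sumr_ge0 // => d _; case: ifP => _; rewrite ?subrr ?subr0.
  apply: le_trans np; rewrite big_mkcond; apply: ler_sum => d _.
  case: ifP => _; case: ifP => _; rewrite ?subrr ?subr0 ?mulr0 //.
  exact: w0.
have h4 : `|\sum_(1 <= d < N.+1) w d - ln N%:R| <= 4.
  case: N {np h1 h2 h3} => [|N]; first by rewrite big_geq // ln0 // subr0 normr0.
  by have /andP[m1 m2] := mertens_first R (ltn0Sn N); rewrite ler_norml /w; apply/andP; split; lra.
rewrite -mulr_sumr; move: h1 h2 h3 h4.
move: (\sum_(_ <= _ < _ | _) _) (\sum_(_ <= _ < _ | coprime _ _) _) => X1 X2.
move: (\sum_(_ <= _ < _) _) (\sum_(_ <= _ < _ | prime _ && _) _) => X3 X4.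
rewrite ler_norml => /andP[a1 a2] /andP[b1 b2] /andP[c1 c2].
have c1' := mulr_ge0 phi0 c1; have c2' := ler_wpM2l phi0 c2.
rewrite !ler_norml => /andP[d1 d2]; rewrite mulrBr in c1' c2'.
clear -a1 a2 b1 b2 c1' c2' d1 d2 phi0.
by apply/andP; split; lra.
Qed.

End all_characters.

(** * Powers of two as a model for the primes congruent to 1 *)

Lemma euler_gamma_cvg (R : realType) :
  (fun n : nat => \sum_(1 <= k < n.+1) (k%:R : R)^-1 - ln (n%:R : R)) @ \oo --> euler_gamma R.
Proof.
rewrite /euler_gamma; set u := fun n : nat => _.
(* The sequence decreases only from n = 1 on: u 0 = 0 because [ln 0 = 0], but u 1 = 1. *)
suff : cvgn (fun n => u n.+1).
  by move=> /cvg_ex[l] /= ul; apply/cvg_ex; exists l; rewrite -cvg_shiftS.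
apply: nonincreasing_is_cvgn.
  apply/nonincreasing_seqP => n; rewrite /u [in X in X <= _]big_nat_recr //=.
  by have := ln_nat_diff_ge R n.+1; rewrite addr0 -addrA lerD2l lerBlDr [- _ + _]addrC.
exists 0 => _ [n _ <-]; rewrite /u subr_ge0.
apply: (@le_trans _ _ (\sum_(1 <= k < n.+1) (k%:R : R)^-1)); last first.
  by rewrite [leRHS]big_nat_recr //= lerDl invr_ge0 ler0n.
elim: n => [|n IH]; first by rewrite ln1 big_geq.
rewrite big_nat_recr //=; have /andP[_] := ln_nat_diff R n.+1.
by rewrite lerBlDr => /le_trans; apply; rewrite [X in X <= _]addrC lerD2r.
Qed.

Section powers_of_two.
Variable R : realType.

(** Coefficients of - ln (1 - 2^(-e)) as a Dirichlet series in n^(-e). The range of m loses nothing,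
    as m < 2^m. *)
Definition pow2_weight (n : nat) : R := \sum_(1 <= m < n.+1 | (2 ^ m == n)%N) m%:R^-1.

Lemma sum_pow2_weight (F : nat -> R) N : (0 < N)%N ->
  \sum_(0 <= n < N.+1) pow2_weight n * F n =
  \sum_(1 <= m < (trunc_log 2 N).+1) m%:R^-1 * F (2 ^ m)%N.
Proof.
move=> N0; have wE n : (n <= N)%N ->
    pow2_weight n = \sum_(1 <= m < N.+1 | (2 ^ m == n)%N) m%:R^-1.
  move=> nN; rewrite /pow2_weight [RHS](@big_cat_nat _ _ _ n.+1 1 N.+1) //=.
  rewrite [X in _ = _ + X]big_nat_cond [X in _ = _ + X]big1 ?addr0 //.
  move=> m /andP[/andP[nm _] /eqP mn].
  by have := ltn_trans nm (ltn_expl m (isT : 1 < 2)%N); rewrite mn ltnn.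
transitivity (\sum_(0 <= n < N.+1) \sum_(1 <= m < N.+1 | (2 ^ m == n)%N) m%:R^-1 * F n).
  by rewrite !big_nat; apply: eq_bigr => n /andP[_ nN]; rewrite wE // mulr_suml.
under eq_bigr do rewrite big_mkcond.
rewrite exchange_big /=.
transitivity (\sum_(1 <= m < N.+1 | (2 ^ m <= N)%N) m%:R^-1 * F (2 ^ m)%N).
  rewrite [RHS]big_mkcond; apply: eq_bigr => m _; rewrite -big_mkcond /=.
  case: ifP => mN.
    rewrite (eq_bigl (pred1 (2 ^ m)%N)); last by move=> d /=; rewrite eq_sym.
    rewrite -big_filter filter_pred1_uniq ?iota_uniq ?big_seq1 //.
    by rewrite mem_index_iota /= ltnS.
  rewrite big_nat_cond big1 // => d /andP[/andP[_ dN] /eqP md].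
  by move: dN; rewrite ltnS -md mN.
have /andP[l1 l2] := @trunc_log_bounds 2 N isT N0.
have lN : (trunc_log 2 N <= N)%N by apply: ltnW; apply: leq_trans (ltn_expl _ _) l1.
rewrite (@big_cat_nat _ _ _ (trunc_log 2 N).+1 1 N.+1) //=.
rewrite [X in _ + X]big_nat_cond [X in _ + X]big1 ?addr0; last first.
  move=> m /andP[/andP[lm _] mN].
  by have := leq_trans l2 (leq_trans (leq_pexp2l (ltn0Sn 1) lm) mN); rewrite ltnn.
rewrite big_nat_cond [RHS]big_nat; apply: eq_bigl => m; rewrite andbC.
apply: andb_idl => /andP[_ ml]; apply: leq_trans l1.
by rewrite leq_exp2l.
Qed.

(** Every power of two contributes ln 2, so the sum is floor(log_2 N) ln 2; this is the main term of
    [mertens_progression]. *)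
Lemma sum_pow2_weight_ln N : (0 < N)%N ->
  ln N%:R - ln 2 <= \sum_(0 <= n < N.+1) pow2_weight n * ln n%:R <= ln N%:R.
Proof.
move=> N0; rewrite sum_pow2_weight //.
have -> : \sum_(1 <= m < (trunc_log 2 N).+1) m%:R^-1 * ln (2 ^ m)%:R =
    (trunc_log 2 N)%:R * ln 2 :> R.
  rewrite big_nat (eq_bigr (fun _ => ln 2)) => [|m /andP[m0 _]].
    by rewrite -big_nat sumr_const_nat subn1 mulr_natl.
  by rewrite natrX lnXn // -[ln 2 *+ m]mulr_natl mulrA mulVf ?mul1r // pnatr_eq0 -lt0n.
have /andP[l1 l2] := @trunc_log_bounds 2 N isT N0.
rewrite mulr_natl -lnXn // -natrX; apply/andP; split; last first.
  by rewrite ler_ln ?posrE ?ltr0n ?expn_gt0 // ler_nat.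
rewrite lerBlDr -lnM ?posrE ?ltr0n ?expn_gt0 // -natrM -expnSr.
by rewrite ler_ln ?posrE ?ltr0n ?expn_gt0 // ler_nat ltnW.
Qed.

(** Mean value theorem for the function f inside the norm: f 0 = 0, and its derivative at y is - y^M
    / (1 - y). *)
Lemma log_series_remainder (x : R) M : 0 < x < 1 ->
  `|\sum_(1 <= m < M.+1) m%:R^-1 * x ^+ m + ln (1 - x)| <= x ^+ M.+1 / (1 - x).
Proof.
move=> /andP[x0 x1].
pose f (y : R) := \sum_(1 <= m < M.+1) m%:R^-1 * y ^+ m + ln (1 - y).
have df (y : R) : y < 1 -> is_derive y (1 : R) f (- (y ^+ M / (1 - y))).
  move=> y1; rewrite /f; elim: M {f} => [|M IH].
    have -> : (fun y : R => \sum_(1 <= m < 1) m%:R^-1 * y ^+ m + ln (1 - y)) =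
        (@ln R \o (fun y => 1 - y)).
      by apply/funext => z; rewrite big_geq // add0r.
    rewrite expr0 mul1r -mulrN1 -[-1](sub0r 1).
    apply: is_derive1_comp; first by apply: is_derive1_ln; rewrite subr_gt0.
  have -> : (fun y : R => \sum_(1 <= m < M.+2) m%:R^-1 * y ^+ m + ln (1 - y)) =
     (fun y : R => \sum_(1 <= m < M.+1) m%:R^-1 * y ^+ m + ln (1 - y)) +
     (M.+1%:R^-1 \*: (id ^+ M.+1)).
    apply/funext => z; rewrite big_nat_recr //= addrAC.
    transitivity (\sum_(1 <= m < M.+1) m%:R^-1 * z ^+ m + ln (1 - z) +
      M.+1%:R^-1 *: ((id ^+ M.+1) z)); last by [].
    by rewrite exprfctE.
  apply: is_derive_eq (is_deriveD IH (is_deriveZ _ (is_deriveX M.+1 (is_derive_id y 1)))) _.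
  have n0 : M.+1%:R != 0 :> R by rewrite pnatr_eq0.
  rewrite -[M.+1.-1]/M -[(_ * _) *: 1]/(_ * _ * 1) mulr1 -[_ *: (_ * _)]/(_ * (_ * _)).
  rewrite mulKf // exprS; field; rewrite gt_eqF // subr_gt0 //.
have f0 : f 0 = 0.
  rewrite /f subr0 ln1 addr0 big_nat big1 // => m /andP[m0 _].
  by rewrite expr0n gtn_eqF // mulr0.
have fc : {within `[0, x], continuous f}.
  apply: derivable_within_continuous => y; rewrite in_itv /= => /andP[_ yx].
  by case: (df y (le_lt_trans yx x1)).
have df' y : y \in `]0, x[ -> is_derive y (1 : R) f (- (y ^+ M / (1 - y))).
  by rewrite in_itv /= => /andP[_ yx]; apply: df; apply: lt_trans x1.
have [c] := MVT x0 df' fc; rewrite in_itv /= => /andP[c0 cx].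
rewrite f0 !subr0 -/(f x) => ->.
have c1 : 0 < 1 - c by lra.
have x10 : 0 < 1 - x by lra.
rewrite normrM normrN (ger0_norm (ltW x0)) ger0_norm; last first.
  by rewrite divr_ge0 ?exprn_ge0 ?ltW.
rewrite exprSr [leRHS]mulrAC ler_wpM2r //; first exact: ltW.
apply: ler_pM; rewrite ?exprn_ge0 ?invr_ge0 ?(ltW c0) ?(ltW c1) //.
  by rewrite lerXn2r ?nnegrE ?(ltW c0) ?(ltW x0) ?(ltW cx).
by rewrite lef_pV2 ?posrE //; lra.
Qed.

Lemma log_series_cvg (x : R) : 0 < x < 1 ->
  (fun M => \sum_(1 <= m < M.+1) m%:R^-1 * x ^+ m) @ \oo --> - ln (1 - x).
Proof.
move=> /[dup] x01 /andP[x0 x1].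
have c : (fun M => x ^+ M.+1 / (1 - x)) @ \oo --> 0.
  rewrite -[X in _ --> X](mul0r (1 - x)^-1); apply: cvgMl.
  by rewrite (cvg_shiftS (fun M => x ^+ M)); apply: cvg_expr; rewrite ger0_norm // ltW.
apply/cvgrPdist_le => e e0; near=> M.
rewrite -normrN opprB opprK; apply: le_trans (log_series_remainder M x01) _.
apply: le_trans (ler_norm _) _.
by near: M; move/cvgr0Pnorm_le : c; apply.
Unshelve. all: by end_near. Qed.

Lemma trunc_log_cvg : (fun n => trunc_log 2 n) @ \oo --> \oo.
Proof.
apply/cvgnyPge => A; near=> n; apply: trunc_log_max => //.
by near: n; exact: nbhs_infty_ge.
Unshelve. all: by end_near. Qed.

Lemma pow2_weight_npow_cvg e : 0 < e ->
  (fun N => \sum_(0 <= n < N) pow2_weight n * npow e n) @ \oo --> - ln (1 - npow e 2).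
Proof.
move=> e0; rewrite -cvg_shiftS /=.
have x01 : 0 < npow e 2 < 1.
  by rewrite npow_gt0 expR_lt1 oppr_lt0 mulr_gt0 // ln_gt0 // ltr1n.
have := cvg_comp _ _ trunc_log_cvg (log_series_cvg x01).
apply: cvg_trans; apply: near_eq_cvg; near=> N.
rewrite sum_pow2_weight; last by near: N; exact: nbhs_infty_gt.
rewrite /=; apply: eq_bigr => m _; congr (_ * _).
elim: m => [|m IH]; first by rewrite expr0 expn0 npow1.
by rewrite exprS expnS npowM ?expn_gt0 // IH.
Unshelve. all: by end_near. Qed.

Lemma npow2_slope (e : nat -> R) : (forall k, 0 < e k) -> e @ \oo --> 0 ->
  (fun k => (1 - npow (e k) 2) / e k) @ \oo --> ln 2.
Proof.
move=> e0 ec; have l0 : 0 < ln 2 :> R by rewrite ln_gt0 // ltr1n.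
have c1 : (fun k => ln 2 * npow (e k) 2) @ \oo --> ln 2 * 1.
  apply: cvgMr; rewrite -[X in _ --> X](npow0n R 2) /npow.
  apply: continuous_cvg; first exact: continuous_expR.
  by apply: cvgN; apply: cvgMl.
rewrite mulr1 in c1.
apply: (@squeeze_cvgr _ _ _ _ (fun k => ln 2 * npow (e k) 2) (cst (ln 2))) => //; last exact: cvg_cst.
near=> k; rewrite ler_pdivrMr ?ler_pdivlMr //=.
have h1 := expR_ge1Dx (- (e k * ln 2)); have h2 := expR_ge1Dx (e k * ln 2).
have h3 : npow (e k) 2 * expR (e k * ln 2) = 1 by rewrite /npow -expRD addNr expR0.
have h4 := ler_wpM2l (ltW (npow_gt0 (e k) 2)) h2.
rewrite h3 mulrDr mulr1 in h4; rewrite -/(npow (e k) 2) in h1.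
by apply/andP; split; lra.
Unshelve. all: by end_near. Qed.

End powers_of_two.

(** * The absolutely convergent part of the logarithm *)

Section euler_remainder.
Variables (R : realType) (q : nat).
Hypothesis q0 : (0 < q)%N.

Lemma neg_ln_bounds (y : R) : 0 <= y <= 2^-1 -> y <= - ln (1 - y) <= y + 2 * y ^+ 2.
Proof.
move=> /andP[y0 y1]; have y1' : 0 < 1 - y by lra.
have h1 : ln (1 - y) <= - y by apply: le_ln1Dx; lra.
have h2 : - ln (1 - y) <= y / (1 - y).
  have e1 : (1 - y)^-1 = 1 + y / (1 - y) by field; rewrite gt_eqF.
  rewrite -lnV // [X in ln X]e1; apply: le_ln1Dx.
  by apply: lt_le_trans (_ : 0 <= _); rewrite ?ltrN10 // divr_ge0 // ltW.
apply/andP; split; first lra.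
apply: le_trans h2 _; rewrite ler_pdivrMr //.
have : 0 <= y ^+ 2 * (1 - 2 * y) by rewrite mulr_ge0 ?sqr_ge0 //; lra.
have e2 : (y + 2 * y ^+ 2) * (1 - y) - y = y ^+ 2 * (1 - 2 * y) by ring.
by rewrite -[X in _ -> is_true X]subr_ge0 e2.
Qed.

(* What remains of the p-th term of [log_euler] once [phi / p ^ s] is removed for p = 1 mod q. *)
Definition euler_remainder (e : R) (p : nat) : R :=
  if prime p && coprime p q then
    - ((totient q %/ unit_order q p)%:R * ln (1 - (p%:R^-1 * npow e p) ^+ unit_order q p))
    - (if unit_order q p == 1%N then (totient q)%:R * (p%:R^-1 * npow e p) else 0)
  else 0.

(** For t = 1 the linear term of the logarithm has been removed and a quadratic one remains; for t
    >= 2 the argument w^t is itself at most w^2. The bound is free of e, as a uniform limit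
    requires. *)
Lemma euler_remainder_bound e p : 0 <= e ->
  0 <= euler_remainder e p <= 2 * (totient q)%:R * (p%:R^-1) ^+ 2.
Proof.
move=> e0; rewrite /euler_remainder.
have b0 : 0 <= 2 * (totient q)%:R * (p%:R^-1) ^+ 2 :> R.
  by rewrite mulr_ge0 ?mulr_ge0 ?ler0n // sqr_ge0.
case: ifP => [/andP[pp pq]|_]; last by rewrite lexx b0.
set w := p%:R^-1 * npow e p; set t := unit_order q p.
have w0 : 0 <= w := ltW (prime_weight_gt0 e pp).
have wh : w <= 2^-1 := prime_weight_le_half e0 pp.
have wle1 : w <= 1 by apply: le_trans wh _; rewrite invf_le1 ?ler1n.
have wp : w <= p%:R^-1 := prime_weight_le p e0.
have w2 : w ^+ 2 <= p%:R^-1 ^+ 2 by rewrite lerXn2r // nnegrE ?invr_ge0 ?ler0n.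
have phi0 : 0 <= (totient q)%:R :> R by [].
have phw := ler_wpM2l phi0 w2.
case: eqP => [t1|/eqP t1].
  have /andP[h1 h2] : w <= - ln (1 - w) <= w + 2 * w ^+ 2 by apply: neg_ln_bounds; rewrite w0.
  rewrite t1 divn1 expr1 -mulrN -mulrBr.
  have g1 : 0 <= - ln (1 - w) - w by lra.
  have g2 : - ln (1 - w) - w <= 2 * w ^+ 2 by lra.
  rewrite mulr_ge0 //=; apply: le_trans (ler_wpM2l phi0 g2) _.
  by rewrite mulrCA -[leRHS]mulrA ler_wpM2l.
have t2 : (2 <= t)%N by case: t t1 (order_gt0 (unit_of_nat q p) : 0 < t)%N => [|[]].
have yw : w ^+ t <= w ^+ 2 by rewrite ler_wiXn2l.
have y0 : 0 <= w ^+ t by rewrite exprn_ge0.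
have yh : w ^+ t <= 2^-1.
  by apply: le_trans yw _; apply: le_trans wh; rewrite expr2 ler_piMr.
have /andP[h1 h2] : w ^+ t <= - ln (1 - w ^+ t) <= w ^+ t + 2 * (w ^+ t) ^+ 2.
  by apply: neg_ln_bounds; rewrite y0.
have g2 : - ln (1 - w ^+ t) <= 2 * w ^+ 2.
  have q2 : 2 * (w ^+ t) ^+ 2 <= w ^+ t.
    by rewrite expr2 mulrA ler_piMl // -ler_pdivlMl // mulr1.
  apply: le_trans h2 _; apply: (@le_trans _ _ (w ^+ t + w ^+ t)); first by rewrite lerD2l.
  by rewrite mulr_natl mulr2n lerD.
have g1 : 0 <= - ln (1 - w ^+ t) := le_trans y0 h1.
rewrite subr0 -mulrN mulr_ge0 ?ler0n //=.
have kphi : (totient q %/ t)%:R <= (totient q)%:R :> R by rewrite ler_nat leq_div.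
apply: le_trans (ler_pM _ _ kphi g2) _ => //.
by rewrite mulrCA -[leRHS]mulrA ler_wpM2l.
Qed.

Lemma euler_remainder_cvg (e : nat -> R) p : (forall k, 0 <= e k) -> e @ \oo --> 0 ->
  (fun k => euler_remainder (e k) p) @ \oo --> euler_remainder 0 p.
Proof.
move=> e0 ec; rewrite /euler_remainder; case: ifP => [/andP[pp pq]|_]; last exact: cvg_cst.
have cw : (fun k => p%:R^-1 * npow (e k) p) @ \oo --> (p%:R^-1 * npow 0 p : R).
  apply: cvgMr; rewrite /npow; apply: continuous_cvg; first exact: continuous_expR.
  by apply: cvgN; apply: cvgMl.
apply: cvgB.
  apply: cvgN; apply: cvgMr; apply: continuous_cvg.
    apply: continuous_ln; apply: prime_weightX_gt0 => //; exact: order_gt0.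
  apply: cvgB; first exact: cvg_cst.
  by elim: (unit_order q p) => [|t IH]; [exact: cvg_cst|under eq_fun do rewrite exprS; rewrite exprS; apply: cvgM].
by case: ifP => _; [apply: cvgMr|exact: cvg_cst].
Qed.

Let tail_bound e M N : 0 <= e -> (0 < M)%N ->
  `|\sum_(M.+1 <= n < N) euler_remainder e n| <= 2 * (totient q)%:R * M%:R^-1.
Proof.
move=> e0 M0; rewrite ger0_norm; last first.
  by rewrite sumr_ge0 // => n _; case/andP: (euler_remainder_bound n e0).
have phi0 : 0 <= 2 * (totient q)%:R :> R by rewrite mulr_ge0 // ler0n.
apply: le_trans (ler_wpM2l phi0 (sum_inv_sqr_tail R N M0)).
by rewrite mulr_sumr; apply: ler_sum => n _; case/andP: (euler_remainder_bound n e0).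
Qed.

(* Weierstrass M-test, against the bound of [euler_remainder_bound]. *)
Lemma sum_euler_remainder : exists2 rho : R,
  series (euler_remainder 0) @ \oo --> rho &
  forall (e : nat -> R) d, (forall k, 0 <= e k) -> e @ \oo --> 0 -> 0 < d ->
    exists M, \forall k \near \oo, forall N, (M <= N)%N ->
      `|\sum_(0 <= n < N) euler_remainder (e k) n - rho| <= d.
Proof.
have phi0 : 0 <= 2 * (totient q)%:R :> R by rewrite mulr_ge0 // ler0n.
have c : cvgn (series (euler_remainder 0)).
  apply: (@abs_summable_cvg _ _ (2 * (totient q)%:R * (1 + 1))) => N.
  apply: (@le_trans _ _ (2 * (totient q)%:R * \sum_(0 <= n < N) n%:R^-1 ^+ 2)).
    rewrite mulr_sumr; apply: ler_sum => n _.
    by have /andP[h1 h2] := euler_remainder_bound n (lexx 0); rewrite ger0_norm.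
  rewrite ler_wpM2l //; case: N => [|[|N]]; first by rewrite big_geq // addr_ge0.
    by rewrite big_nat1 invr0 expr0n addr_ge0.
  rewrite big_ltn // big_ltn // invr0 expr0n add0r invr1 expr1n lerD2l.
  by have := sum_inv_sqr_tail R N.+2 (ltn0Sn 0); rewrite invr1.
exists (limn (series (euler_remainder 0))) => //; set rho := limn _ in c *.
move=> e d e0 ec d0.
(* Makes the tail beyond M at most d / 3 for every e; the finite part and the tail of the limit
   series take the other two thirds. *)
pose M := (Num.truncn (2 * (totient q)%:R * (3 / d))).+1.
have Mb : 2 * (totient q)%:R * M%:R^-1 <= d / 3.
  rewrite ler_pdivrMr ?ltr0n // -ler_pdivrMl ?divr_gt0 // invf_div mulrC.
  by apply: ltW; exact: truncnS_gt.
exists M.+1.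
have rhoM : `|\sum_(0 <= n < M.+1) euler_remainder 0 n - rho| <= d / 3.
  rewrite distrC; apply: (@cvg_norm_le _ (fun N => series (euler_remainder 0) N -
      \sum_(0 <= n < M.+1) euler_remainder 0 n)).
    by apply: cvgB => //; exact: cvg_cst.
  near=> N; rewrite /series /= sum_nat_sub; last by near: N; exact: nbhs_infty_ge.
  by apply: le_trans Mb; exact: tail_bound.
have fin : (fun k => \sum_(0 <= n < M.+1) euler_remainder (e k) n) @ \oo -->
    \sum_(0 <= n < M.+1) euler_remainder 0 n.
  elim: M.+1 => [|m IH].
    by rewrite big_geq //; under eq_fun do rewrite big_geq //; exact: cvg_cst.
  rewrite big_nat_recr //; under eq_fun do rewrite big_nat_recr //.
  by apply: cvgD => //; exact: euler_remainder_cvg.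
near=> k => N MN.
have h1 : `|\sum_(0 <= n < M.+1) euler_remainder 0 n -
    \sum_(0 <= n < M.+1) euler_remainder (e k) n| <= d / 3.
  by near: k; move/cvgrPdist_le : fin; apply; rewrite divr_gt0.
rewrite (@big_cat_nat _ _ _ M.+1 0 N) //=.
have h2 := le_trans (tail_bound N (e0 k) (ltn0Sn _ : (0 < M)%N)) Mb.
move: h1 h2 rhoM; rewrite !ler_norml => /andP[a1 a2] /andP[b1 b2] /andP[c1 c2].
by apply/andP; split; lra.
Unshelve. all: by end_near. Qed.

End euler_remainder.

Lemma ccvg_eps (R : realType) (u : nat -> R[i]) (l : R[i]) :
  (forall d, 0 < d -> \forall n \near \oo, `|u n - l| <= d%:C) -> ccvg u l.
Proof.
move=> ul; split; apply/cvgrPdist_le => d d0; near=> n; rewrite distrC.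
  by rewrite -ReB; apply: norm_Re_le; near: n; exact: ul.
by rewrite -ImB; apply: norm_Im_le; near: n; exact: ul.
Unshelve. all: by end_near. Qed.

Lemma ccvg1_norm_le2 (R : realType) (u : nat -> R[i]) : ccvg u 1 ->
  \forall n \near \oo, `|u n| <= 2%:C.
Proof.
move=> /ccvg_cvg/cvgrPdist_le/(_ 1 ltr01) h; near=> n.
rewrite -(subrK 1 (u n)); apply: le_trans (ler_normD _ _) _.
rewrite normr1 distrC -[2]/(1 + 1) rmorphD rmorph1 lerD2r.
by near: n.
Unshelve. all: by end_near. Qed.

Lemma expR_sub1_le (R : realType) (x d : R) : 0 <= d <= 2^-1 -> `|x| <= d ->
  `|expR x - 1| <= 2 * d.
Proof.
move=> /andP[d0 d2]; rewrite ler_norml => /andP[x1 x2].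
have h1 := expR_ge1Dx x; have h2 := expR_ge1Dx (- x).
have e0 := expR_gt0 x.
have ee : expR x * expR (- x) = 1 by rewrite -expRD subrr expR0.
have h3 : expR x * (1 - x) <= 1 by rewrite -[leRHS]ee ler_wpM2l // ltW.
rewrite ler_norml; apply/andP; split; first lra.
have h4 : expR x * (1 - d) <= 1 by apply: le_trans h3; rewrite ler_wpM2l ?(ltW e0) //; lra.
rewrite lerBlDr -(@ler_pM2r _ (1 - d)); last by lra.
apply: le_trans h4 _.
have : 0 <= d * (1 - 2 * d) by rewrite mulr_ge0 //; lra.
have e2 : (2 * d + 1) * (1 - d) - 1 = d * (1 - 2 * d) by ring.
by rewrite -[X in _ -> is_true X]subr_ge0 e2.
Qed.

(** * Primes congruent to 1 compared with powers of two *)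

Section excess.
Variables (R : realType) (q : nat).

Definition prime_excess (n : nat) : R :=
  (if prime n && (n == 1 %[mod q])%N then (totient q)%:R * n%:R^-1 else 0) - pow2_weight R n.

(** Weighted by ln n, both parts of the excess sum to ln N + O(1), so the differences are bounded;
    Dirichlet's test with the decreasing factor 1 / ln n removes the weight. *)
Lemma prime_excess_cvg (K : R) :
  (forall N, `|\sum_(1 <= p < N.+1 | prime p && (p == 1 %[mod q])%N)
     (totient q)%:R * (ln p%:R * p%:R^-1) - ln N%:R| <= K) -> cvgn (series prime_excess).
Proof.
move=> hK.
have K0 : 0 <= K := le_trans (normr_ge0 _) (hK 0%N).
have l2 : 0 <= ln 2 :> R := ln_nat_ge0 R 2.
have bnd N : `|\sum_(0 <= n < N) prime_excess n * ln n%:R| <= K + ln 2.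
  case: N => [|[|N]]; first by rewrite big_geq // normr0 addr_ge0.
    by rewrite big_nat1 ln0 // mulr0 normr0 addr_ge0.
  have -> : \sum_(0 <= n < N.+2) prime_excess n * ln n%:R =
     \sum_(1 <= p < N.+2 | prime p && (p == 1 %[mod q])%N)
     (totient q)%:R * (ln p%:R * p%:R^-1) - \sum_(0 <= n < N.+2) pow2_weight R n * ln n%:R.
    have -> : \sum_(1 <= p < N.+2 | prime p && (p == 1 %[mod q])%N)
        (totient q)%:R * (ln p%:R * p%:R^-1) = \sum_(0 <= n < N.+2)
        (if prime n && (n == 1 %[mod q])%N then (totient q)%:R * (ln n%:R * n%:R^-1) else 0) :> R.
      by rewrite big_mkcond [RHS]big_ltn //= add0r.
    rewrite -sumrB; apply: eq_bigr => n _; rewrite /prime_excess mulrBl; congr (_ - _).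
    by case: ifP => _; rewrite ?mul0r // -mulrA [_^-1 * _]mulrC.
  have /andP[p1 p2] := sum_pow2_weight_ln R (ltn0Sn N).
  have := hK N.+1; move: p1 p2; set X := \sum_(_ <= _ < _) _; set Y := \sum_(_ <= _ < _ | _) _.
  move: l2; set l := ln 2; set l' := ln _%:R; clearbody X Y l l'; clear hK.
  rewrite !ler_norml => l2 p1 p2 /andP[a1 a2]; apply/andP; split; lra.
(* The logarithm vanishes at 0 and 1, so these two terms are set aside before dividing by it. *)
pose a k := prime_excess k.+2 * ln k.+2%:R.
pose v k : R := (ln k.+2%:R)^-1.
have lnp k : 0 < ln k.+2%:R :> R by rewrite ln_gt0 // ltr1n.
have [] := @dirichlet_test R a v (K + ln 2).
- move=> n; have := bnd n.+2; rewrite 2?big_nat_recl // ln0 // ln1 !mulr0 !add0r.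
  by [].
- by move=> k; rewrite lef_pV2 ?posrE // ler_ln ?posrE ?ltr0n // ler_nat.
- by move=> k; rewrite invr_ge0 ltW.
- apply/cvgr0Pnorm_le => d d0; near=> k.
  rewrite ger0_norm; last by rewrite invr_ge0 ltW.
  rewrite -[leRHS]invrK lef_pV2 ?posrE ?invr_gt0 //.
  apply: le_trans (_ : ln k%:R <= _).
    by near: k; have /cvgryPge := @cvg_ln_nat R; apply.
  move: (k) => [|n]; first by rewrite ln0 // ltW.
  by rewrite ler_ln ?posrE ?ltr0n // ler_nat ltnW.
have e3 : series (fun k => a k * v k) = series (fun k => prime_excess k.+2).
  by apply/funext => N; apply: eq_bigr => k _; rewrite /a /v mulfK // gt_eqF.
move=> L; rewrite e3 => cL _.
apply/cvg_ex; exists (prime_excess 0 + (prime_excess 1 + L)).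
rewrite -cvg_shiftS -cvg_shiftS /=.
rewrite (_ : (fun n => _) = (fun N => prime_excess 0 + (prime_excess 1 +
    series (fun k => prime_excess k.+2) N))).
  by apply: cvgD; [exact: cvg_cst|apply: cvgD => //; exact: cvg_cst].
by apply/funext => N; rewrite /series /= 2?big_nat_recl.
Unshelve. all: by end_near. Qed.

Hypothesis q0 : (0 < q)%N.

Lemma unit_order_eq1 p : coprime p q -> (unit_order q p == 1%N) = (p == 1 %[mod q])%N.
Proof. by move=> pq; rewrite order_eq1 unit_of_nat_eq1. Qed.

Lemma log_euler_split e N :
  log_euler q e N - \sum_(0 <= n < N) pow2_weight R n * npow e n =
  \sum_(0 <= n < N) prime_excess n * npow e n + \sum_(0 <= n < N) euler_remainder q e n.
Proof.
rewrite /log_euler big_mkcond -sumrB -big_split /=; apply: eq_bigr => p _.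
rewrite /prime_excess /euler_remainder; have [pp|pp] /= := boolP (prime p); last first.
  by rewrite addr0 mulrBl mul0r.
have [pq|pq] := boolP (coprime p q).
  by rewrite unit_order_eq1 //; case: ifP => _; ring.
rewrite ifF; first by rewrite addr0 mulrBl mul0r.
by apply/negP => /modn1_coprime; rewrite (negPf pq).
Qed.

End excess.

(** * Interchange of the limits in e and N *)

Section mertens_limit.
Variables (R : realType) (q : nat) (chi : 'I_(totient q) -> nat -> R[i]).
Hypotheses (q0 : (0 < q)%N)
  (chiD : forall i, dirichlet_character q (chi i))
  (chiI : injective chi)
  (chiE : forall f, dirichlet_character q f -> exists i, f = chi i)
  (chiS : forall n, \sum_i chi i n = if (n == 1 %[mod q])%N then (totient q)%:R else 0)
  (chiP : forall p z, coprime p q -> (unit_order q p %| totient q)%N /\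
     \prod_i (1 - chi i p * z) =
     (1 - z ^+ unit_order q p) ^+ (totient q %/ unit_order q p)).
Variable i0 : 'I_(totient q).
Hypothesis chi0 : chi i0 = principal_character R q.

Let eps (k : nat) : R := k.+1%:R^-1.

Let eps_gt0 k : 0 < eps k. Proof. by rewrite invr_gt0 ltr0n. Qed.

Let eps_cvg : eps @ \oo --> 0. Proof. exact: cvg_harmonic. Qed.

Let G k := \prod_i L_value (chi i) (eps k) * (1 - npow (eps k) 2)%:C.

Let G_cvg : ccvg G ((ln 2 * ((totient q)%:R / q%:R))%:C *
  \prod_(i | i != i0) L_value (chi i) 0).
Proof.
have c1 : ccvg (fun k => (eps k)%:C * L_value (chi i0) (eps k)) ((totient q)%:R / q%:R)%:C.
  have [C hC] := L_value_principal R q0; rewrite -chi0 in hC.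
  apply: (@ccvg_bound _ _ _ (fun k => C * eps k)).
    by rewrite -(mulr0 C); apply: cvgMr.
  near=> k; apply: hC; rewrite eps_gt0 /= invf_le1 ?ltr0n //.
  by rewrite ler1n.
have c2 : ccvg (fun k => \prod_(i | i != i0) L_value (chi i) (eps k))
    (\prod_(i | i != i0) L_value (chi i) 0).
  apply: ccvg_prod => i ii0; have [C [_ _ _ hC]] := L_value_package q0 chiD chiI chi0 ii0.
  apply: (@ccvg_bound _ _ _ (fun k => C * eps k)).
    by rewrite -(mulr0 C); apply: cvgMr.
  by near=> k; apply: hC.
have c3 := ccvg_real (npow2_slope eps_gt0 eps_cvg).
have := ccvgM c3 (ccvgM c1 c2); rewrite mulrA -rmorphM /=.
apply: ccvg_near_eq; near=> k.
rewrite /G [X in _ = X * _](bigD1 i0) //=; have e0 : (eps k)%:C != 0 :> R[i].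
  by rewrite -[0]/(0%:C) (inj_eq (@complexI _)) gt_eqF.
rewrite rmorphM fmorphV /=; set a := (1 - _)%:C; set b := L_value _ _; set c := \prod_(_ | _) _.
by rewrite -!mulrA mulKf // [LHS]mulrC -mulrA.
Unshelve. all: by end_near. Qed.

Let V e N := log_euler q e N - \sum_(0 <= n < N) pow2_weight R n * npow e n.

(** For fixed e, exp (V e N) tends to G; the form with a limit 1 needs no logarithm of the complex
    number [G k]. *)
Let G_V k : ccvg (fun N => G k * (expR (- V (eps k) N))%:C) 1.
Proof.
have c1 := prod_L_value_euler q0 chiD chiP (eps_gt0 k).
have w1 : 0 < 1 - npow (eps k) 2.
  by rewrite subr_gt0 expR_lt1 oppr_lt0 mulr_gt0 // ln_gt0 // ltr1n.
have c2 : (fun N => expR (\sum_(0 <= n < N) pow2_weight R n * npow (eps k) n) *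
    (1 - npow (eps k) 2)) @ \oo --> (1 : R).
  rewrite -[X in _ --> X](mulVf (lt0r_neq0 w1)); apply: cvgMl.
  rewrite -[X in X^-1](lnK (w1 : _ \in Num.pos)) -expRN.
  by apply: continuous_cvg; [exact: continuous_expR|exact: pow2_weight_npow_cvg].
have := ccvgM c1 (ccvg_real c2); rewrite mulr1; apply: ccvg_near_eq; near=> N.
rewrite /G /V opprB addrC expRD !rmorphM /=; ring.
Unshelve. all: by end_near. Qed.

(** V e N is close to y for small e and large N, so G, its exponentiated limit in N, tends to exp y;
    [G_cvg] computes the same limit from the L-values. *)
Lemma log_euler_limit : exists2 y : R,
  (fun N => log_euler q 0 N - \sum_(0 <= n < N) pow2_weight R n) @ \oo --> y &
  (expR y)%:C = (ln 2 * ((totient q)%:R / q%:R))%:C *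
    \prod_(i | i != i0) L_value (chi i) 0.
Proof.
have [K hK] := mertens_progression q0 chiD chiI chiE chiS chiP chi0.
have /cvg_ex[D cD] := prime_excess_cvg hK.
have [rho crho hrho] := sum_euler_remainder R q.
pose y := D + rho; exists y.
  rewrite (_ : (fun N => _) = series (prime_excess R q) \+ series (euler_remainder q 0)).
    exact: cvgD cD crho.
  apply/funext => N /=; rewrite /series /=.
  have e1 : \sum_(0 <= n < N) pow2_weight R n = \sum_(0 <= n < N) pow2_weight R n * npow 0 n.
    by apply: eq_bigr => n _; rewrite npow0n mulr1.
  rewrite e1 (log_euler_split q0) addrC [RHS]addrC; congr (_ + _).
  by apply: eq_bigr => n _; rewrite npow0n mulr1.
(* Abel's theorem handles the excess, which converges only conditionally, and the uniform bound
   handles the remainder; each error is at most d / 3 apart from C * eps k, which tends to 0. *)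
have close d : 0 < d -> \forall k \near \oo, \forall N \near \oo, `|V (eps k) N - y| <= d.
  move=> d0; have d3 : 0 < d / 3 by rewrite divr_gt0.
  have [C [n0 hC]] := abel_uniform cD d3.
  have [M hM] := hrho eps (d / 3) (fun k => ltW (eps_gt0 k)) eps_cvg d3.
  have cC : (fun k => C * eps k) @ \oo --> 0 by rewrite -(mulr0 C); apply: cvgMr.
  near=> k; near=> N; rewrite /V log_euler_split //.
  have h1 : `|\sum_(0 <= n < N) prime_excess R q n * npow (eps k) n - D| <= C * eps k + d / 3.
    by apply: hC => //; [near: N; exact: nbhs_infty_ge|exact: ltW].
  have h2 : `|\sum_(0 <= n < N) euler_remainder q (eps k) n - rho| <= d / 3.
    have : (M <= N)%N by near: N; exact: nbhs_infty_ge.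
    by move: (N); near: k.
  have h3 : C * eps k <= d / 3.
    apply: le_trans (ler_norm _) _; near: k; move/cvgr0Pnorm_le : cC; apply; exact: d3.
  rewrite /y opprD addrACA; apply: le_trans (ler_normD _ _) _.
  by apply: le_trans (lerD h1 h2) _; lra.
have c1 : ccvg (fun k => G k * (expR (- y))%:C) 1.
  apply: ccvg_eps => d d0.
  (* The bound 1 / 2 is required by [expR_sub1_le]; the 4 is its factor 2 times the bound 2 on the
     factor that tends to 1. *)
  pose d' := Num.min (d / 4) 2^-1.
  have d'0 : 0 < d' by rewrite lt_min divr_gt0 //= invr_gt0.
  have d'd : 4 * d' <= d.
    have : d' <= d / 4 by rewrite ge_min lexx.
    by lra.
  near=> k; apply: le_trans (_ : (4 * d')%:C <= _); last by rewrite lecR.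
  apply: (@ccvg_norm_le _ (fun N => G k * (expR (- y))%:C - G k * (expR (- V (eps k) N))%:C)).
    by apply: ccvgB; [exact: ccvg_cst|exact: G_V].
  near=> N; have -> : G k * (expR (- y))%:C - G k * (expR (- V (eps k) N))%:C =
      G k * (expR (- V (eps k) N))%:C * (expR (V (eps k) N - y) - 1)%:C.
    rewrite -mulrBr -mulrA -rmorphM -rmorphB /=; congr (_ * _%:C).
    by rewrite mulrBr mulr1 -expRD addrA addNr add0r.
  have -> : 4 * d' = 2 * (2 * d') by lra.
  apply: norm_mul_le; first by near: N; exact: ccvg1_norm_le2 (G_V k).
  rewrite norm_real_complex lecR; apply: expR_sub1_le.
    by rewrite ltW //= /d' ge_min lexx orbT.
  by near: N; near: k; exact: close.
have := ccvgM G_cvg (ccvg_cst (expR (- y))%:C) => /ccvg_unique/(_ c1) E.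
have ey : (expR (- y))%:C * (expR y)%:C = 1 :> R[i].
  by rewrite -rmorphM -expRD addNr expR0.
by rewrite -[LHS]mul1r -[X in X * _]E -[LHS]mulrA [X in _ * X]ey mulr1.
Unshelve. all: by end_near. Qed.

End mertens_limit.

(** * The Mertens constant *)

Section class_products.
Variables (R : realType) (q : nat).
Hypothesis q0 : (0 < q)%N.

Definition class_remainder (b : {unit 'Z_q}) (p : nat) : R :=
  if prime_in_class q (FinRing.uval b) p then euler_remainder q 0 p else 0.

Lemma prime_in_class_unit (b : {unit 'Z_q}) p : b != 1%g ->
  prime_in_class q (FinRing.uval b) p =
  [&& prime p, coprime p q & unit_of_nat q p == b].
Proof.
move=> b1; have q1 : (1 < q)%N.
  by rewrite ltnNge; apply: contra b1 => q1; rewrite (unit_Z1_eq q0 b 1%g q1).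
rewrite /prime_in_class; case: (prime p) => //=.
have [pq|pq] /= := boolP (coprime p q); first by rewrite unit_of_nat_eq.
apply/negP => /eqP pb; move: pq; rewrite -coprime_modl pb coprime_modl.
by rewrite coprime_uval.
Qed.

(** For b <> 1 nothing was subtracted in [euler_remainder], so it is the logarithm of the factor at
    p; the real exponent phi / t is an integer since t divides phi. *)
Lemma class_partial_prodE (b : {unit 'Z_q}) n : b != 1%g ->
  class_partial_prod R b n = expR (\sum_(0 <= p < n) class_remainder b p).
Proof.
move=> b1; have bt : (#[b]%g %| totient q)%N.
  by rewrite -(card_units_Zp q0) order_dvdG // inE.
rewrite /class_partial_prod expR_sum big_mkcond; apply: eq_bigr => p _.
rewrite /class_remainder; case: ifP => [|_]; last by rewrite expR0.
rewrite prime_in_class_unit // => /and3P[pp pq /eqP pb].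
have tb : unit_order q p = #[b]%g by rewrite /unit_order pb.
have t0 : (0 < #[b]%g)%N := order_gt0 b.
have := prime_weightX_gt0 (lexx (0 : R)) pp t0.
rewrite /euler_remainder pp pq tb order_eq1 (negPf b1) subr0 npow0n mulr1 exprVn => w0.
have -> : (totient q)%:R / #[b]%g%:R = (totient q %/ #[b]%g)%:R :> R.
  by rewrite -[in LHS](divnK bt) natrM mulfK // pnatr_eq0 -lt0n.
by rewrite /powR gt_eqF // mulNr.
Qed.

Lemma class_remainder_cvg (b : {unit 'Z_q}) : cvgn (series (class_remainder b)).
Proof.
have [rho crho _] := sum_euler_remainder R q.
apply: (@abs_summable_cvg _ _ (limn (series (euler_remainder q (0 : R))))) => N.
have er0 p := andP (euler_remainder_bound q p (lexx (0 : R))).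
apply: (@le_trans _ _ (series (euler_remainder q (0 : R)) N)).
  apply: ler_sum => p _; rewrite /class_remainder; have [e0 _] := er0 p.
  by case: ifP => _; rewrite ?normr0 // ger0_norm.
apply: nondecreasing_cvgn_le; last by apply/cvg_ex; exists rho.
move=> m n mn; rewrite /series /= -subr_ge0 sum_nat_sub // sumr_ge0 // => p _.
by case: (er0 p).
Qed.

Lemma class_partial_prod_cvg (b : {unit 'Z_q}) : b != 1%g ->
  class_partial_prod R b @ \oo --> expR (limn (series (class_remainder b))).
Proof.
move=> b1; rewrite (_ : class_partial_prod R b = expR \o series (class_remainder b)).
  by apply: continuous_cvg; [exact: continuous_expR|exact: class_remainder_cvg].
by apply/funext => n; rewrite class_partial_prodE.
Qed.

Lemma sum_class_remainder p :
  \sum_(b in (units_Zp q :\ 1)%g) class_remainder b p =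
  if [&& prime p, coprime p q & unit_of_nat q p != 1%g] then euler_remainder q 0 p else 0.
Proof.
rewrite (eq_bigr (fun b => if [&& prime p, coprime p q & unit_of_nat q p == b]
    then euler_remainder q 0 p else 0)); last first.
  by move=> b; rewrite !inE andbT => b1; rewrite /class_remainder prime_in_class_unit.
case: (prime p); last by rewrite big1.
case: (coprime p q); last by rewrite big1.
rewrite /= -big_mkcondr /=; case: eqVneq => c1.
  by rewrite big1 // => b; rewrite !inE c1 => /andP[/andP[/negPf b1 _]]; rewrite eq_sym b1.
rewrite (big_pred1 (unit_of_nat q p)) // => b; rewrite !inE andbT /= [RHS]eq_sym.
by case: (eqVneq _ b) => [<-|_]; rewrite ?c1 ?andbF.
Qed.

(** Checked prime by prime: outside the class of 1 the class product cancels the term of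
    [log_euler], and primes dividing q occur nowhere. *)
Lemma mertens_product_split N :
  (\prod_(0 <= p < N | prime_in_class q 1 p) (1 - p%:R^-1 : R)) ^+ totient q =
  expR (- log_euler q 0 N) * \prod_(b in (units_Zp q :\ 1)%g) class_partial_prod R b N.
Proof.
have cE b : b \in (units_Zp q :\ 1)%g ->
    class_partial_prod R b N = expR (\sum_(0 <= p < N) class_remainder b p).
  by rewrite !inE andbT => b1; exact: class_partial_prodE.
rewrite (eq_bigr _ cE) -expR_sum -expRD exchange_big /= /log_euler -sumrN.
rewrite [X in X + _]big_mkcond -big_split /= expR_sum -prodrXl [LHS]big_mkcond.
apply: eq_bigr => p _; rewrite sum_class_remainder /prime_in_class.
have [pp|pp] /= := boolP (prime p); last by rewrite addr0 expR0.
have [pq|pq] /= := boolP (coprime p q); last first.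
  rewrite addr0 expR0; case: ifP => // /modn1_coprime.
  by rewrite (negPf pq).
rewrite -unit_of_nat_eq1 // opprK; case: eqVneq => [c1|c1] /=.
  have := prime_weightX_gt0 (lexx (0 : R)) pp (ltn0Sn 0).
  rewrite /unit_order c1 order1 divn1 npow0n mulr1 expr1 addr0 => w0.
  by rewrite expRM_natl lnK.
rewrite /euler_remainder pp pq /= /unit_order order_eq1 (negPf c1) subr0.
by rewrite addrN expR0.
Qed.

End class_products.

Lemma truncn_cvg (R : realType) : (fun x : R => Num.truncn x) @ +oo --> \oo.
Proof.
apply/cvgnyPge => A; near=> x; rewrite truncn_ge_nat.
  by near: x; apply: nbhs_pinfty_ge; exact: num_real.
by near: x; apply: nbhs_pinfty_ge; exact: num_real.
Unshelve. all: by end_near. Qed.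

Lemma ln_div_trunc_log_cvg (R : realType) :
  (fun x : R => ln x / (trunc_log 2 (Num.truncn x))%:R) @ +oo --> (ln 2 : R).
Proof.
have ct : (fun x : R => trunc_log 2 (Num.truncn x)) @ +oo --> \oo.
  exact: cvg_comp (@truncn_cvg R) trunc_log_cvg.
have ci : (fun n => n%:R^-1 : R) @ \oo --> (0 : R).
  by rewrite -cvg_shiftS; exact: cvg_harmonic.
have c1 : (fun x : R => ln 2 * (1 + (trunc_log 2 (Num.truncn x))%:R^-1)) @ +oo -->
    (ln 2 * (1 + 0) : R).
  apply: cvgMr; apply: cvgD; first exact: cvg_cst.
  exact: cvg_comp ct ci.
rewrite addr0 mulr1 in c1.
apply: (@squeeze_cvgr _ _ _ _ (cst (ln 2))
  (fun x : R => ln 2 * (1 + (trunc_log 2 (Num.truncn x))%:R^-1))) => //; last exact: cvg_cst.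
near=> x; have x2 : 2 <= x by near: x; apply: nbhs_pinfty_ge; exact: num_real.
have x0 : 0 < x by lra.
have n2 : (2 <= Num.truncn x)%N by rewrite truncn_ge_nat // ltW.
have /andP[tx xt] := truncn_itv (ltW x0).
have T0 : (0 < trunc_log 2 (Num.truncn x))%N by exact: trunc_log_max.
have /andP[l1 l2] := @trunc_log_bounds 2 _ isT (ltnW n2).
have TR : 0 < (trunc_log 2 (Num.truncn x))%:R :> R by rewrite ltr0n.
rewrite ler_pdivrMr // ler_pdivlMr // -mulrA mulrDl mul1r mulVf ?gt_eqF //=.
rewrite natr1 !mulr_natr -!lnXn // !ler_ln ?posrE ?exprn_gt0 // -!natrX.
apply/andP; split; first by apply: le_trans tx; rewrite ler_nat.
by apply: le_trans (ltW xt) _; rewrite ler_nat.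
Unshelve. all: by end_near. Qed.

Section mertens_constant.
Variables (R : realType) (q : nat).
Hypothesis q0 : (0 < q)%N.

Lemma mertens_constantX (y : R) :
  (fun N => log_euler q 0 N - \sum_(0 <= n < N) pow2_weight R n) @ \oo --> y ->
  mertens_constant R q 1 ^+ totient q = ln 2 * (expR (- euler_gamma R) * (expR (- y) *
    \prod_(b in (units_Zp q :\ 1)%g) limn (class_partial_prod R b))).
Proof.
move=> cy; set l := RHS.
have phin : (totient q)%:R != 0 :> R by rewrite pnatr_eq0 -lt0n totient_gt0.
have l0 : 0 < l.
  rewrite /l mulr_gt0 ?ln_gt0 ?ltr1n // mulr_gt0 ?expR_gt0 // mulr_gt0 ?expR_gt0 //.
  apply: prodr_gt0 => b; rewrite !inE andbT => b1.
  by rewrite (cvg_lim _ (class_partial_prod_cvg q0 b1)) ?expR_gt0.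
pose M N : R := \prod_(0 <= p < N | prime_in_class q 1 p) (1 - p%:R^-1).
have M0 N : 0 < M N.
  apply: prodr_gt0 => p /andP[pp _]; have := prime_weightX_gt0 (lexx (0 : R)) pp (ltn0Sn 0).
  by rewrite expr1 npow0n mulr1.
(* Three convergent factors: harmonic sum minus logarithm at the number of powers of two up to n (1
   excluded), the limit y, and the class products. *)
pose g n : R := expR (- (\sum_(1 <= k < (trunc_log 2 n).+1) k%:R^-1 - ln (trunc_log 2 n)%:R)) *
  (expR (- (log_euler q 0 n.+1 - \sum_(0 <= k < n.+1) pow2_weight R k)) *
   \prod_(b in (units_Zp q :\ 1)%g) class_partial_prod R b n.+1).
have cg : g @ \oo --> expR (- euler_gamma R) * (expR (- y) *
    \prod_(b in (units_Zp q :\ 1)%g) limn (class_partial_prod R b)).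
  apply: cvgM.
    apply: continuous_cvg; first exact: continuous_expR.
    by apply: cvgN; exact: (cvg_comp _ _ trunc_log_cvg (@euler_gamma_cvg R)).
  apply: cvgM.
    apply: continuous_cvg; first exact: continuous_expR.
    apply: cvgN.
    by rewrite (cvg_shiftS (fun N => log_euler q 0 N - \sum_(0 <= n < N) pow2_weight R n)).
  rewrite (cvg_shiftS (fun N => \prod_(b in (units_Zp q :\ 1)%g) class_partial_prod R b N)).
  move: (index_enum _) => r; elim: r => [|b r IH].
    by rewrite big_nil; under eq_fun do rewrite big_nil; exact: cvg_cst.
  rewrite big_cons; under eq_fun do rewrite big_cons.
  case: ifP => [|_]; last exact: IH.
  rewrite !inE andbT => b1; apply: cvgM; last exact: IH.
  by apply/cvg_ex; exists (expR (limn (series (class_remainder R b)))); exact: class_partial_prod_cvg.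
(* The sum X of the weights is the harmonic sum of the first factor of g, so it cancels against the
   second, leaving the factor T that ln x / T compensates. *)
have gE (x : R) : (2 <= Num.truncn x)%N -> ln x * M (Num.truncn x).+1 ^+ totient q =
    ln x / (trunc_log 2 (Num.truncn x))%:R * g (Num.truncn x).
  rewrite /M (mertens_product_split R q0) /g => n2.
  have T0 : (0 < trunc_log 2 (Num.truncn x))%N by exact: trunc_log_max.
  have := sum_pow2_weight (fun _ => 1 : R) (ltnW n2).
  rewrite -mulr_suml mulr1 -mulr_suml mulr1 => ->; set X := \sum_(_ <= _ < _) _; set E := log_euler _ _ _.
  set P := \prod_(_ in _) _; set T : R := _%:R.
  have TT : 0 < T by rewrite ltr0n.
  have -> : expR (- (X - ln T)) = T * expR (- X) by rewrite opprB expRD lnK.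
  have -> : expR (- (E - X)) = expR (- E) * expR X by rewrite opprB addrC expRD.
  have eX : expR (- X) * expR X = 1 by rewrite -expRD addNr expR0.
  transitivity (ln x * (T^-1 * T) * (expR (- X) * expR X * (expR (- E) * P))).
    by rewrite mulVf ?gt_eqF // eX mulr1 mul1r.
  by ring.
have cM : (fun x : R => ln x * M (Num.truncn x).+1 ^+ totient q) @ +oo --> l.
  have : (fun x : R => ln x / (trunc_log 2 (Num.truncn x))%:R * g (Num.truncn x)) @ +oo --> l.
    by apply: cvgM; [exact: ln_div_trunc_log_cvg|exact: cvg_comp (@truncn_cvg R) cg].
  apply: cvg_trans; apply: near_eq_cvg; near=> x; rewrite gE //.
  have x2 : 2 <= x by near: x; apply: nbhs_pinfty_ge; exact: num_real.
  by rewrite truncn_ge_nat //; apply: le_trans x2.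
(* The phi-th root is taken as exp of ln divided by phi, continuous at l because l > 0. *)
have cm : (fun x : R => ln x `^ ((totient q)%:R^-1) * M (Num.truncn x).+1) @ +oo -->
    l `^ ((totient q)%:R^-1).
  have : (fun x : R => expR ((totient q)%:R^-1 *
      ln (ln x * M (Num.truncn x).+1 ^+ totient q))) @ +oo -->
      expR ((totient q)%:R^-1 * ln l).
    apply: continuous_cvg; first exact: continuous_expR.
    by apply: cvgMr; apply: continuous_cvg => //; exact: continuous_ln.
  rewrite [l `^ _]/powR gt_eqF //; apply: cvg_trans; apply: near_eq_cvg; near=> x.
  have lx : 0 < ln x.
    by apply: ln_gt0; near: x; apply: nbhs_pinfty_gt; exact: num_real.
  have Mx := M0 (Num.truncn x).+1; have Mx' := ltW Mx.
  transitivity ((ln x * M (Num.truncn x).+1 ^+ totient q) `^ ((totient q)%:R^-1)).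
    by rewrite /powR gt_eqF // mulr_gt0 // exprn_gt0.
  rewrite powRM ?exprn_ge0 //; last exact: ltW.
  by rewrite -powR_mulrn // -powRrM mulfV // powRr1.
rewrite /mertens_constant (cvg_lim _ cm) // -powR_mulrn ?powR_ge0 //.
by rewrite -powRrM mulVf // powRr1 // ltW.
Unshelve. all: by end_near. Qed.

End mertens_constant.

Lemma Pi_q1_prod (R : realType) (q : nat) (chi : 'I_(totient q) -> nat -> R[i]) i0 :
  (0 < q)%N -> (forall i, dirichlet_character q (chi i)) -> injective chi ->
  (forall f, dirichlet_character q f -> exists i, f = chi i) ->
  chi i0 = principal_character R q ->
  Pi_q1 R q = (\prod_(i | i != i0) L_value (chi i) 0)^-1.
Proof.
move=> q0 chiD chiI chiE chi0; rewrite /Pi_q1 -prodfV.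
have -> : [set f : nat -> R[i] | dirichlet_character q f /\ f <> principal_character R q] =
    chi @` [set` [seq i <- enum 'I_(totient q) | i != i0]].
  apply/seteqP; split => f /=.
    move=> [fD fn]; have [i fi] := chiE _ fD; exists i => //=.
    rewrite mem_filter mem_enum andbT; apply: contra_notN fn => /eqP ii0.
    by rewrite fi ii0.
  move=> [i /=]; rewrite mem_filter => /andP[ii0 _] <-; split; first exact: chiD.
  exact: (chi_nonprincipal chiI chi0 ii0).
rewrite fsbig_image; last by move=> i j _ _; exact: chiI.
transitivity (\prod_(i <- [seq i <- enum 'I_(totient q) | i != i0]) (dirichlet_L 1 (chi i))^-1).
  have u : uniq [seq i <- enum 'I_(totient q) | i != i0] by rewrite filter_uniq // enum_uniq.
  exact: esym (fsbig_seq _ _ u).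
rewrite big_filter big_enum_cond /=; apply: eq_bigr => i ii0; congr (_^-1).
exact: (dirichlet_L_value q0 (chiD i) (chi_nonprincipal chiI chi0 ii0)).
Qed.

Theorem mainTheorem1 (R : realType) (q : nat) (hq : (0 < q)%N) :
  (forall b : {unit 'Z_q}, b \in (units_Zp q :\ 1)%g ->
     cvgn (class_partial_prod R b))
  /\ (mertens_c R q 1)%:C
     = Pi_q1 R q *
       (\prod_(b in (units_Zp q :\ 1)%g) limn (class_partial_prod R b))%:C.
Proof.
split=> [b|].
  rewrite !inE andbT => b1; apply/cvg_ex.
  by exists (expR (limn (series (class_remainder R b)))); exact: class_partial_prod_cvg.
have [chi [chiD chiI chiE chiS chiP]] := dirichlet_characters_enum R hq.
have [i0 ci0] := chiE _ (principal_dirichlet R q); have chi0 := esym ci0.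
have [y cy ey] := log_euler_limit hq chiD chiI chiE chiS chiP chi0.
rewrite (Pi_q1_prod hq chiD chiI chiE chi0) /mertens_c (mertens_constantX hq cy).
set P := \prod_(_ in _) _; set L := \prod_(_ | _) _ in ey *; set c := _ / _ in ey *.
have L0 : L != 0.
  by apply/prodf_neq0 => i ii0; exact: (L_value_neq0 hq chiD chiI chiE chiP chi0 ii0).
have c0 : ln 2 * c != 0.
  rewrite gt_eqF // mulr_gt0 ?ln_gt0 ?ltr1n // divr_gt0 ?ltr0n // totient_gt0 //.
have eg : expR (- euler_gamma R) * expR (euler_gamma R) = 1 by rewrite -expRD addNr expR0.
(* Euler's constant cancels here; then [ey] cancels ln 2 * c against exp y, and no trace of the
   powers of two remains. *)
have -> : ln 2 * (expR (- euler_gamma R) * (expR (- y) * P)) * expR (euler_gamma R) * c =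
    ln 2 * c * (expR y)^-1 * P.
  rewrite -expRN; transitivity (expR (- euler_gamma R) * expR (euler_gamma R) *
    (ln 2 * c * expR (- y) * P)); first by ring.
  by rewrite eg mul1r.
have c0' : (ln 2 * c)%:C != 0 :> R[i] by rewrite -[0]/(0%:C) (inj_eq (@complexI _)).
rewrite rmorphM rmorphM fmorphV /= ey invfM mulrA mulfV // mul1r //.
Qed.
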